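(* If $A$ is a purely infinite, simple, unital C*-algebra then $K_0(A)$, considered as an ordered group with order unit, is in $A^{\mathrm{eq}}$. In particular, if $A\prec B$ then $K_0(A)$ is an elementary submodel of $K_0(B)$, considered as ordered groups with order unit.
   Context: Continuous logic for C*-algebras: a unital C*-algebra $A$ is a metric structure whose sorts are the balls $\{a:\|a\|\le n\}$, $n\in\mathbb N$, with metric $\|x-y\|$, and functions the restrictions of $+,\cdot,{}^*$, scalar multiplications, the constants $0,1$, and inclusions between balls; formulas are built from distances between *-polynomial terms by applying continuous functions $\mathbb R^n\to\mathbb R$ and $\sup_x,\inf_x$ over the sorts; $\varphi^A(\bar a)$ is the value. $A\prec B$ ($A$ is an elementary submodel of $B$) if $A\subseteq B$ and $\varphi^A(\bar a)=\varphi^B(\bar a)$ for all formulas $\varphi$ and $\bar a$ in $A$. A definable predicate relative to a theory is a limit of formulas uniform over all models of the theory; a definable set is a uniform assignment $A\mapsto X(A)$ of closed subsets of a finite product of sorts such that for every formula $\psi(\bar x,\bar y)$, $\sup_{\bar x\in X(A)}\psi$ and $\inf_{\bar x\in X(A)}\psi$ are definable predicates. $A^{\mathrm{eq}}$ is the structure obtained from $A$ by iteratively adding as new (imaginary) sorts: countable products of sorts with their projections; definable sets; and quotients of sorts (or finite products of sorts) by definable pseudometrics (with the quotient maps). A structure is in $A^{\mathrm{eq}}$ if its universe is such a sort and its operations and relations are definable. $A$ is purely infinite and simple if $\dim A>1$ and for all nonzero positive $a,b$ there are $x_n$ with $\|x_nax_n^*-b\|\to0$. $K_0(A)$ is the Grothendieck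 group of the Murray--von Neumann semigroup $V(A)$ of equivalence classes of projections in $A\otimes\mathcal K$ ($\mathcal K$ the compact operators), considered as an ordered group with distinguished order unit, $(K_0(A),K_0^+(A),[1_A])$, where $K_0^+(A)$ is the image of $V(A)$. It is a discrete structure; ''elementary submodel'' for these groups is the usual first-order notion, via the map induced by $A\subseteq B$. *)

(* Defs.v *)
From HB Require Import structures.
From mathcomp Require Import all_boot all_order all_algebra.
From mathcomp Require Import complex.
From mathcomp Require Import all_classical all_reals all_analysis.

Set Implicit Arguments.
Unset Strict Implicit.
Unset Printing Implicit Defensive.

Import Order.TTheory GRing.Theory Num.Theory.
Import numFieldNormedType.Exports.

Local Open Scope classical_set_scope.
Local Open Scope ring_scope.
Local Open Scope complex_scope.

(** * Quotients by an equivalence relation *)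

Definition quot (T : Type) (E : T -> T -> Prop) : Type :=
  {C : set T | exists x, C = E x}.

Definition cls (T : Type) (E : T -> T -> Prop) (x : T) : quot E :=
  exist _ (E x) (ex_intro _ x erefl).

Definition repr (T : Type) (E : T -> T -> Prop) (C : quot E) : T :=
  projT1 (cid (proj2_sig C)).

(** * Unital C*-algebras *)

(* The library's algebras satisfy [1 != 0], so the zero algebra is excluded. *)
HB.mixin Record isCStarAlgebra (R : realType) A of GRing.Algebra R[i] A := {
  cnorm : A -> R;
  star : A -> A;
  cnorm_eq0 : forall x, cnorm x = 0 -> x = 0;
  cnormD : forall x y, cnorm (x + y) <= cnorm x + cnorm y;
  cnormZ : forall (c : R[i]) x, cnorm (c *: x) = complex.Re `|c| * cnorm x;
  cnormM : forall x y, cnorm (x * y) <= cnorm x * cnorm y;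
  starK : involutive star;
  starD : {morph star : x y / x + y};
  starZ : forall (c : R[i]) x, star (c *: x) = (c^*)%C *: star x;
  starM : forall x y, star (x * y) = star y * star x;
  cstar_identity : forall x, cnorm (star x * x) = cnorm x ^+ 2;
  cnorm_complete : forall u : nat -> A,
    (forall eps : R, 0 < eps -> exists N : nat, forall m n,
       (N <= m)%N -> (N <= n)%N -> cnorm (u m - u n) < eps) ->
    exists l : A, (fun n => cnorm (u n - l)) @ \oo --> (0 : R)
}.

#[short(type="cstarType")]
HB.structure Definition CStarAlgebra (R : realType) :=
  { A of isCStarAlgebra R A & GRing.Algebra R[i] A }.

Lemma star1 (R : realType) (A : cstarType R) : star (1 : A) = 1.
Proof. by have := starM (star 1) (1 : A); rewrite mulr1 starK mulr1. Qed.

Lemma star0 (R : realType) (A : cstarType R) : star (0 : A) = 0.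
Proof. by apply: (addIr (star (0 : A))); rewrite -starD !add0r. Qed.

Lemma cnorm0 (R : realType) (A : cstarType R) : cnorm (0 : A) = 0.
Proof. by rewrite -(scale0r (0 : A)) cnormZ normr0 mul0r. Qed.

Lemma cnorm_ge0 (R : realType) (A : cstarType R) (x : A) : 0 <= cnorm x.
Proof.
have := cnormD x (- x); rewrite subrr cnorm0 -scaleN1r cnormZ normrN normr1.
by rewrite mul1r -mulr2n pmulrn_lge0.
Qed.

Lemma cnorm_star (R : realType) (A : cstarType R) (x : A) :
  cnorm (star x) = cnorm x.
Proof.
have le_star (y : A) : cnorm y <= cnorm (star y).
  have [y0|] := ltP 0 (cnorm y).
    by rewrite -(ler_pM2r y0) -expr2 -cstar_identity cnormM.
  by move=> /le_trans; apply; exact: cnorm_ge0.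
by apply/eqP; rewrite eq_le le_star andbT -{2}[x]starK le_star.
Qed.

Lemma cnorm1 (R : realType) (A : cstarType R) : cnorm (1 : A) = 1.
Proof.
have n1 : cnorm (1 : A) != 0.
  by apply/eqP => /cnorm_eq0 /eqP; rewrite oner_eq0.
have := cstar_identity (1 : A); rewrite star1 mulr1 expr2.
by rewrite -{1}[cnorm 1]mulr1 => /(mulfI n1).
Qed.

Definition positive (R : realType) (A : cstarType R) (a : A) : Prop :=
  exists y : A, a = star y * y.

Definition purely_infinite_simple (R : realType) (A : cstarType R) : Prop :=
  ~ (exists e : A, forall x : A, exists c : R[i], x = c *: e) /\
  forall a b : A, positive a -> a != 0 -> positive b -> b != 0 ->
    exists x : nat -> A,
      (fun n => cnorm (x n * a * star (x n) - b)) @ \oo --> (0 : R).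

(** * Many-sorted metric structures, given uniformly over a class of models *)

Fixpoint env (S : Type) (C : S -> Type) (G : seq S) : Type :=
  if G is s :: G' then (C s * env C G')%type else unit.

Inductive var (S : Type) : seq S -> S -> Type :=
| VZ s G : var (s :: G) s
| VS t s G : var G s -> var (t :: G) s.

Fixpoint lookup (S : Type) (C : S -> Type) (G : seq S) (s : S)
    (v : var G s) : env C G -> C s :=
  match v in var G s return env C G -> C s with
  | VZ _ _ => fun e => e.1
  | VS _ _ _ v => fun e => lookup v e.2
  end.

Fixpoint env_cat (S : Type) (C : S -> Type) (G D : seq S) :
    env C G -> env C D -> env C (G ++ D) :=
  match G return env C G -> env C D -> env C (G ++ D) with
  | [::] => fun _ e' => e'
  | s :: G' => fun e e' => (e.1, env_cat e.2 e')
  end.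

Fixpoint env_map (S : Type) (C C' : S -> Type) (f : forall s, C s -> C' s)
    (G : seq S) : env C G -> env C' G :=
  match G return env C G -> env C' G with
  | [::] => id
  | s :: G' => fun e => (f s e.1, env_map f e.2)
  end.

(* An environment for [map h G] is one for [G], with sorts reindexed by [h]. *)
Fixpoint env_reindex (S S' : Type) (h : S -> S') (C : S' -> Type)
    (G : seq S) : env C (map h G) -> env (C \o h) G :=
  match G return env C (map h G) -> env (C \o h) G with
  | [::] => id
  | s :: G' => fun e => (e.1, env_reindex e.2)
  end.

(* The maximum metric on a finite product of sorts. *)
Fixpoint env_dist (R : realType) (S : Type) (C : S -> Type)
    (d : forall s, C s -> C s -> R) (G : seq S) : env C G -> env C G -> R :=
  match G return env C G -> env C G -> R with
  | [::] => fun _ _ => 0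
  | s :: G' => fun e e' => Num.max (d s e.1 e'.1) (env_dist d e.2 e'.2)
  end.

(* A language without relation symbols other than the metrics of the sorts,
   together with its interpretation in every member of the class [K]. *)
Record mstruct (R : realType) (K : Type) := MStruct {
  srt : Type;
  car : K -> srt -> Type;
  dst : forall M s, car M s -> car M s -> R;
  fn : Type;
  dom : fn -> seq srt;
  cod : fn -> srt;
  app : forall M f, env (car M) (dom f) -> car M (cod f)
}.

Inductive term (R : realType) (K : Type) (L : mstruct R K)
    (G : seq (srt L)) : srt L -> Type :=
| TVar s : var G s -> term G s
| TApp (f : fn L) : terms G (dom f) -> term G (cod f)
with terms (R : realType) (K : Type) (L : mstruct R K)
    (G : seq (srt L)) : seq (srt L) -> Type :=
| TNil : terms G [::]
| TCons s D : term G s -> terms G D -> terms G (s :: D).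

Inductive formula (R : realType) (K : Type) (L : mstruct R K) :
    seq (srt L) -> Type :=
| FDist G s : term G s -> term G s -> formula G
| FConn G n (u : 'rV[R]_n -> R) :
    continuous u -> ('I_n -> formula G) -> formula G
| FSup G s : formula (s :: G) -> formula G
| FInf G s : formula (s :: G) -> formula G.

Fixpoint teval (R : realType) (K : Type) (L : mstruct R K) (M : K)
    (G : seq (srt L)) (e : env (car M) G) (s : srt L) (t : term G s) :
    car M s :=
  match t in term _ s return car M s with
  | TVar _ v => lookup v e
  | TApp f ts => app (tseval e ts)
  end
with tseval (R : realType) (K : Type) (L : mstruct R K) (M : K)
    (G : seq (srt L)) (e : env (car M) G) (D : seq (srt L))
    (ts : terms G D) : env (car M) D :=
  match ts in terms _ D return env (car M) D with
  | TNil => tt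
  | TCons _ _ t ts => (teval e t, tseval e ts)
  end.

Fixpoint feval (R : realType) (K : Type) (L : mstruct R K) (M : K)
    (G : seq (srt L)) (phi : formula G) : env (car M) G -> R :=
  match phi in formula G return env (car M) G -> R with
  | FDist _ _ t1 t2 => fun e => dst (teval e t1) (teval e t2)
  | FConn _ n u _ phis => fun e => u (\row_j feval (phis j) e)
  | FSup _ s phi =>
      fun e => sup [set r | exists a : car M s, r = feval phi (a, e)]
  | FInf _ s phi =>
      fun e => inf [set r | exists a : car M s, r = feval phi (a, e)]
  end.

(* A function on the finite product of sorts [G], uniformly in the model. *)
Definition upred (R : realType) (K : Type) (L : mstruct R K)
    (G : seq (srt L)) : Type := forall M : K, env (car M) G -> R.

Definition definable_pred (R : realType) (K : Type) (L : mstruct R K)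
    (G : seq (srt L)) (P : upred G) : Prop :=
  forall eps : R, 0 < eps -> exists phi : formula G,
    forall (M : K) (e : env (car M) G), `|feval phi e - P M e| <= eps.

Definition definable_set (R : realType) (K : Type) (L : mstruct R K)
    (G : seq (srt L)) (X : forall M : K, set (env (car M) G)) : Prop :=
  (forall (M : K) (x : env (car M) G),
    (forall eps : R, 0 < eps ->
       exists2 y, X M y & env_dist (@dst R K L M) x y < eps) -> X M x) /\
  forall (D : seq (srt L)) (psi : formula (G ++ D)),
    definable_pred (G := D) (fun M y =>
      sup [set r | exists2 x, X M x & r = feval psi (env_cat x y)]) /\
    definable_pred (G := D) (fun M y =>
      inf [set r | exists2 x, X M x & r = feval psi (env_cat x y)]).

Definition definable_pseudometric (R : realType) (K : Type)
    (L : mstruct R K) (G : seq (srt L)) (P : upred (G ++ G)) : Prop :=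
  definable_pred P /\
  forall M : K, let d x y := P M (env_cat x y) in
    [/\ forall x, d x x = 0,
        forall x y, d x y = d y x &
        forall x y z, d x z <= d x y + d y z].

(** * Imaginary sorts *)

(* One step of the construction adds, simultaneously, every countable product
   of sorts, every definable set and every quotient by a definable
   pseudometric. *)
Inductive eq_srt (R : realType) (K : Type) (L : mstruct R K) : Type :=
| OldS of srt L
| ProdS of (nat -> srt L)
| SetS (G : seq (srt L)) (X : forall M : K, set (env (car M) G))
    of definable_set X
| QuotS (G : seq (srt L)) (P : upred (G ++ G))
    of definable_pseudometric P.

Definition eq_car (R : realType) (K : Type) (L : mstruct R K) (M : K)
    (s : eq_srt L) : Type :=
  match s with
  | OldS s => car M s
  | ProdS ss => forall k, car M (ss k)
  | SetS _ X _ => {e | X M e}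
  | QuotS G P _ =>
      quot (fun x y : env (car M) G => P M (env_cat x y) = 0)
  end.

(* A countable product carries [\sum_k 2^-(k+1) min(1, d_k)]. *)
Definition eq_dst (R : realType) (K : Type) (L : mstruct R K) (M : K)
    (s : eq_srt L) : eq_car M s -> eq_car M s -> R :=
  match s return eq_car M s -> eq_car M s -> R with
  | OldS _ => fun x y => dst x y
  | ProdS _ => fun x y =>
      limn (series (fun k => 2^-1 ^+ k.+1 * Num.min 1 (dst (x k) (y k))))
  | SetS _ _ _ => fun x y =>
      env_dist (@dst R K L M) (proj1_sig x) (proj1_sig y)
  | QuotS _ P _ => fun x y => P M (env_cat (repr x) (repr y))
  end.

Inductive eq_fn (R : realType) (K : Type) (L : mstruct R K) : Type :=
| OldF of fn L
| ProjF of (nat -> srt L) & nat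
| CoordF (G : seq (srt L)) (X : forall M : K, set (env (car M) G))
    (H : definable_set X) (s : srt L) of var G s
| QuotF (G : seq (srt L)) (P : upred (G ++ G))
    of definable_pseudometric P.

Definition eq_dom (R : realType) (K : Type) (L : mstruct R K)
    (f : eq_fn L) : seq (eq_srt L) :=
  match f with
  | OldF f => map (@OldS R K L) (dom f)
  | ProjF ss _ => [:: ProdS ss]
  | CoordF _ _ H _ _ => [:: SetS H]
  | QuotF G _ _ => map (@OldS R K L) G
  end.

Definition eq_cod (R : realType) (K : Type) (L : mstruct R K)
    (f : eq_fn L) : eq_srt L :=
  match f with
  | OldF f => OldS (cod f)
  | ProjF ss k => OldS (ss k)
  | CoordF _ _ _ s _ => OldS s
  | QuotF _ _ H => QuotS H
  end.

Definition eq_app (R : realType) (K : Type) (L : mstruct R K) (M : K)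
    (f : eq_fn L) : env (@eq_car R K L M) (eq_dom f) -> eq_car M (eq_cod f) :=
  match f return env (@eq_car R K L M) (eq_dom f) -> eq_car M (eq_cod f) with
  | OldF f => fun e => app (env_reindex e)
  | ProjF _ k => fun e => e.1 k
  | CoordF _ _ _ _ v => fun e => lookup v (proj1_sig e.1)
  | QuotF _ _ _ => fun e => cls _ (env_reindex e)
  end.

Definition eq_step (R : realType) (K : Type) (L : mstruct R K) :
    mstruct R K :=
  {| srt := eq_srt L; car := @eq_car R K L; dst := @eq_dst R K L;
     fn := eq_fn L; dom := @eq_dom R K L; cod := @eq_cod R K L;
     app := @eq_app R K L |}.

(** * C*-algebras as metric structures *)

Definition cball (R : realType) (A : cstarType R) (n : nat) : Type :=
  {a : A | cnorm a <= n%:R}.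

Inductive cstar_fn (R : realType) : Type :=
| AddF of nat & nat
| MulF of nat & nat
| StarF of nat
| ScaleF (c : R[i]) (m n : nat) of complex.Re `|c| * m%:R <= n%:R
| ZeroF
| OneF
| InclF (m n : nat) of (m <= n)%N.

Definition cstar_dom (R : realType) (f : cstar_fn R) : seq nat :=
  match f with
  | AddF m n | MulF m n => [:: m; n]
  | StarF m | @ScaleF _ _ m _ _ | @InclF _ m _ _ => [:: m]
  | ZeroF | OneF => [::]
  end.

Definition cstar_cod (R : realType) (f : cstar_fn R) : nat :=
  match f with
  | AddF m n => m + n
  | MulF m n => m * n
  | StarF n | @ScaleF _ _ _ n _ | @InclF _ _ n _ => n
  | ZeroF => 0
  | OneF => 1
  end%N.

Definition ball_add (R : realType) (A : cstarType R) (m n : nat)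
    (x : cball A m) (y : cball A n) : cball A (m + n).
Proof.
exists (proj1_sig x + proj1_sig y).
by rewrite natrD (le_trans (cnormD _ _)) // lerD // ?(proj2_sig x)
  ?(proj2_sig y).
Defined.

Definition ball_mul (R : realType) (A : cstarType R) (m n : nat)
    (x : cball A m) (y : cball A n) : cball A (m * n).
Proof.
exists (proj1_sig x * proj1_sig y).
by rewrite natrM (le_trans (cnormM _ _)) // ler_pM // ?cnorm_ge0
  ?(proj2_sig x) ?(proj2_sig y).
Defined.

Definition ball_star (R : realType) (A : cstarType R) (n : nat)
    (x : cball A n) : cball A n.
Proof.
exists (star (proj1_sig x)).
by rewrite cnorm_star (proj2_sig x).
Defined.

Definition ball_scale (R : realType) (A : cstarType R) (c : R[i])
    (m n : nat) (h : complex.Re `|c| * m%:R <= n%:R) (x : cball A m) : cball A n.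
Proof.
exists (c *: proj1_sig x).
rewrite cnormZ (le_trans _ h) // ler_wpM2l ?(proj2_sig x) //.
by have := normr_ge0 c; rewrite lecE => /andP[].
Defined.

Definition ball_zero (R : realType) (A : cstarType R) : cball A 0.
Proof. by exists 0; rewrite cnorm0. Defined.

Definition ball_one (R : realType) (A : cstarType R) : cball A 1.
Proof. by exists 1; rewrite cnorm1. Defined.

Definition ball_incl (R : realType) (A : cstarType R) (m n : nat)
    (h : (m <= n)%N) (x : cball A m) : cball A n.
Proof.
exists (proj1_sig x).
by rewrite (le_trans (proj2_sig x)) // ler_nat.
Defined.

Definition cstar_app (R : realType) (A : cstarType R) (f : cstar_fn R) :
    env (@cball R A) (cstar_dom f) -> cball A (cstar_cod f) :=
  match f return env (@cball R A) (cstar_dom f) -> cball A (cstar_cod f) with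
  | AddF m n => fun e => ball_add e.1 e.2.1
  | MulF m n => fun e => ball_mul e.1 e.2.1
  | StarF n => fun e => ball_star e.1
  | ScaleF _ _ _ h => fun e => ball_scale h e.1
  | ZeroF => fun _ => ball_zero A
  | OneF => fun _ => ball_one A
  | InclF _ _ h => fun e => ball_incl h e.1
  end.

Definition cstar_struct (R : realType) (K : Type) (alg : K -> cstarType R) :
    mstruct R K :=
  {| srt := nat; car := fun M n => cball (alg M) n;
     dst := fun M n x y => cnorm (proj1_sig x - proj1_sig y);
     fn := cstar_fn R; dom := @cstar_dom R; cod := @cstar_cod R;
     app := fun M f e => @cstar_app R (alg M) f e |}.

(* The language of C*-algebras interpreted in all of them. *)
Definition cstar_lang (R : realType) : mstruct R (cstarType R) :=
  cstar_struct (K := cstarType R) id.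

Definition elem_equiv (R : realType) (A B : cstarType R) : Prop :=
  forall phi : formula (L := cstar_lang R) [::],
    feval (M := A) phi tt = feval (M := B) phi tt.

(* The models of the complete theory of [A]. *)
Definition Th_models (R : realType) (A : cstarType R) : Type :=
  {B : cstarType R | elem_equiv A B}.

Definition Th_self (R : realType) (A : cstarType R) : Th_models A :=
  exist _ A (fun _ => erefl).

(* The finite stages of [A^eq], uniformly over the models of [Th A]. *)
Fixpoint eq_stage (R : realType) (A : cstarType R) (n : nat) :
    mstruct R (Th_models A) :=
  if n is n'.+1 then eq_step (eq_stage A n')
  else cstar_struct (@proj1_sig _ (elem_equiv A)).

Definition ball_map (R : realType) (A B : cstarType R) (iota : A -> B)
    (h : forall x, cnorm (iota x) = cnorm x) (n : nat) (x : cball A n) : cball B n.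
Proof. by exists (iota (proj1_sig x)); rewrite h (proj2_sig x). Defined.

(* [A] is an elementary submodel of [B] via the inclusion [iota]. *)
Definition elementary_inclusion (R : realType) (A B : cstarType R)
    (iota : {lrmorphism A -> B}) : Prop :=
  (forall x, iota (star x) = star (iota x)) /\
  exists h : forall x, cnorm (iota x) = cnorm x,
    forall (G : seq (srt (cstar_lang R))) (phi : formula G)
      (e : env (car (m := cstar_lang R) A) G),
      feval (M := A) phi e =
      feval (M := B) phi
        (env_map (C' := car (m := cstar_lang R) B) (ball_map h) e).

(** * Ordered groups with order unit, as discrete first-order structures *)

Record ogroup := OGroup {
  og_car :> Type;
  og_zero : og_car;
  og_unit : og_car;
  og_add : og_car -> og_car -> og_car;
  og_opp : og_car -> og_car;
  og_pos : og_car -> Prop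
}.

Inductive og_term : Type :=
| OVar of nat
| OZero
| OUnit
| OAdd of og_term & og_term
| OOpp of og_term.

Inductive og_formula : Type :=
| OEq of og_term & og_term
| OPos of og_term
| ONot of og_formula
| OAnd of og_formula & og_formula
| OEx of nat & og_formula.

Fixpoint og_teval (G : ogroup) (v : nat -> G) (t : og_term) : G :=
  match t with
  | OVar k => v k
  | OZero => og_zero G
  | OUnit => og_unit G
  | OAdd t1 t2 => og_add (og_teval v t1) (og_teval v t2)
  | OOpp t => og_opp (og_teval v t)
  end.

Fixpoint og_sat (G : ogroup) (v : nat -> G) (phi : og_formula) : Prop :=
  match phi with
  | OEq t1 t2 => og_teval v t1 = og_teval v t2
  | OPos t => og_pos (og_teval v t)
  | ONot phi => ~ og_sat v phi
  | OAnd phi psi => og_sat v phi /\ og_sat v psi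
  | OEx k phi =>
      exists a : G, og_sat (fun j => if j == k then a else v j) phi
  end.

Definition og_elementary (G H : ogroup) (f : G -> H) : Prop :=
  forall (phi : og_formula) (v : nat -> G),
    og_sat v phi <-> og_sat (f \o v) phi.

Definition discrete_val (R : realType) (Q : Prop) : R := (~~ `[< Q >])%:R.

(* The relation [Q] on sorts of [A^eq] is definable: its zero-one predicate,
   with value [0] for true, is the value at [A] of a definable predicate. *)
Definition definable_rel (R : realType) (A : cstarType R) (n : nat)
    (G : seq (srt (eq_stage A n)))
    (Q : set (env (car (m := eq_stage A n) (Th_self A)) G)) : Prop :=
  exists2 P : upred G, definable_pred P &
    forall e, P (Th_self A) e = discrete_val R (Q e).

(* The universe of [G], with the discrete metric, is isometric to a sort. As
   this metric is zero-one valued, an operation [g] is definable (that is,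
   [d (g x) y] is a definable predicate) when its graph is. *)
Definition in_Aeq (R : realType) (A : cstarType R) (G : ogroup) : Prop :=
  exists (n : nat) (s : srt (eq_stage A n))
    (f : G -> car (m := eq_stage A n) (Th_self A) s),
  [/\ bijective f,
      forall x y, dst (f x) (f y) = discrete_val R (x = y) &
  [/\ definable_rel (G := [:: s]) (fun e => e.1 = f (og_zero G)),
      definable_rel (G := [:: s]) (fun e => e.1 = f (og_unit G)),
      definable_rel (G := [:: s; s; s]) (fun e => exists x y,
        [/\ e.1 = f x, e.2.1 = f y & e.2.2.1 = f (og_add x y)]),
      definable_rel (G := [:: s; s]) (fun e => exists x,
        e.1 = f x /\ e.2.1 = f (og_opp x)) &
      definable_rel (G := [:: s]) (fun e => exists x,
        e.1 = f x /\ og_pos x)]].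

(** * The stabilization and [K_0] *)

(* Infinite matrices; the algebraic tensor product of [A] with the union of
   the matrix algebras [M_n(C)] consists of the finitely supported ones. *)
Definition imx (R : realType) (A : cstarType R) : Type := nat -> nat -> A.

Definition imx_sub (R : realType) (A : cstarType R) (x y : imx A) : imx A :=
  fun i j => x i j - y i j.

Definition imx_add (R : realType) (A : cstarType R) (x y : imx A) : imx A :=
  fun i j => x i j + y i j.

Definition imx_zero (R : realType) (A : cstarType R) : imx A :=
  fun _ _ => 0.

Definition imx_star (R : realType) (A : cstarType R) (x : imx A) : imx A :=
  fun i j => star (x j i).

Definition imx_mul (R : realType) (A : cstarType R) (x y : imx A) : imx A :=
  fun i j => \sum_(k \in [set: nat]) x i k * y k j.

Definition imx_finite (R : realType) (A : cstarType R) (x : imx A) : Prop :=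
  exists N : nat, forall i j, (N <= i)%N || (N <= j)%N -> x i j = 0.

Definition col_finite (R : realType) (A : cstarType R) (xi : nat -> A) :
    Prop := exists N : nat, forall i, (N <= i)%N -> xi i = 0.

(* The norm of the free Hilbert module of columns over [A]. *)
Definition col_norm (R : realType) (A : cstarType R) (xi : nat -> A) : R :=
  Num.sqrt (cnorm (\sum_(i \in [set: nat]) star (xi i) * xi i)).

(* The operator norm for the action on columns: this is the C*-norm of
   [M_n(A)], compatibly for all [n]. *)
Definition imx_norm (R : realType) (A : cstarType R) (x : imx A) : R :=
  sup [set r | exists xi : nat -> A,
    [/\ col_finite xi, col_norm xi <= 1 &
        r = col_norm (fun i => \sum_(j \in [set: nat]) x i j * xi j)]].

(* Elements of the tensor product of [A] with the compact operators, which is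
   the completion of the algebra of finite matrices, are represented by Cauchy
   sequences; [stab_eq] below is equality in the completion. *)
Record stab (R : realType) (A : cstarType R) := Stab {
  stab_seq :> nat -> imx A;
  stab_finite : forall k, imx_finite (stab_seq k);
  stab_cauchy : forall eps : R, 0 < eps -> exists N : nat,
    forall k l, (N <= k)%N -> (N <= l)%N ->
      imx_norm (imx_sub (stab_seq k) (stab_seq l)) < eps
}.

Definition stab_eq (R : realType) (A : cstarType R) (x y : nat -> imx A) :
    Prop :=
  (fun k => imx_norm (imx_sub (x k) (y k))) @ \oo --> (0 : R).

Definition seq_add (R : realType) (A : cstarType R) (x y : nat -> imx A) :
    nat -> imx A := fun k => imx_add (x k) (y k).

Definition seq_mul (R : realType) (A : cstarType R) (x y : nat -> imx A) :
    nat -> imx A := fun k => imx_mul (x k) (y k).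

Definition seq_star (R : realType) (A : cstarType R) (x : nat -> imx A) :
    nat -> imx A := fun k => imx_star (x k).

Definition seq_zero (R : realType) (A : cstarType R) : nat -> imx A :=
  fun _ => imx_zero A.

Record projection (R : realType) (A : cstarType R) := Projection {
  proj_stab :> stab A;
  proj_star : stab_eq (seq_star proj_stab) proj_stab;
  proj_idem : stab_eq (seq_mul proj_stab proj_stab) proj_stab
}.

Definition mvn_equiv (R : realType) (A : cstarType R) (p q : projection A) :
    Prop :=
  exists v : stab A, stab_eq (seq_mul (seq_star v) v) p /\
                     stab_eq (seq_mul v (seq_star v)) q.

Definition V (R : realType) (A : cstarType R) : Type :=
  quot (@mvn_equiv R A).

(* The sum of two classes is the class of the sum of orthogonal
   representatives. *)
Definition V_add (R : realType) (A : cstarType R) (a b : V A) : V A :=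
  xget (a : {classic V A}) [set c : V A | exists p q r : projection A,
    [/\ a = cls _ p, b = cls _ q, c = cls _ r,
        stab_eq (seq_mul p q) (@seq_zero R A) & stab_eq (seq_add p q) r]].

(* The Grothendieck group of a commutative semigroup: formal differences. *)
Definition groth_eq (S : Type) (add : S -> S -> S) (x y : S * S) : Prop :=
  exists z : S, add (add x.1 y.2) z = add (add y.1 x.2) z.

Definition groth (S : Type) (add : S -> S -> S) : Type :=
  quot (groth_eq add).

Definition groth_add (S : Type) (add : S -> S -> S) (x y : groth add) :
    groth add :=
  cls _ (add (repr x).1 (repr y).1, add (repr x).2 (repr y).2).

Definition groth_opp (S : Type) (add : S -> S -> S) (x : groth add) :
    groth add := cls _ ((repr x).2, (repr x).1).

Lemma imx_norm0 (R : realType) (A : cstarType R) (x : imx A) :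
  (forall i j, x i j = 0) -> imx_norm x = 0.
Proof.
move=> x0; rewrite /imx_norm; set S := (X in sup X).
have -> : S = [set 0].
  have col0 (xi : nat -> A) : (forall i, xi i = 0) -> col_norm xi = 0.
    move=> xi0; rewrite /col_norm fsbig1 => [|i _]; last by rewrite xi0 mulr0.
    by rewrite cnorm0 sqrtr0.
  have x00 (xi : nat -> A) :
      col_norm (fun i => \sum_(j \in [set: nat]) x i j * xi j) = 0.
    by apply: col0 => i; rewrite fsbig1 // => j _; rewrite x0 mul0r.
  apply/seteqP; split=> [r [xi [_ _ ->]]|r ->] /=; first exact: x00.
  by exists (fun=> 0); split; [exists 0%N | rewrite col0 | rewrite x00].
exact: sup1.
Qed.

Lemma stab_eq_ext (R : realType) (A : cstarType R) (x y : nat -> imx A) :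
  (forall k i j, x k i j = y k i j) -> stab_eq x y.
Proof.
move=> xy; rewrite /stab_eq.
rewrite (_ : (fun k => _) = fun=> 0); first exact: cvg_cst.
apply/funext => k; apply: imx_norm0 => i j.
by rewrite /imx_sub xy subrr.
Qed.

(* The matrix with [a] in the upper left corner, as a constant sequence. *)
Definition corner (R : realType) (A : cstarType R) (a : A) : stab A.
Proof.
exists (fun _ i j => if (i == 0%N) && (j == 0%N) then a else 0).
  by move=> _; exists 1%N => -[|i] [|j].
move=> eps eps0; exists 0%N => k l _ _.
by rewrite imx_norm0 // => i j; rewrite /imx_sub subrr.
Defined.

Definition corner_proj (R : realType) (A : cstarType R) (a : A)
    (aS : star a = a) (aI : a * a = a) : projection A.
Proof.
exists (corner a); apply: stab_eq_ext => k i j /=.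
  by rewrite /seq_star /imx_star /= andbC; case: ifP => // _; rewrite star0.
rewrite /seq_mul /imx_mul /= -(fsbig_widen [set 0%N] setT) //=; last first.
  by move=> [|l] [] //= _ _; rewrite andbF mul0r.
rewrite fsbig_set1 andbT.
by case: i j => [|i] [|j] //=; rewrite ?mul0r ?mulr0.
Defined.

Definition V_zero (R : realType) (A : cstarType R) : V A :=
  cls _ (corner_proj (star0 A) (mulr0 0)).

Definition V_unit (R : realType) (A : cstarType R) : V A :=
  cls _ (corner_proj (star1 A) (mulr1 1)).

Definition K0 (R : realType) (A : cstarType R) : ogroup :=
  {| og_car := groth (@V_add R A);
     og_zero := cls _ (V_zero A, V_zero A);
     og_unit := cls _ (V_unit A, V_zero A);
     og_add := @groth_add _ (@V_add R A);
     og_opp := @groth_opp _ (@V_add R A);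
     og_pos := fun x => exists a : V A, x = cls _ (a, V_zero A) |}.

(* [q] is the image of [p] under the extension of [iota] to the
   stabilizations, which acts on entries. *)
Definition stab_image (R : realType) (A B : cstarType R) (iota : A -> B)
    (p : projection A) (q : projection B) : Prop :=
  forall k i j, q k i j = iota (p k i j).

(* [f] is the homomorphism induced by [iota]. That the image of a projection
   is a projection is part of this condition. *)
Definition K0_induced (R : realType) (A B : cstarType R) (iota : A -> B)
    (f : K0 A -> K0 B) : Prop :=
  forall p q : projection A, exists p' q' : projection B,
    [/\ stab_image iota p p', stab_image iota q q' &
        f (cls _ (cls _ p, cls _ q)) = cls _ (cls _ p', cls _ q')].

(* Main.v *)
From HB Require Import structures.
Require Import Defs.
From mathcomp Require Import all_boot all_order all_algebra.
From mathcomp Require Import all_classical all_reals all_analysis.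
From mathcomp Require Import complex.
From mathcomp Require Import ring lra.
From Stdlib Require Ncring Ncring_tac.

(* An algebra [A] as in the theorem contains isometries [s_i] with pairwise
   orthogonal ranges, and [x |-> sum_ij s_i x_ij s_j^*] is an isometric
   *-homomorphism from the finite matrices to [A]. Hence [V(A)] is the set of
   projections of [A] up to Murray-von Neumann equivalence. Among the nonzero
   classes every equation [a + x = b] is solvable, so they form a group, which
   is [K_0(A)], and its positive cone is everything.

   The nonzero projections form a definable set, since approximate projections
   are close to projections. Equivalence, and the relation [p + q = r] between
   classes, are open conditions on projections: approximate witnesses can be
   corrected by Newton iterations. So the infima over the unit ball that
   express them are either [0] or bounded below, and continuous functions of
   them take only the values [0] and [1]. This puts [K_0(A)] in [A^eq], as a
   quotient of the set of nonzero projections. It also turns a first-order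
   formula about [K_0] into a formula about nonzero projections, uniformly over
   all algebras with isometries as above in which any nonzero projection
   contains a copy of any other; this class contains [B] when [A] is an
   elementary submodel of [B]. *)

Set Implicit Arguments.
Unset Strict Implicit.
Unset Printing Implicit Defensive.

Import Order.TTheory GRing.Theory Num.Theory.
Import numFieldNormedType.Exports.

Local Open Scope classical_set_scope.
Local Open Scope ring_scope.
Local Open Scope complex_scope.

(** Spectral arguments are replaced by explicit norm-convergent iterations, for polar parts, for
    projections near approximate ones and for square roots. Square roots serve to extract from
    [dim A > 1] two nonzero self-adjoint elements with product [0]; pure infiniteness turns them
    into isometries with orthogonal ranges. The zero projection has to be set aside: it is neutral
    in [V(A)], while the group of nonzero classes has another neutral element. The zero of [K_0] is
    therefore described by [p + p = p] among nonzero projections. A pseudometric defining an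
    imaginary sort must be one in every model of the theory of [A], so the formula for equivalence
    is correct in every C*-algebra. The formulas for the operations only need the right value at
    [A], and are decided for algebras with isometries and absorption. An elementary inclusion speaks
    about formulas of the original language. For the second claim, quantifiers over nonzero
    projections are therefore turned back into quantifiers over balls, by definability of that
    set. *)

#[local] Instance nzring_ops (A : nzRingType) :
  @Ncring.Ring_ops A 0 1 +%R *%R (fun x y => x - y) -%R eq := {}.

#[local] Instance nzring_ring (A : nzRingType) :
  @Ncring.Ring A _ _ _ _ _ _ _ (nzring_ops A).
Proof.
constructor.
1-5: try typeclasses eauto.
- exact: add0r.
- exact: addrC.
- exact: addrA.
- exact: mul1r.
- exact: mulr1.
- exact: mulrA.
- by move=> *; exact: mulrDl.
- by move=> *; exact: mulrDr.
- by [].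
- exact: addrN.
Qed.

(** Stars and scalar multiples are atoms here, so relations such as [star u * u = 1] are substituted
    after an expansion has been proved. *)
Ltac ncring := Ncring_tac.non_commutative_ring.

(** * Convergence in a C*-algebra *)

Section Norm.
Variables (R : realType) (A : cstarType R).
Implicit Types (x y z : A) (r : R) (u v : nat -> A).

Lemma cnormZr r x : cnorm (r%:C *: x) = `|r| * cnorm x.
Proof. by rewrite cnormZ normc_def /= expr0n /= addr0 sqrtr_sqr. Qed.

Lemma cnormN x : cnorm (- x) = cnorm x.
Proof. by rewrite -scaleN1r cnormZ normrN normr1 mul1r. Qed.

Lemma cnorm_distC x y : cnorm (x - y) = cnorm (y - x).
Proof. by rewrite -cnormN opprB. Qed.

Lemma cnormB x y : cnorm (x - y) <= cnorm x + cnorm y.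
Proof. by rewrite -(cnormN y) cnormD. Qed.

Lemma cnorm_tri y x z : cnorm (x - z) <= cnorm (x - y) + cnorm (y - z).
Proof. by rewrite (le_trans _ (cnormD _ _)) // addrA subrK. Qed.

Lemma cnorm_lerB x y : `|cnorm x - cnorm y| <= cnorm (x - y).
Proof.
rewrite ler_norml; apply/andP; split.
  by have := cnormD (y - x) x; rewrite subrK cnorm_distC; lra.
by have := cnormD (x - y) y; rewrite subrK; lra.
Qed.

Lemma starN x : star (- x) = - star x.
Proof. by apply: (addrI (star x)); rewrite -starD !addrN star0. Qed.

Lemma starB x y : star (x - y) = star x - star y.
Proof. by rewrite starD starN. Qed.

Lemma starZr r x : star (r%:C *: x) = r%:C *: star x.
Proof. by rewrite starZ conjc_real. Qed.

Lemma scale_half x : 2^-1%:C *: x + 2^-1%:C *: x = x.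
Proof. by rewrite -scalerDl -rmorphD /= (_ : 2^-1 + 2^-1 = 1) ?scale1r //; lra. Qed.

Lemma cnormM_le x y (a b : R) : cnorm x <= a -> cnorm y <= b ->
  cnorm (x * y) <= a * b.
Proof.
by move=> xa yb; rewrite (le_trans (cnormM _ _)) // ler_pM // cnorm_ge0.
Qed.

Lemma cnorm_sq_sa x : star x = x -> cnorm (x * x) = cnorm x ^+ 2.
Proof. by move=> xS; rewrite -{1}xS cstar_identity. Qed.

Lemma cnorm_le1 x : cnorm (star x * x) <= 1 -> cnorm x <= 1.
Proof. by rewrite cstar_identity expr_le1 // cnorm_ge0. Qed.

Lemma cvg0_squeeze (a b : nat -> R) : (forall n, 0 <= a n <= b n) ->
  b @ \oo --> (0 : R) -> a @ \oo --> (0 : R).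
Proof.
move=> ab b0; apply: (@squeeze_cvgr _ _ _ _ (fun=> 0) b) => //.
  by near=> n; exact: ab.
exact: cvg_cst.
Unshelve. all: by end_near.
Qed.

Definition clim u l := (fun n => cnorm (u n - l)) @ \oo --> (0 : R).

Lemma climP u l : clim u l <-> forall eps : R, 0 < eps ->
  exists N : nat, forall n, (N <= n)%N -> cnorm (u n - l) < eps.
Proof.
split=> [/cvgr0Pnorm_lt ul eps e0|ul].
  have [N _ NP] := ul _ e0; exists N => n Nn.
  by have := NP n Nn; rewrite /= ger0_norm // cnorm_ge0.
apply/cvgr0Pnorm_lt => eps e0; have [N NP] := ul _ e0; exists N => // n /= Nn.
by rewrite ger0_norm ?cnorm_ge0 // NP.
Qed.

Lemma clim_squeeze (b : nat -> R) u l : (forall n, cnorm (u n - l) <= b n) ->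
  b @ \oo --> (0 : R) -> clim u l.
Proof. by move=> ub; apply: cvg0_squeeze => n; rewrite cnorm_ge0 ub. Qed.

Lemma clim_cst l : clim (fun=> l) l.
Proof. by rewrite /clim subrr cnorm0; exact: cvg_cst. Qed.

Lemma clim_shift u l : clim u l -> clim (fun n => u n.+1) l.
Proof. by rewrite /clim -(cvg_shiftS (fun n => cnorm (u n - l))). Qed.

Lemma climD u v l m : clim u l -> clim v m -> clim (fun n => u n + v n) (l + m).
Proof.
move=> ul vm; apply: (@clim_squeeze (fun n => cnorm (u n - l) + cnorm (v n - m))).
  by move=> n; rewrite opprD addrACA cnormD.
by rewrite -[X in _ --> X](addr0 0); exact: cvgD.
Qed.

Lemma climN u l : clim u l -> clim (fun n => - u n) (- l).
Proof.
by move=> ul; apply: clim_squeeze ul => n; rewrite -opprD cnormN.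
Qed.

Lemma climB u v l m : clim u l -> clim v m -> clim (fun n => u n - v n) (l - m).
Proof. by move=> ul /climN; exact: climD. Qed.

Lemma climM u v l m : clim u l -> clim v m -> clim (fun n => u n * v n) (l * m).
Proof.
move=> ul vm; apply: (@clim_squeeze (fun n =>
    cnorm (u n - l) * (cnorm (v n - m) + cnorm m) + cnorm l * cnorm (v n - m))).
  move=> n; rewrite (_ : _ - _ = (u n - l) * v n + l * (v n - m)); last by ncring.
  rewrite (le_trans (cnormD _ _)) // lerD ?cnormM //.
  apply: cnormM_le => //.
  by have := cnormD (v n - m) m; rewrite subrK.
rewrite [X in _ --> X](_ : _ = 0 * (0 + cnorm m) + cnorm l * 0); last first.
  by rewrite mul0r mulr0 addr0.
apply: cvgD; last by apply: cvgM => //; exact: cvg_cst.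
by apply: cvgM => //; apply: cvgD => //; exact: cvg_cst.
Qed.

Lemma clim_star u l : clim u l -> clim (fun n => star (u n)) (star l).
Proof.
by move=> ul; apply: clim_squeeze ul => n; rewrite -starB cnorm_star.
Qed.

Lemma climZ (c : R) u l : clim u l -> clim (fun n => c%:C *: u n) (c%:C *: l).
Proof.
move=> ul; apply: (@clim_squeeze (fun n => `|c| * cnorm (u n - l))).
  by move=> n; rewrite -scalerBr cnormZr.
by rewrite -(mulr0 `|c|); apply: cvgM => //; exact: cvg_cst.
Qed.

Lemma clim_le u l (c : R) : clim u l -> (forall n, cnorm (u n) <= c) ->
  cnorm l <= c.
Proof.
move=> /climP ul uc; apply/ler_addgt0Pr => e e0.
have [N /(_ N (leqnn N)) NP] := ul e e0.
have := cnormB (u N) (u N - l); rewrite subKr => /le_trans; apply.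
by rewrite lerD // ltW.
Qed.

Lemma clim_uniq u l m : clim u l -> clim u m -> l = m.
Proof.
move=> ul um; apply/subr0_eq/cnorm_eq0/eqP; rewrite eq_le cnorm_ge0 andbT.
apply: (clim_le (climB ul um)) => n; by rewrite subrr cnorm0.
Qed.

Lemma clim_ext u v l : (forall n, u n = v n) -> clim u l -> clim v l.
Proof. by move=> /funext ->. Qed.

(** The increments of [u] are dominated by those of a bounded nondecreasing scalar sequence, so [u]
    is Cauchy. This covers geometric convergence as well as the square root iteration, which has no
    geometric rate on the boundary of the unit ball. *)
Lemma clim_telescope u (r : nat -> R) (c : R) :
  (forall n, cnorm (u n.+1 - u n) <= r n.+1 - r n) -> (forall n, r n <= c) ->
  exists2 l, clim u l & cnorm (l - u 0%N) <= c - r 0%N.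
Proof.
move=> ur rc.
have rS n : r n <= r n.+1.
  by rewrite -subr_ge0 (le_trans _ (ur n)) // cnorm_ge0.
have dist m k : cnorm (u (m + k)%N - u m) <= r (m + k)%N - r m.
  elim: k => [|k IH]; first by rewrite addn0 !subrr cnorm0.
  rewrite addnS (le_trans (cnorm_tri (u (m + k)%N) _ _)) //.
  by have := ur (m + k)%N; lra.
have rh : {homo r : m n / (m <= n)%N >-> m <= n} by apply: homo_leq => // ? ? ?;
  exact: le_trans.
have rcvg : cvgn r.
  by apply: nondecreasing_is_cvgn => //; exists c => _ [n _ <-].
have rlim n : r n <= limn r by apply: nondecreasing_cvgn_le.
have [l ul] : exists l, clim u l.
  apply: cnorm_complete => eps e0.
  have e20 : 0 < eps / 2 by lra.
  have /cvgrPdist_lt/(_ _ e20)[N _ NP] := rcvg.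
  have half m : (N <= m)%N -> cnorm (u m - u N) < eps / 2.
    move=> Nm; have := dist N (m - N)%N; rewrite subnKC // => /le_lt_trans; apply.
    have := NP N (leqnn N); rewrite /= ger0_norm ?subr_ge0 //.
    by have := rlim m; lra.
  exists N => m n Nm Nn; rewrite (le_lt_trans (cnorm_tri (u N) _ _)) //.
  rewrite (cnorm_distC (u N)).
  by have := half _ Nm; have := half _ Nn; lra.
exists l => //; apply: (clim_le (climB ul (clim_cst (u 0%N)))) => n.
by have := dist 0%N n; rewrite add0n => /le_trans; apply; rewrite lerB.
Qed.

Lemma clim_geometric u (c : R) :
  (forall n, cnorm (u n.+1 - u n) <= c * 2^-1 ^+ n) ->
  exists2 l, clim u l & cnorm (l - u 0%N) <= 2 * c.
Proof.
move=> uc; have c0 : 0 <= c.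
  by have := uc 0%N; rewrite expr0 mulr1; apply: le_trans; exact: cnorm_ge0.
have [] := @clim_telescope u (fun n => 2 * c - 2 * c * 2^-1 ^+ n) (2 * c).
- by move=> n; have := uc n; rewrite exprS; lra.
- by move=> n; rewrite gerBl // mulr_ge0 ?mulr_ge0 ?exprn_ge0 ?invr_ge0.
by move=> l ul; rewrite expr0 => h; exists l => //; move: h; lra.
Qed.

Lemma clim_eq0 u l : clim u l -> (forall n, cnorm (u n) <= 2^-1 ^+ n) -> l = 0.
Proof.
move=> ul u0; apply: (clim_uniq ul).
apply: (@clim_squeeze (fun n => 2^-1 ^+ n)) => [n|]; first by rewrite subr0.
by apply: cvg_expr; rewrite ger0_norm ?invr_ge0 // invf_lt1 // ltr1n.
Qed.

End Norm.

(** * Projections and partial isometries *)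

Section Projections.
Variables (R : realType) (A : cstarType R).
Implicit Types (a b p q t u v w x y : A).

Definition is_proj p := star p = p /\ p * p = p.

Definition mvn p q := exists v, star v * v = p /\ v * star v = q.

Lemma is_proj_norm_cases p : is_proj p -> p != 0 -> cnorm p = 1.
Proof.
move=> [pS pI] p0; have n0 : cnorm p != 0 by apply: contra p0 => /eqP/cnorm_eq0 ->.
by apply: (mulfI n0); rewrite mulr1 -expr2 -cnorm_sq_sa // pI.
Qed.

Lemma is_proj_norm p : is_proj p -> cnorm p <= 1.
Proof.
by move=> pP; have [->|/is_proj_norm_cases ->//] := eqVneq p 0; rewrite cnorm0.
Qed.

(** The norm of a projection is [0] or [1]. This gap makes approximate relations exact: a defect
    that is itself a projection only has to be small in order to vanish. *)
Lemma is_proj_eq0 p : is_proj p -> cnorm p < 1 -> p = 0.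
Proof.
by move=> pP; have [//|/is_proj_norm_cases -> //] := eqVneq p 0; rewrite ltxx.
Qed.

Lemma mvn_refl p : is_proj p -> mvn p p.
Proof. by move=> [pS pI]; exists p; rewrite pS. Qed.

Lemma mvn_sym p q : mvn p q -> mvn q p.
Proof. by move=> [v [vp vq]]; exists (star v); rewrite starK. Qed.

Lemma star_self x : star (star x * x) = star x * x.
Proof. by rewrite starM starK. Qed.

(** [(x p - x)^* (x p - x)] expands into copies of [p] that cancel, and the C*-identity
    concludes. *)
Lemma sub_supp x p : star p = p -> p * p = p -> star x * x = p -> x * p = x.
Proof.
move=> pS pI xp; apply/subr0_eq/cnorm_eq0/eqP; rewrite -sqrf_eq0 -cstar_identity.
rewrite starB starM pS.
rewrite (_ : (p * star x - star x) * _ = p * (star x * x) * p - p * (star x * x)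
  - star x * x * p + star x * x); last by ncring.
by rewrite xp !pI subrr sub0r addNr cnorm0.
Qed.

Lemma mvn_supp p q v : is_proj p -> star v * v = p -> v * star v = q ->
  v * p = v /\ q * v = v.
Proof.
move=> [pS pI] vp vq; have vpv := sub_supp pS pI vp.
by split=> //; rewrite -vq -mulrA vp.
Qed.

Lemma mvn_trans p q r : is_proj p -> is_proj q -> mvn p q -> mvn q r -> mvn p r.
Proof.
move=> pP qP [v [vp vq]] [w [wq wr]]; exists (w * v).
have [_ qv] := mvn_supp pP vp vq; have [wqw _] := mvn_supp qP wq wr.
rewrite starM; split.
  by rewrite mulrA -(mulrA (star v)) wq -mulrA qv.
by rewrite mulrA -(mulrA w) vq wqw.
Qed.

(* Newton's iteration for the polar part of [w]. *)
Definition polar_step q w := w * (1 + 2^-1%:C *: (q - star w * w)).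

(** With [d = e / 2] one has [w^* w = q - 2 d], and [q] acts as a unit on [d]; hence the new error
    is [3 d^2 + 2 d^3], which for [|d| <= 1/4] is at most half of the old one. *)
Lemma polar_stepP q w (e := q - star w * w) (w' := polar_step q w) :
  is_proj q -> w * q = w -> cnorm e <= 2^-1 ->
  [/\ w' * q = w', cnorm (q - star w' * w') <= 2^-1 * cnorm e
    & cnorm (w' - w) <= cnorm e].
Proof.
move=> qP wq e2; have [qS qI] := qP.
set d := 2^-1%:C *: e.
have ed : e = d + d by rewrite scale_half.
have wS : q * star w = star w by rewrite -{1}qS -starM wq.
have eq_ : e * q = e by rewrite mulrBl qI -mulrA wq.
have qe_ : q * e = e by rewrite mulrBr qI mulrA wS.
have dq : d * q = d by rewrite -scalerAl eq_.
have qd : q * d = d by rewrite -scalerAr qe_.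
have dS : star d = d by rewrite starZr starB qS star_self.
have ww : star w * w = q - (d + d) by rewrite -ed opprB addrC subrK.
have w'E : w' = w + w * d by rewrite /w' /polar_step -/e -/d mulrDr mulr1.
have nd : cnorm d = 2^-1 * cnorm e by rewrite cnormZr ger0_norm // invr_ge0.
have nw : cnorm w <= 2.
  rewrite -(@ler_pXn2r _ 2) ?nnegrE ?cnorm_ge0 // -cstar_identity ww -ed.
  rewrite (le_trans (cnormB _ _)) //; have := is_proj_norm qP; lra.
split.
- by rewrite w'E mulrDl wq -mulrA dq.
- rewrite (_ : q - _ = d * d + d * d + d * d + (d * d * d + d * d * d)); last first.
    rewrite w'E starD starM dS.
    rewrite (_ : (_ + _) * _ = star w * w + d * (star w * w) +
        (star w * w) * d + d * (star w * w) * d); last by ncring.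
    rewrite ww (_ : _ - _ = - (d * q) + (d + d) - q * d + d * d + d * d + d * d
      + d * d - d * q * d + d * d * d + d * d * d); last by ncring.
    by rewrite dq qd; ncring.
  have n2 : cnorm (d * d) <= 4^-1 * cnorm d.
    by rewrite (le_trans (cnormM _ _)) // ler_wpM2r ?cnorm_ge0 //; lra.
  have n3 : cnorm (d * d * d) <= 16^-1 * cnorm d.
    rewrite (le_trans (cnormM _ _)) // ler_wpM2r ?cnorm_ge0 //.
    by rewrite (le_trans n2) //; lra.
  have := cnormD (d * d + d * d + d * d) (d * d * d + d * d * d).
  have := cnormD (d * d + d * d) (d * d); have := cnormD (d * d) (d * d).
  have := cnormD (d * d * d) (d * d * d); have := cnorm_ge0 d; lra.
- rewrite w'E addrC addKr (le_trans (cnormM _ _)) // nd mulrA.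
  by rewrite ler_piMl ?cnorm_ge0 //; lra.
Qed.

(** Every iterate has the form [t * _], so whatever annihilates [t] from the left annihilates the
    limit. Taken with [a = 1 - p], this is how the range of [t] controls the range of [u]. *)
Lemma polar q t : is_proj q -> t * q = t -> cnorm (q - star t * t) <= 2^-1 ->
  exists u, [/\ star u * u = q, forall a, a * t = 0 -> a * u = 0
    & cnorm (u - t) <= 2 * cnorm (q - star t * t)].
Proof.
move=> qP tq; set c := cnorm _ => c2.
pose w n := iter n (polar_step q) t.
have wP n : [/\ w n * q = w n, cnorm (q - star (w n) * w n) <= c * 2^-1 ^+ n
    & forall a, a * t = 0 -> a * w n = 0].
  elim: n => [|n [IH1 IH2 IH3]]; first by rewrite expr0 mulr1.
  have [|h1 h2 _] := polar_stepP qP IH1.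
    rewrite (le_trans IH2) // (le_trans _ c2) // ler_piMr ?cnorm_ge0 //.
    by rewrite exprn_ile1 ?invr_ge0 // invf_le1 // ler1n.
  split=> //; first by rewrite (le_trans h2) // exprS mulrCA ler_pM2l ?invr_gt0.
  by move=> a a0; rewrite /w iterS /polar_step mulrA IH3 // mul0r.
have cn n : c * 2^-1 ^+ n <= 2^-1.
  rewrite (le_trans _ c2) // ler_piMr ?cnorm_ge0 //.
  by rewrite exprn_ile1 ?invr_ge0 // invf_le1 // ler1n.
have [|u wu ut] := @clim_geometric _ _ w c.
  move=> n; have [h1 h2 _] := wP n.
  by have [|_ _ h] := polar_stepP qP h1; [apply: le_trans h2 _ | apply:
    le_trans h h2].
exists u; split=> //.
  apply/esym/subr0_eq; apply: (@clim_eq0 _ _ (fun n => q - star (w n) * w n)).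
    by apply: climB; [exact: clim_cst | apply: climM => //; exact: clim_star].
  move=> n; have [_ + _] := wP n; move=> /le_trans; apply.
  by rewrite ler_piMl ?exprn_ge0 ?invr_ge0 //; lra.
move=> a a0; apply: (clim_uniq (climM (clim_cst a) wu)).
apply: clim_ext (clim_cst 0) => n.
by have [_ _ ->] := wP n.
Qed.

(* [t^* t = p v^* q v p] is close to [p v^* v v^* v p], hence to [p]. *)
Lemma mvn_corner p q v (t := q * v * p) (c : R) : is_proj p -> is_proj q ->
  cnorm v <= 1 -> cnorm (star v * v - p) <= c -> cnorm (v * star v - q) <= c ->
  cnorm (p - star t * t) <= 3 * c.
Proof.
move=> pP qP v1 vp vq; have [[pS pI] [qS qI]] := (pP, qP).
have np := is_proj_norm pP; have nvS : cnorm (star v) <= 1 by rewrite cnorm_star.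
have comp (a b x : A) : cnorm a <= 1 -> cnorm b <= 1 ->
    cnorm x <= c -> cnorm (a * x * b) <= c.
  by move=> a1 b1 xy; rewrite -[c]mulr1 cnormM_le // -[c]mul1r cnormM_le.
have m1 a b : cnorm a <= 1 -> cnorm b <= 1 -> cnorm (a * b) <= 1.
  by move=> a1 b1; rewrite -[1]mulr1 cnormM_le.
have vp' : cnorm (p - star v * v) <= c by rewrite cnorm_distC.
have -> : p - star t * t = p * (p - star v * v) * p
    + p * (star v * v) * (p - star v * v) * p
    + (p * star v) * (v * star v - q) * (v * p).
  rewrite /t !starM pS qS; move: (star v) => v'.
  rewrite (_ : p * (v' * q) * _ = p * v' * (q * q) * v * p); last by ncring.
  rewrite qI (_ : _ + _ = p * p * p - p * v' * v * p + p * v' * v * (p * p)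
     - p * v' * q * v * p); last by ncring.
  by rewrite !pI; ncring.
rewrite (_ : 3 * c = c + c + c); last by ring.
rewrite (le_trans (cnormD _ _)) // lerD ?comp ?m1 //.
by rewrite (le_trans (cnormD _ _)) // lerD ?comp ?m1.
Qed.

(** The polar part [u] of [t = q v p] satisfies [u^* u = p] exactly, and its range lies under [q].
    Hence the defect [q - u u^*] is a projection. It differs from the small [q - t t^*] by an amount
    controlled by [|u - t| <= 6/100], so its norm is below [1] and it vanishes. *)
Lemma mvn_gap p q v : is_proj p -> is_proj q -> cnorm v <= 1 ->
  cnorm (star v * v - p) <= 100^-1 -> cnorm (v * star v - q) <= 100^-1 ->
  mvn p q.
Proof.
move=> pP qP v1 vp vq; have [[pS pI] [qS qI]] := (pP, qP).
have [np nq] := (is_proj_norm pP, is_proj_norm qP).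
set t := q * v * p.
have tp : t * p = t by rewrite -mulrA pI.
have qt : (1 - q) * t = 0 by rewrite mulrBl mul1r /t -!mulrA (mulrA q q) qI subrr.
have tt : cnorm (p - star t * t) <= 3 * 100^-1 by exact: mvn_corner.
have [|u [uu ut nut]] := polar pP tp; first by rewrite (le_trans tt) //; lra.
have qu : q * u = u.
  by apply/esym/subr0_eq; rewrite -{1}[u]mul1r -mulrBl ut.
have up := sub_supp pS pI uu.
have uSq : star u * q = star u by rewrite -{2}qu starM qS.
have nu : cnorm u <= 1 by apply: cnorm_le1; rewrite uu.
have nt : cnorm t <= 1.
  by rewrite -[1]mulr1 cnormM_le // -[1]mulr1 cnormM_le.
have qtt : cnorm (q - t * star t) <= 3 * 100^-1.
  have := @mvn_corner q p (star v) 100^-1; rewrite !starM !starK pS qS !mulrA.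
  by apply=> //; rewrite cnorm_star.
have rP : is_proj (q - u * star u).
  split; first by rewrite starB starM starK qS.
  rewrite (_ : _ * _ = q * q - (q * u) * star u - u * (star u * q)
    + u * (star u * u) * star u); last by ncring.
  by rewrite qI qu uSq uu up subrK.
exists u; split=> //; apply/esym/subr0_eq/(is_proj_eq0 rP).
rewrite (_ : q - _ = (q - t * star t) - ((u - t) * star u + t * star (u - t)));
  last first.
  by rewrite starB; ncring.
apply: le_lt_trans (cnormB _ _) _.
have h1 : cnorm ((u - t) * star u) <= cnorm (u - t) * 1.
  by rewrite cnormM_le // cnorm_star.
have h2 : cnorm (t * star (u - t)) <= 1 * cnorm (u - t).
  by rewrite cnormM_le // cnorm_star.
have := cnormD ((u - t) * star u) (t * star (u - t)); lra.
Qed.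

(* The cubic [3 a^2 - 2 a^3] improves an approximate projection quadratically. *)
Lemma near_proj_sa a : star a = a -> cnorm (a * a - a) <= 8^-1 ->
  exists2 p, is_proj p & cnorm (p - a) <= 10 * cnorm (a * a - a).
Proof.
pose f a := a * a + a * a + a * a - a * a * a - a * a * a.
have fP (b : A) (e := b * b - b) : star b = b -> cnorm e <= 8^-1 ->
    [/\ star (f b) = f b, cnorm (f b * f b - f b) <= 2^-1 * cnorm e
      & cnorm (f b - b) <= 5 * cnorm e].
  move=> bS e8; split.
  - by rewrite /f !(starB, starD, starM) bS mulrA.
  - rewrite (_ : _ - _ = e * (e * e + e * e + e * e + e * e - e - e - e)); last first.
      by rewrite /f /e; ncring.
    rewrite (mulrC 2^-1) cnormM_le //.
    have ee : cnorm (e * e) <= 8^-1 * cnorm e.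
      by rewrite (le_trans (cnormM _ _)) // ler_wpM2r // cnorm_ge0.
    have := cnormB (e * e + e * e + e * e + e * e - e - e) e.
    have := cnormB (e * e + e * e + e * e + e * e - e) e.
    have := cnormB (e * e + e * e + e * e + e * e) e.
    have := cnormD (e * e + e * e + e * e) (e * e).
    have := cnormD (e * e + e * e) (e * e); have := cnormD (e * e) (e * e); lra.
  - rewrite (_ : _ - b = (1 - b - b) * e); last by rewrite /f /e; ncring.
    rewrite cnormM_le //.
    have nb : cnorm b <= 2.
      have := cnormD e b; rewrite subrK cnorm_sq_sa // => h.
      have := cnorm_ge0 b; nra.
    have := cnormB (1 - b) b; have := cnormB 1 b; rewrite cnorm1; lra.
move=> aS; set c := cnorm _ => c8.
pose w n := iter n f a.
have wP n : star (w n) = w n /\ cnorm (w n * w n - w n) <= c * 2^-1 ^+ n.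
  elim: n => [|n [IH1 IH2]]; first by rewrite expr0 mulr1.
  have [|h1 h2 _] := fP _ IH1.
    rewrite (le_trans IH2) // (le_trans _ c8) // ler_piMr ?cnorm_ge0 //.
    by rewrite exprn_ile1 ?invr_ge0 // invf_le1 // ler1n.
  by split=> //; rewrite (le_trans h2) // exprS mulrCA ler_pM2l ?invr_gt0.
have cn n : c * 2^-1 ^+ n <= 8^-1.
  rewrite (le_trans _ c8) // ler_piMr ?cnorm_ge0 //.
  by rewrite exprn_ile1 ?invr_ge0 // invf_le1 // ler1n.
have [|p wp pa] := @clim_geometric _ _ w (5 * c).
  move=> n; have [h1 h2] := wP n.
  have [|_ _ h] := fP _ h1; first exact: le_trans h2 _.
  by rewrite (le_trans h) // -mulrA ler_pM2l.
exists p; last by move: pa; rewrite mulrA (_ : 2 * 5 = 10) //; ring.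
split.
  by apply: (clim_uniq (clim_star wp)); apply: clim_ext wp => n; case: (wP n).
apply/subr0_eq; apply: (@clim_eq0 _ _ (fun n => w n * w n - w n)).
  by apply: climB => //; exact: climM.
move=> n; have [_] := wP n; move=> /le_trans; apply.
by rewrite ler_piMl ?exprn_ge0 ?invr_ge0 //; lra.
Qed.

(** The self-adjoint part of [a] is within [c / 2] of [a], and its idempotency defect is at most
    [3 c]. The self-adjoint case adds a distance of [30 c], and [40] leaves a margin. *)
Lemma near_proj a (c : R) : cnorm a <= 1 -> c <= 100^-1 ->
  cnorm (a * a - a) <= c -> cnorm (star a - a) <= c ->
  exists2 p, is_proj p & cnorm (p - a) <= 40 * c.
Proof.
move=> a1 c100 aI aS; set b := 2^-1%:C *: (a + star a).
have bS : star b = b by rewrite starZr starD starK addrC.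
have ab : cnorm (b - a) <= 2^-1 * c.
  rewrite -[in X in X <= _](scale_half a) /b -scalerDr -scalerBr cnormZr.
  rewrite ger0_norm ?invr_ge0 // ler_pM2l ?invr_gt0 //.
  by rewrite (_ : _ - _ = star a - a) //; ncring.
have b2 : cnorm b <= 1.
  rewrite cnormZr ger0_norm ?invr_ge0 //.
  by have := cnormD a (star a); rewrite cnorm_star; lra.
have bb : cnorm (b * b - b) <= 3 * c.
  rewrite (_ : _ - b = (b - a) * b + a * (b - a) + (a * a - a) - (b - a)); last first.
    by ncring.
  have h1 : cnorm ((b - a) * b) <= 2^-1 * c * 1 by exact: cnormM_le.
  have h2 : cnorm (a * (b - a)) <= 1 * (2^-1 * c) by exact: cnormM_le.
  have c0 : 0 <= c by rewrite (le_trans _ aS) ?cnorm_ge0.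
  have := cnormB ((b - a) * b + a * (b - a) + (a * a - a)) (b - a).
  have := cnormD ((b - a) * b + a * (b - a)) (a * a - a).
  have := cnormD ((b - a) * b) (a * (b - a)); lra.
have [|p pP pb] := near_proj_sa bS; first by rewrite (le_trans bb) //; lra.
exists p => //; have := cnorm_tri b p a; have := cnorm_ge0 (star a - a); lra.
Qed.

End Projections.
(** * Square roots and orthogonal elements *)

Section SquareRoot.
Variables (R : realType) (A : cstarType R).
Implicit Types (a f g h k p q t u v w x y z : A).

Lemma star_scalar (r : R) : star (r%:C *: 1 : A) = r%:C *: 1.
Proof. by rewrite starZr star1. Qed.

Lemma scalar_comm (r : R) x : r%:C *: 1 * x = x * (r%:C *: 1).
Proof. by rewrite -scalerAl mul1r -scalerAr mulr1. Qed.

(* [Y = 1 - sqrt x] is the fixed point of [Y |-> (1 - x + Y^2) / 2]. On the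
   boundary of the unit ball the iteration converges because it is dominated
   by the scalar iteration [r |-> (1 + r^2) / 2], which increases to [1]. *)
Lemma sqrt_unit x : star x = x -> cnorm (1 - x) <= 1 ->
  exists y, [/\ star y = y, y * y = x, cnorm (1 - y) <= 1
    & forall a, a * x = x * a -> a * y = y * a].
Proof.
move=> xS; set z := 1 - x => z1.
have zS : star z = z by rewrite starB star1 xS.
pose Y n := iter n (fun Y : A => 2^-1%:C *: (z + Y * Y)) 0.
pose r n := iter n (fun r : R => 2^-1 * (1 + r ^+ 2)) 0.
have rP n : 0 <= r n <= 1.
  elim: n => [|n /andP[IH0 IH1]]; first by rewrite lexx ler01.
  by rewrite /r iterS -/(r n); nra.
have YS n : star (Y n) = Y n.
  elim: n => [|n IH]; first by rewrite star0.
  by rewrite /Y iterS starZr starD starM -/(Y n) IH zS.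
have YC a n : a * z = z * a -> a * Y n = Y n * a.
  move=> az; elim: n => [|n IH]; first by rewrite mulr0 mul0r.
  rewrite /Y iterS -/(Y n) -scalerAr -scalerAl mulrDr mulrDl az; congr (_ *: (_ + _)).
  by rewrite mulrA IH -!mulrA IH.
have YY m n : Y m * Y n = Y n * Y m by apply: (YC (Y m)); rewrite (YC z).
have nY n : cnorm (Y n) <= r n.
  elim: n => [|n IH]; first by rewrite cnorm0.
  rewrite /Y /r !iterS -/(Y n) -/(r n) cnormZr ger0_norm ?invr_ge0 //.
  rewrite ler_pM2l ?invr_gt0 // (le_trans (cnormD _ _)) // lerD //.
  by rewrite expr2 cnormM_le.
have dY n : cnorm (Y n.+1 - Y n) <= r n.+1 - r n.
  elim: n => [|n IH].
    rewrite /Y /r /= mulr0 addr0 !subr0 cnormZr ger0_norm ?invr_ge0 //.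
    by rewrite expr0n addr0 ler_pM2l ?invr_gt0.
  rewrite {1}/Y iterS -/(Y n.+1) {2}/Y iterS -/(Y n).
  rewrite {1}/r iterS -/(r n.+1) {2}/r iterS -/(r n).
  rewrite -scalerBr cnormZr ger0_norm ?invr_ge0 //.
  (* Factoring the difference of squares relies on the iterates commuting with one another. *)
  rewrite (_ : _ - _ = (Y n.+1 + Y n) * (Y n.+1 - Y n)); last first.
    rewrite (_ : (_ + _) * _ = Y n.+1 * Y n.+1 - Y n.+1 * Y n + Y n * Y n.+1
      - Y n * Y n); last by ncring.
    by rewrite (YY n) subrK; ncring.
  rewrite (_ : _ - _ = 2^-1 * ((r n.+1 + r n) * (r n.+1 - r n))); last by ring.
  rewrite ler_pM2l ?invr_gt0 // cnormM_le //.
  by rewrite (le_trans (cnormD _ _)) // lerD.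
have [|Y' Ylim] := clim_telescope dY (c := 1).
  by move=> n; case/andP: (rP n).
rewrite /Y /r /= !subr0 => nY'.
have fixY : Y' = 2^-1%:C *: (z + Y' * Y').
  apply: (clim_uniq (clim_shift Ylim)); apply: climZ.
  by apply: climD; [exact: clim_cst | exact: climM].
have fixY2 : Y' + Y' = z + Y' * Y' by rewrite {1 2}fixY scale_half.
exists (1 - Y'); split.
- rewrite starB star1; congr (_ - _).
  by apply: (clim_uniq (clim_star Ylim)); exact: clim_ext Ylim.
- rewrite (_ : _ * _ = 1 - (Y' + Y') + Y' * Y'); last by ncring.
  by rewrite fixY2 /z; ncring.
- by rewrite opprB addrC subrK.
- move=> a ax; rewrite mulrBr mulrBl mulr1 mul1r; congr (_ - _).
  apply: (clim_uniq (climM (clim_cst a) Ylim)).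
  apply: clim_ext (climM Ylim (clim_cst a)) => n.
  by rewrite (YC a) // /z mulrBr mulrBl mulr1 mul1r ax.
Qed.

(** For self-adjoint [x], the bound [|T - x| <= T] for some [T > 0] is positivity expressed through
    the norm; dividing by [T] reduces to the unit case. *)
Lemma sqrt_scaled x (T : R) : 0 < T -> star x = x ->
  cnorm (T%:C *: 1 - x) <= T ->
  exists y, [/\ star y = y, y * y = x & forall a, a * x = x * a -> a * y = y * a].
Proof.
move=> T0 xS xT.
have [||y [yS yy _ yc]] := @sqrt_unit (T^-1%:C *: x).
- by rewrite starZr xS.
- rewrite (_ : 1 - _ = T^-1%:C *: (T%:C *: 1 - x)).
    rewrite cnormZr gtr0_norm ?invr_gt0 // mulrC ler_pdivrMr // mul1r //.
  by rewrite scalerBr scalerA -rmorphM /= mulVf ?gt_eqF // scale1r.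
exists ((Num.sqrt T)%:C *: y); split.
- by rewrite starZr yS.
- rewrite -scalerAl -scalerAr scalerA -rmorphM /= -expr2 sqr_sqrtr ?ltW //.
  by rewrite yy scalerA -rmorphM /= divff ?gt_eqF // scale1r.
- move=> a ax; rewrite -scalerAr -scalerAl yc //.
  by rewrite -scalerAr -scalerAl ax.
Qed.

(* [y + i w] is a multiple of a unitary. *)
Lemma norm_le_unitary y w (c : R) : 0 <= c -> star y = y -> star w = w ->
  y * w = w * y -> y * y + w * w = (c ^+ 2)%:C *: 1 -> cnorm y <= c.
Proof.
move=> c0 yS wS yw yyww; set i : R[i] := (0 +i* 1)%C.
have iC : (i^*)%C = - i by rewrite /i /=; apply/eqP;
  rewrite eq_complex /= oppr0 !eqxx.
have ii : i * i = -1.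
  by apply/eqP; rewrite eq_complex /=; rewrite !(mul0r, mulr0, mulr1, mul1r,
    sub0r, addr0, oppr0) !eqxx.
set u := y + i *: w.
have uS : star u = y - i *: w by rewrite starD starZ yS wS iC scaleNr.
have nu : cnorm u <= c.
  rewrite -(@ler_pXn2r _ 2) ?nnegrE ?cnorm_ge0 // -cstar_identity uS.
  rewrite (_ : _ * _ = (c ^+ 2)%:C *: 1).
    by rewrite cnormZr cnorm1 mulr1 ger0_norm // sqr_ge0.
  rewrite -yyww /u (_ : (_ - _) * _ = y * y - i *: w * y + y * (i *: w)
    - i *: w * (i *: w)); last by ncring.
  by rewrite -!scalerAl -!scalerAr scalerA ii scaleN1r opprK yw subrK.
have -> : y = 2^-1%:C *: (u + star u).
  rewrite uS /u addrACA addrN addr0.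
  by rewrite scalerDr scale_half.
rewrite cnormZr ger0_norm ?invr_ge0 //.
by have := cnormD u (star u); rewrite cnorm_star; lra.
Qed.

(** Two positive elements with scalar sum commute, and so do their square roots [v] and [w]. As
    [v^2 + w^2 = s], the element [v + i w] is [sqrt s] times a unitary, whence [|v|^2 <= s]. *)
Lemma norm_le_scalar x y (s S T : R) : 0 <= s -> 0 < S -> 0 < T ->
  star x = x -> star y = y -> cnorm (S%:C *: 1 - x) <= S ->
  cnorm (T%:C *: 1 - y) <= T -> x + y = s%:C *: 1 -> cnorm x <= s.
Proof.
move=> s0 S0 T0 xS yS xpos ypos xy.
have [v [vS vv vc]] := sqrt_scaled S0 xS xpos.
have [w [wS ww wc]] := sqrt_scaled T0 yS ypos.
have yE : y = s%:C *: 1 - x by rewrite -xy addrC addKr.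
have yv : y * v = v * y.
  apply: vc; rewrite yE mulrBl mulrBr; congr (_ - _).
  exact: scalar_comm.
have vw : v * w = w * v by apply: wc; rewrite yv.
rewrite -vv cnorm_sq_sa // -[leRHS](sqr_sqrtr s0) ler_pXn2r ?nnegrE ?cnorm_ge0
  ?sqrtr_ge0 //.
apply: (norm_le_unitary (sqrtr_ge0 s) vS wS vw).
by rewrite vv ww xy sqr_sqrtr.
Qed.

(** The square root [w] of [1 - k^2] exists because [|k^2| <= 1], and [w + i k] is unitary; so
    [|w| <= 1]. *)
Lemma norm_1B_sqr k : star k = k -> cnorm k <= 1 -> cnorm (1 - k * k) <= 1.
Proof.
move=> kS k1.
have xS : star (1 - k * k) = 1 - k * k by rewrite starB star1 starM kS.
have [|w [wS ww _ wc]] := sqrt_unit xS.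
  by rewrite subKr -[1]mulr1 cnormM_le.
have kw : k * w = w * k.
  by apply: wc; rewrite mulrBl mulrBr mulr1 mul1r mulrA.
rewrite -ww cnorm_sq_sa // expr_le1 ?cnorm_ge0 //.
apply: (norm_le_unitary ler01 wS kS) => //.
by rewrite ww subrK expr1n scale1r.
Qed.

(* With [|k|] the square root of [k^2], the product of [|k| + k] and [|k| - k]
   vanishes. *)
Lemma orthogonal_or_definite k : star k = k -> cnorm k <= 1 ->
  (exists f g, [/\ star f = f, star g = g, f != 0, g != 0 & f * g = 0]) \/
  cnorm (1 - k) <= 1 \/ cnorm (1 + k) <= 1.
Proof.
move=> kS k1.
have kkS : star (k * k) = k * k by rewrite starM kS.
have [y [yS yy y1 yc]] := sqrt_unit kkS (norm_1B_sqr kS k1).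
have ky : k * y = y * k by apply: yc; rewrite mulrA.
have [yk|nyk] := eqVneq (y - k) 0.
  by right; left; rewrite -(subr0_eq yk).
have [ypk|nypk] := eqVneq (y + k) 0.
  by right; right; rewrite (_ : k = - y) //; apply/esym/eqP;
    rewrite eqr_oppLR -addr_eq0 ypk.
left; exists (y + k), (y - k); split=> //.
- by rewrite starD yS kS.
- by rewrite starB yS kS.
rewrite (_ : _ * _ = y * y - y * k + k * y - k * k); last by ncring.
by rewrite yy ky subrK subrr.
Qed.

(** Without orthogonal pairs, [h - c] is definite for every scalar [c] in []0, 1[]. If it were
    negative, positivity of [h] would give [|h| <= c < 1]. So it is positive, and together with the
    positive [1 - h] it adds up to [1 - c]; hence [|h - c| <= 1 - c]. Then [c] tends to [1]. *)
Lemma unit_definite h :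
  ~ (exists f g, [/\ star f = f, star g = g, f != 0, g != 0 & f * g = 0]) ->
  star h = h -> cnorm h = 1 -> cnorm (1 - h) <= 1 -> h = 1.
Proof.
move=> noorth hS h1 h1'.
have close (c : R) : 0 < c < 1 -> cnorm (h - 1) <= 2 * (1 - c).
  move=> /andP[c0 c1].
  have kS : star (h - c%:C *: 1) = h - c%:C *: 1 by rewrite starB star_scalar hS.
  have nk : cnorm (2^-1%:C *: (h - c%:C *: 1)) <= 1.
    rewrite cnormZr ger0_norm ?invr_ge0 //.
    have := cnormB h (c%:C *: 1); rewrite cnormZr cnorm1 gtr0_norm //; lra.
  have half x : 2 * cnorm (1 - 2^-1%:C *: x) = cnorm (2%:C *: 1 - x).
    rewrite -{1}(@ger0_norm _ (2 : R)) // -cnormZr scalerBr scalerA -rmorphM /=.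
    by rewrite divff ?scale1r // pnatr_eq0.
  have kS' : star (2^-1%:C *: (h - c%:C *: 1)) = 2^-1%:C *: (h - c%:C *: 1).
    by rewrite starZr kS.
  have [//|[k1|k1]] := orthogonal_or_definite kS' nk.
  - have hc : cnorm (h - c%:C *: 1) <= 1 - c.
      apply: (@norm_le_scalar _ (1 - h) _ 2 1) => //; first by lra.
      + by rewrite starB star1 hS.
      + by rewrite -half; lra.
      + by rewrite scale1r subKr h1.
      by rewrite rmorphB /= scalerBl scale1r; ncring.
    have := cnorm_tri (c%:C *: 1) h 1; rewrite (cnorm_distC _ 1).
    rewrite (_ : c%:C *: 1 - 1 = (c - 1)%:C *: 1); last first.
      by rewrite rmorphB /= scalerBl scale1r.
    by rewrite cnormZr cnorm1 ler0_norm; lra.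
  - suff : cnorm h <= c by rewrite h1; lra.
    apply: (@norm_le_scalar h (c%:C *: 1 - h) c 1 2) => //; first exact: ltW.
    + by rewrite starB star_scalar hS.
    + by rewrite scale1r.
    + by rewrite -[c%:C *: 1 - h]opprB -half scalerN opprK; lra.
    by rewrite addrC subrK.
apply/subr0_eq/cnorm_eq0; apply/eqP; rewrite eq_le cnorm_ge0 andbT leNgt.
(* This [c] makes the bound [2 (1 - c)] equal to half of [|h - 1|], a contradiction. *)
apply/negP => d0; have := close (1 - cnorm (h - 1) / 4).
by rewrite (cnorm_distC h) in d0 *; lra.
Qed.

(** Otherwise every self-adjoint element is a scalar: once normalised, it or its opposite is
    positive of norm [1], hence equal to [1]. Real and imaginary parts then make every element a
    scalar. *)
Lemma exists_orthogonal :
  ~ (exists e : A, forall x : A, exists c : R[i], x = c *: e) ->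
  exists f g, [/\ star f = f, star g = g, f != 0, g != 0 & f * g = 0].
Proof.
move=> nsc; apply: contrapT => noorth; apply: nsc; exists 1.
have sa h : star h = h -> exists c : R[i], h = c *: 1.
  move=> hS; have [->|h0] := eqVneq h 0; first by exists 0; rewrite scale0r.
  have n0 : 0 < cnorm h.
    rewrite lt_neqAle cnorm_ge0 andbT eq_sym; apply: contra h0 => /eqP/cnorm_eq0 ->//.
  set h' := (cnorm h)^-1%:C *: h.
  have hE : h = (cnorm h)%:C *: h'.
    by rewrite /h' scalerA -rmorphM /= divff ?gt_eqF // scale1r.
  have h'S : star h' = h' by rewrite starZr hS.
  have h'1 : cnorm h' = 1.
    by rewrite cnormZr gtr0_norm ?invr_gt0 // mulVf ?gt_eqF.
  have h'1' : cnorm h' <= 1 by rewrite h'1.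
  have [//|[k|k]] := orthogonal_or_definite h'S h'1'.
    exists (cnorm h)%:C; rewrite {1}hE (_ : h' = 1) //; exact: unit_definite.
  exists (- (cnorm h)%:C); rewrite {1}hE scaleNr -scalerN -[h']opprK (_ :
    - h' = 1) //.
  by apply: unit_definite; rewrite ?starN ?h'S ?cnormN ?opprK.
move=> x.
have [c xc] := sa (2^-1%:C *: (x +
  star x)) ltac:(by rewrite starZr starD starK addrC).
set i : R[i] := (0 +i* 1)%C.
have iC : (i^*)%C = - i by rewrite /i /=; apply/eqP;
  rewrite eq_complex /= oppr0 !eqxx.
have ii : i * i = -1.
  by apply/eqP; rewrite eq_complex /=; rewrite !(mul0r, mulr0, mulr1, mul1r,
    sub0r, addr0, oppr0) !eqxx.
have [d xd] := sa (i *: (2^-1%:C *: (x - star x)))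
  ltac:(by rewrite starZ iC starZr starB starK scaleNr -scalerN -scalerN opprB).
exists (c - i * d); rewrite scalerBl -xc -scalerA -xd (scalerA i i) ii scaleN1r opprK.
by rewrite -scalerDr addrACA addrN addr0 scalerDr scale_half.
Qed.

End SquareRoot.

(** * Purely infinite simple algebras *)

Section PurelyInfinite.
Variables (R : realType).

(* What is used of pure infiniteness; it passes to elementary extensions. *)
Definition orth_isometries (A : cstarType R) := exists u v : A,
  [/\ star u * u = 1, star v * v = 1 & star u * v = 0].

Definition proj_absorbing (A : cstarType R) := forall p q : A,
  is_proj p -> is_proj q -> p != 0 -> q != 0 ->
  exists w, star w * w = q /\ p * w = w.

Definition infinite_alg (A : cstarType R) := orth_isometries A /\ proj_absorbing A.

Variable A : cstarType R.

Lemma is_proj1 : is_proj (1 : A).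
Proof. by split; rewrite ?star1 ?mulr1. Qed.

Lemma is_proj0 : is_proj (0 : A).
Proof. by split; rewrite ?star0 ?mulr0. Qed.

(** Take the polar part of [t = p x q]: [t^* t = q (x^* p x) q] is within [1/2] of [q], the radius
    accepted by [polar], and [(1 - p) t = 0] puts the range under [p]. *)
Lemma polar_compress (p q x : A) : is_proj p -> is_proj q ->
  cnorm (star x * p * x - q) <= 2^-1 ->
  exists w, star w * w = q /\ p * w = w.
Proof.
move=> pP qP; have [[pS pI] [qS qI]] := (pP, qP) => xq.
set t := p * x * q.
have tt : star t * t = q * (star x * p * x) * q.
  rewrite /t !starM pS qS (_ : _ * _ = q * star x * (p * p) * x * q); last by ncring.
  by rewrite pI; ncring.
have [||w [ww wt _]] := @polar _ _ q t qP.
- by rewrite /t -mulrA qI.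
- rewrite tt cnorm_distC (_ : _ - q = q * (star x * p * x - q) * q).
    rewrite -[2^-1]mulr1 cnormM_le ?is_proj_norm // -[2^-1]mul1r cnormM_le //.
    exact: is_proj_norm.
  by rewrite mulrBr mulrBl !qI.
exists w; split=> //; apply/esym/subr0_eq; rewrite -{1}[w]mul1r -mulrBl.
by apply: wt; rewrite mulrBl mul1r /t -!mulrA (mulrA p p) pI subrr.
Qed.

Lemma pis_compress (a b : A) (eps : R) : purely_infinite_simple A ->
  positive a -> a != 0 -> positive b -> b != 0 -> 0 < eps ->
  exists x, cnorm (x * a * star x - b) < eps.
Proof.
move=> [_ hA] ap a0 bp b0 e0; have [x] := hA a b ap a0 bp b0.
move=> xl; have [N /(_ N (leqnn N)) h] := (climP (fun n =>
  x n * a * star (x n)) b).1 xl eps e0.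
by exists (x N).
Qed.

Lemma proj_positive (p : A) : is_proj p -> positive p.
Proof. by move=> [pS pI]; exists p; rewrite pS pI. Qed.

(** Compressing [h^2] to within [1/2] of [1] makes the polar part of [h x^*] an isometry that is
    annihilated from the left by whatever annihilates [h]. Applied to orthogonal [f] and [g], this
    passes from [g f = 0] to [g u = 0], and then from [u^* g = 0] to [u^* v = 0]. *)
Lemma pis_infinite : purely_infinite_simple A -> infinite_alg A.
Proof.
move=> hA; have h20 : 0 < 2^-1 :> R by rewrite invr_gt0.
split; last first.
  move=> p q pP qP p0 q0.
  have [x xq] := pis_compress hA (proj_positive pP) p0 (proj_positive qP) q0 h20.
  by apply: (@polar_compress p q (star x)) => //; rewrite starK ltW.
have [f [g [fS gS f0 g0 fg]]] := exists_orthogonal hA.1.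
have isom (h : A) : star h = h -> h != 0 ->
    exists w, star w * w = 1 /\ forall a, a * h = 0 -> a * w = 0.
  move=> hS h0.
  have hh0 : h * h != 0.
    apply: contra h0 => /eqP hh; apply/eqP/cnorm_eq0/eqP.
    by rewrite -sqrf_eq0 -cnorm_sq_sa // hh cnorm0.
  have hhP : positive (h * h) by exists h; rewrite hS.
  have [x xq] := pis_compress hA hhP hh0 (proj_positive is_proj1) (oner_neq0 _) h20.
  have [||w [ww wt _]] := @polar _ _ 1 (h * star x) is_proj1.
  - by rewrite mulr1.
  - by rewrite starM starK hS cnorm_distC ltW // mulrA -(mulrA x).
  by exists w; split=> // a ah; apply: wt; rewrite mulrA ah mul0r.
have [u [uu uf]] := isom f fS f0; have [v [vv vg]] := isom g gS g0.
exists u, v; split=> //; apply: vg; rewrite -gS -starM uf ?star0 //.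
by rewrite -fS -gS -starM fg star0.
Qed.

End PurelyInfinite.
(** * Addition of projections up to equivalence *)

Section ProjAdd.
Variables (R : realType) (A : cstarType R).
Implicit Types (p q r t u v w x y z : A).

(** Addition of [V(A)] as a relation between projections of [A]: [r] is the sum of orthogonal copies
    of [p] and [q]. By [padd_mvn] and [padd_uniq] the possible [r] form one full equivalence
    class. *)
Definition padd p q r := exists v w,
  [/\ star v * v = p, star w * w = q, star v * w = 0 & v * star v + w * star w = r].

Lemma star_eq0 v w : star v * w = 0 -> star w * v = 0.
Proof. by move=> vw; rewrite -[v]starK -starM vw star0. Qed.

Lemma mulsv_eq0 v : star v * v = 0 -> v = 0.
Proof.
move=> v0; apply/cnorm_eq0/eqP.
by rewrite -sqrf_eq0 -cstar_identity v0 cnorm0.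
Qed.

Lemma is_proj_range v : is_proj (star v * v) -> is_proj (v * star v).
Proof.
move=> vP; have [vv _] := mvn_supp vP erefl erefl.
by split; rewrite ?starM ?starK // mulrA -(mulrA v) vv.
Qed.

Lemma mvn_proj p q : is_proj p -> mvn p q -> is_proj q.
Proof. by move=> pP [v [vp <-]]; apply: is_proj_range; rewrite vp. Qed.

Lemma mvn_eq0 p : mvn p 0 -> p = 0.
Proof.
move=> [v [<-]]; rewrite -{1}[v]starK => /mulsv_eq0 v0.
by rewrite v0 mul0r.
Qed.

Lemma padd_proj p q r : is_proj p -> is_proj q -> padd p q r -> is_proj r.
Proof.
move=> pP qP [v [w [vp wq vw <-]]].
have [_ vI] : is_proj (v * star v) by apply: is_proj_range; rewrite vp.
have [_ wI] : is_proj (w * star w) by apply: is_proj_range; rewrite wq.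
split; first by rewrite starD !starM !starK.
rewrite (_ : _ * _ = v * star v * (v * star v) + v * (star v * w) * star w
  + w * (star w * v) * star v + w * star w * (w * star w)); last by ncring.
by rewrite vI wI vw (star_eq0 vw) !(mulr0, mul0r) !addr0.
Qed.

Lemma padd_comm p q r : padd p q r -> padd q p r.
Proof.
move=> [v [w [vp wq vw vwr]]]; exists w, v.
by split=> //; [exact: star_eq0 | rewrite addrC].
Qed.

Lemma padd0 p : is_proj p -> padd p 0 p.
Proof.
by move=> [pS pI]; exists p, 0; rewrite star0 !mulr0 pS pI addr0.
Qed.

Lemma padd_supp p q r v w : is_proj p -> is_proj q ->
  star v * v = p -> star w * w = q -> star v * w = 0 ->
  v * star v + w * star w = r -> r * v = v /\ r * w = w.
Proof.
move=> pP qP vp wq vw <-; rewrite !mulrDl -!mulrA vp wq vw (star_eq0 vw).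
rewrite !mulr0 addr0 add0r; split; first by case: (mvn_supp pP vp erefl).
by case: (mvn_supp qP wq erefl).
Qed.

Lemma padd_mvn p q r r' : is_proj p -> is_proj q ->
  padd p q r -> mvn r r' -> padd p q r'.
Proof.
move=> pP qP pqr [t [tr tr']]; have rP := padd_proj pP qP pqr.
have [v [w [vp wq vw vwr]]] := pqr.
have [rv rw] := padd_supp pP qP vp wq vw vwr.
have [trt _] := mvn_supp rP tr tr'.
exists (t * v), (t * w); rewrite !starM; split.
- by rewrite mulrA -(mulrA (star v)) tr -mulrA rv.
- by rewrite mulrA -(mulrA (star w)) tr -mulrA rw.
- by rewrite mulrA -(mulrA (star v)) tr -mulrA rw.
rewrite (_ : _ + _ = t * (v * star v + w * star w) * star t); last by ncring.
by rewrite vwr trt.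
Qed.

Lemma padd_uniq p q r r' : is_proj p -> is_proj q ->
  padd p q r -> padd p q r' -> mvn r r'.
Proof.
move=> pP qP [v [w [vp wq vw vwr]]] [v' [w' [vp' wq' vw' vwr']]].
have [vpv _] := mvn_supp pP vp erefl; have [wqw _] := mvn_supp qP wq erefl.
have [vpv' _] := mvn_supp pP vp' erefl; have [wqw' _] := mvn_supp qP wq' erefl.
exists (v' * star v + w' * star w); rewrite starD !starM !starK; split.
  rewrite (_ : _ * _ = v * (star v' * v') * star v + v * (star v' * w') * star w
    + w * (star w' * v') * star v + w * (star w' * w') * star w); last by ncring.
  rewrite vp' wq' vw' (star_eq0 vw') vpv wqw !mulr0 !mul0r !addr0; exact: vwr.
rewrite (_ : _ * _ = v' * (star v * v) * star v' + v' * (star v * w) * star w'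
  + w' * (star w * v) * star v' + w' * (star w * w) * star w'); last by ncring.
by rewrite vp wq vw (star_eq0 vw) vpv' wqw' !mulr0 !mul0r !addr0.
Qed.

(** The partial isometry [v'] is defined on [r = v v^* + w w^*] and splits into [v' v] and [v' w];
    [y] collects the copy of [q] made by [v' w] and the copy of [t]. *)
Lemma padd_assoc p q r t z : is_proj p -> is_proj q -> is_proj t ->
  padd p q r -> padd r t z ->
  exists y, [/\ is_proj y, padd q t y & padd p y z].
Proof.
move=> pP qP tP pqr; have rP := padd_proj pP qP pqr.
have [v [w [vp wq vw vwr]]] := pqr; move=> [v' [w' [vr wt vw' vwz]]].
have [rv rw] := padd_supp pP qP vp wq vw vwr.
have [vrv _] := mvn_supp rP vr erefl.
have qty : padd q t (v' * w * star (v' * w) + w' * star w').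
  exists (v' * w), w'; rewrite !starM; split=> //.
    by rewrite mulrA -(mulrA (star w)) vr -mulrA rw.
  by rewrite -mulrA vw' mulr0.
have yP := padd_proj qP tP qty.
exists (v' * w * star (v' * w) + w' * star w'); split=> //.
exists (v' * v), (v' * w * star (v' * w) + w' * star w').
have [-> ->] := yP; rewrite !starM; split=> //.
- by rewrite mulrA -(mulrA (star v)) vr -mulrA rv.
- rewrite (_ : _ * _ = star v * ((star v' * v') * w) * star w * star v'
    + star v * (star v' * w') * star w'); last by ncring.
  by rewrite vr rw vw vw' !(mulr0, mul0r) addr0.
- rewrite (_ : _ + _ = v' * (v * star v + w * star w) * star v' + w' * star w').
    by rewrite vwr vrv.
  by ncring.
Qed.

Lemma padd_ex p q : orth_isometries A -> is_proj p -> is_proj q ->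
  exists2 r, is_proj r & padd p q r.
Proof.
move=> [a [b [aa bb ab]]] pP qP; have [[pS pI] [qS qI]] := (pP, qP).
have pqr : padd p q (a * p * star (a * p) + b * q * star (b * q)).
  exists (a * p), (b * q); rewrite !starM pS qS; split=> //.
  - by rewrite mulrA -(mulrA p) aa mulr1.
  - by rewrite mulrA -(mulrA q) bb mulr1.
  - by rewrite mulrA -(mulrA p) ab mulr0 mul0r.
by exists (a * p * star (a * p) + b * q * star (b * q)) => //; exact: padd_proj pqr.
Qed.

(* Inside [q], put a copy of [p] orthogonal to a copy of [1]. *)
Lemma padd_sub p q : infinite_alg A -> is_proj p -> is_proj q -> p != 0 ->
  q != 0 -> exists r, [/\ is_proj r, r != 0 & padd p r q].
Proof.
move=> [[a [b [aa bb ab]]] abs] pP qP p0 q0; have [[pS pI] [qS qI]] := (pP, qP).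
have ba : star b * a = 0 by exact: star_eq0.
set c := a * p * star a + b * star b.
have ac : star a * c = p * star a.
  rewrite (_ : _ * _ = star a * a * p * star a + star a * b * star b);
    last by rewrite /c; ncring.
  by rewrite aa ab mul1r mul0r addr0.
have bc : star b * c = star b.
  rewrite (_ : _ * _ = star b * a * p * star a + star b * b * star b);
    last by rewrite /c; ncring.
  by rewrite bb ba mul1r !mul0r add0r.
have cP : is_proj c.
  split; first by rewrite starD !starM !starK pS mulrA.
  rewrite {1}/c mulrDl -!mulrA ac bc (mulrA p) pI; congr (_ + _).
  by rewrite mulrA.
have c0 : c != 0.
  apply/eqP => c0; have := bb.
  have : star b * c * b = 0 by rewrite c0 mulr0 mul0r.
  by rewrite bc => ->; apply/eqP; rewrite eq_sym oner_eq0.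
have [w [wc qw]] := abs q c qP cP q0 c0.
set v := w * a * p.
have vv : star v * v = p.
  rewrite /v !starM pS (_ : _ * _ = p * (star a * (star w * w)) * a * p);
    last by ncring.
  by rewrite wc ac -!mulrA (mulrA (star a) a) aa mul1r !pI.
have qv : q * v = v by rewrite /v !mulrA qw.
have vq : star v * q = star v by have := congr1 star qv; rewrite starM qS.
have vpv : v * p = v by rewrite /v -mulrA pI.
have vb : star v * (w * b) = 0.
  rewrite /v !starM pS (_ : _ * _ = p * (star a * (star w * w)) * b); last by ncring.
  by rewrite wc ac -!mulrA ab !mulr0.
have rP : is_proj (q - v * star v).
  split; first by rewrite starB starM starK qS.
  rewrite (_ : _ * _ = q * q - (q * v) * star v - v * (star v * q)
    + v * (star v * v) * star v); last by ncring.
  by rewrite qI qv vq vv vpv subrK.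
(* The remainder is nonzero because it still contains the range of [w * b], which is nonzero and
   orthogonal to that of [v]. *)
exists (q - v * star v); split=> //.
  apply/eqP => /subr0_eq qE.
  have wb0 : w * b = 0.
    by rewrite -qw qE -mulrA -(mulrA v) vb mulr0.
  have : star b * (star w * w) * b = 0 by rewrite -!mulrA wb0 !mulr0.
  by rewrite wc bc bb => /eqP; rewrite oner_eq0.
have [rS rI] := rP.
exists v, (q - v * star v); rewrite rS rI; split=> //.
  rewrite mulrBr vq mulrA vv -{1}vpv starM pS subrr //.
by rewrite addrC subrK.
Qed.

End ProjAdd.

(** * The stabilization inside the algebra *)

(** The isometries are [u^i v]: the range of [v] is orthogonal to that of [u], and powers of [u]
    push it into pairwise orthogonal positions. *)
Lemma exists_isometries (R : realType) (A : cstarType R) : orth_isometries A ->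
  exists s : nat -> A, forall i j, star (s i) * s j = (i == j)%:R.
Proof.
move=> [u [v [uu vv uv]]]; have vu := star_eq0 uv.
exists (fun i => iter i (fun x => u * x) v); elim=> [|i IH] [|j] //=.
- by rewrite mulrA vu mul0r.
- by rewrite starM -mulrA uv mulr0.
- by rewrite starM mulrA -(mulrA _ (star u)) uu mulr1 IH eqSS.
Qed.

Lemma star_sum (R : realType) (A : cstarType R) (I : Type) (r : seq I)
    (P : pred I) (F : I -> A) :
  star (\sum_(i <- r | P i) F i) = \sum_(i <- r | P i) star (F i).
Proof. exact: (big_morph _ (@starD R A) (star0 A)). Qed.

Lemma sum_finite_support (V : nmodType) (F : nat -> V) (N : nat) :
  (forall k, (N <= k)%N -> F k = 0) ->
  \sum_(k \in [set: nat]) F k = \sum_(k < N) F k.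
Proof.
move=> F0; rewrite -(fsbig_widen `I_N setT) ?fsbig_ord // => k [_ /=].
by move=> /negP; rewrite -leqNgt => /F0.
Qed.

Section Stabilization.
Variables (R : realType) (A : cstarType R) (s : nat -> A).
Hypothesis sP : forall i j, star (s i) * s j = (i == j)%:R.
Implicit Types (a b p q : A) (x y : imx A) (X Y : nat -> imx A) (i j k N : nat).

Lemma sum_delta (F : nat -> A) N i :
  \sum_(k < N) (i == k)%:R * F k = if (i < N)%N then F i else 0.
Proof.
case: ltnP => [iN|Ni].
  rewrite (bigD1 (Ordinal iN)) //= eqxx mul1r big1 ?addr0 // => k /eqP ki.
  rewrite (_ : (_ == _) = false) ?mul0r //; apply/eqP => ik; apply: ki.
  exact/val_inj.
rewrite big1 // => k _; rewrite (_ : (_ == _) = false) ?mul0r //.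
by apply/eqP => ik; move: (ltn_ord k); rewrite -ik ltnNge Ni.
Qed.

Definition bounded x N := forall i j, (N <= i)%N || (N <= j)%N -> x i j = 0.

Definition phi x : A :=
  \sum_(i \in [set: nat]) s i * \sum_(j \in [set: nat]) x i j * star (s j).

(** Compression by the isometries inverts [phi] on the corner cut out by [corner_unit N]. Identities
    about [phi] are thus checked on coefficients, through [phi_eq]. *)
Definition coef a : imx A := fun i j => star (s i) * a * s j.

Definition corner_unit N := \sum_(i < N) s i * star (s i).

Lemma phiE x N : bounded x N ->
  phi x = \sum_(i < N) s i * \sum_(j < N) x i j * star (s j).
Proof.
move=> xN; rewrite /phi (@sum_finite_support _ _ N); last first.
  move=> k Nk; rewrite (@sum_finite_support _ _ 0) ?big_ord0 ?mulr0 // => l _.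
  by rewrite xN ?Nk // mul0r.
apply: eq_bigr => i _; rewrite (@sum_finite_support _ _ N) // => k Nk.
by rewrite xN ?Nk ?orbT // mul0r.
Qed.

Lemma unit_mull N j :
  star (s j) * corner_unit N = if (j < N)%N then star (s j) else 0.
Proof.
rewrite mulr_sumr -(sum_delta (fun i => star (s i))); apply: eq_bigr => i _.
by rewrite mulrA sP.
Qed.

Lemma unit_star N : star (corner_unit N) = corner_unit N.
Proof. by rewrite star_sum; apply: eq_bigr => i _; rewrite starM starK. Qed.

Lemma unit_mulr N j : corner_unit N * s j = if (j < N)%N then s j else 0.
Proof.
by have := congr1 star (unit_mull N j);
  rewrite starM starK unit_star (fun_if star) starK star0.
Qed.

Lemma unit_proj N : is_proj (corner_unit N).
Proof.
split; first exact: unit_star.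
rewrite {1}/corner_unit mulr_suml; apply: eq_bigr => i _.
by rewrite -mulrA unit_mull ltn_ord.
Qed.

Lemma phi_unitl x N : bounded x N -> corner_unit N * phi x = phi x.
Proof.
move=> xN; rewrite (phiE xN) mulr_sumr; apply: eq_bigr => i _.
by rewrite mulrA unit_mulr ltn_ord.
Qed.

Lemma phi_unitr x N : bounded x N -> phi x * corner_unit N = phi x.
Proof.
move=> xN; rewrite (phiE xN) mulr_suml; apply: eq_bigr => i _.
rewrite -mulrA mulr_suml; congr (_ * _); apply: eq_bigr => j _.
by rewrite -mulrA unit_mull ltn_ord.
Qed.

Lemma coef_phi x N : bounded x N -> coef (phi x) = x.
Proof.
move=> xN; apply/funext => i; apply/funext => j; rewrite /coef (phiE xN).
rewrite mulr_sumr (eq_bigr (fun k : 'I_N => (i == k)%:R *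
    \sum_(l < N) x k l * star (s l))); last by move=> k _; rewrite mulrA sP.
rewrite (sum_delta (fun k => \sum_(l < N) x k l * star (s l))).
case: ltnP => iN; last by rewrite mul0r xN ?iN.
rewrite mulr_suml (eq_bigr (fun l : 'I_N => (j == l)%:R * x i l)).
  by rewrite (sum_delta (x i)); case: ltnP => // jN; rewrite xN // jN orbT.
move=> l _; rewrite -mulrA sP eq_sym.
by case: eqP => _; rewrite ?mulr1 ?mul1r ?mulr0 ?mul0r.
Qed.

Lemma coef_bounded a N : corner_unit N * a = a -> a * corner_unit N = a ->
  bounded (coef a) N.
Proof.
move=> Na aN i j; rewrite /coef -{1}Na -{1}aN => /orP[Ni|Nj].
  by rewrite mulrA unit_mull ltnNge Ni /= !mul0r.
by rewrite -!mulrA unit_mulr ltnNge Nj /= !mulr0.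
Qed.

Lemma phi_coef a N : corner_unit N * a = a -> a * corner_unit N = a ->
  phi (coef a) = a.
Proof.
move=> Na aN; rewrite (phiE (coef_bounded Na aN)) -[RHS]Na -{2}aN.
rewrite {1}/corner_unit mulr_suml; apply: eq_bigr => i _.
rewrite -[RHS]mulrA; congr (_ * _); rewrite /corner_unit !mulr_sumr.
by apply: eq_bigr => j _; rewrite /coef !mulrA.
Qed.

Lemma phi_eq a x N : corner_unit N * a = a -> a * corner_unit N = a ->
  (forall i j, coef a i j = x i j) -> phi x = a.
Proof.
move=> Na aN ax; rewrite -[RHS](phi_coef Na aN); congr phi.
by apply/funext => i; apply/funext => j.
Qed.

Lemma bounded_widen x N N' : (N <= N')%N -> bounded x N -> bounded x N'.
Proof.
move=> NN' xN i j /orP[h|h]; apply: xN; rewrite (leq_trans NN' h) ?orbT //.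
Qed.

Lemma finite_pair x y : imx_finite x -> imx_finite y ->
  exists N, bounded x N /\ bounded y N.
Proof.
move=> [N xN] [N' yN']; exists (maxn N N').
by split; [apply: bounded_widen xN | apply: bounded_widen yN'];
  rewrite ?leq_maxl ?leq_maxr.
Qed.

Lemma phiB x y : imx_finite x -> imx_finite y ->
  phi (imx_sub x y) = phi x - phi y.
Proof.
move=> xf yf; have [N [xN yN]] := finite_pair xf yf.
apply: (@phi_eq _ _ N) => [||i j].
- by rewrite mulrBr !phi_unitl.
- by rewrite mulrBl !phi_unitr.
- by rewrite /imx_sub -{2}(coef_phi xN) -{2}(coef_phi yN) /coef mulrBr mulrBl.
Qed.

Lemma phiD x y : imx_finite x -> imx_finite y ->
  phi (imx_add x y) = phi x + phi y.
Proof.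
move=> xf yf; have [N [xN yN]] := finite_pair xf yf.
apply: (@phi_eq _ _ N) => [||i j].
- by rewrite mulrDr !phi_unitl.
- by rewrite mulrDl !phi_unitr.
- by rewrite /imx_add -{2}(coef_phi xN) -{2}(coef_phi yN) /coef mulrDr mulrDl.
Qed.

Lemma phi_star x : imx_finite x -> phi (imx_star x) = star (phi x).
Proof.
move=> [N xN]; apply: (@phi_eq _ _ N) => [||i j].
- by rewrite -[corner_unit N]unit_star -starM phi_unitr.
- by rewrite -[corner_unit N]unit_star -starM phi_unitl.
- by rewrite /imx_star -{2}(coef_phi xN) /coef !starM starK mulrA.
Qed.

Lemma phiM x y : imx_finite x -> imx_finite y ->
  phi (imx_mul x y) = phi x * phi y.
Proof.
move=> xf yf; have [N [xN yN]] := finite_pair xf yf.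
apply: (@phi_eq _ _ N) => [||i j].
- by rewrite mulrA phi_unitl.
- by rewrite -mulrA phi_unitr.
rewrite /imx_mul (@sum_finite_support _ _ N); last first.
  by move=> k Nk; rewrite xN ?Nk ?orbT // mul0r.
rewrite (eq_bigr (fun k : 'I_N => coef (phi x) i k * coef (phi y) k j)); last first.
  by move=> k _; rewrite (coef_phi xN) (coef_phi yN).
rewrite {1}/coef -{1}(phi_unitr xN); move: (phi x) (phi y) => a b.
rewrite /corner_unit mulr_sumr mulr_suml mulr_sumr mulr_suml.
by apply: eq_bigr => k _; rewrite /coef !mulrA.
Qed.

Lemma phi_corner a k : phi (corner a k) = s 0%N * a * star (s 0%N).
Proof.
have u1 : corner_unit 1 = s 0%N * star (s 0%N) by rewrite /corner_unit big_ord1.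
apply: (@phi_eq _ _ 1) => [||i j]; rewrite ?u1.
- by rewrite !mulrA -(mulrA (s 0%N)) sP mulr1.
- by rewrite -!mulrA (mulrA (star _)) sP mul1r.
rewrite /coef !mulrA sP -!mulrA sP eq_sym [0%N == j]eq_sym /=.
by case: i j => [|i] [|j] /=; rewrite ?mul1r ?mulr1 ?mul0r ?mulr0.
Qed.

Lemma finiteB x y : imx_finite x -> imx_finite y -> imx_finite (imx_sub x y).
Proof.
move=> xf yf; have [N [xN yN]] := finite_pair xf yf; exists N => i j ij.
by rewrite /imx_sub xN // yN // subrr.
Qed.

Lemma finiteD x y : imx_finite x -> imx_finite y -> imx_finite (imx_add x y).
Proof.
move=> xf yf; have [N [xN yN]] := finite_pair xf yf; exists N => i j ij.
by rewrite /imx_add xN // yN // addr0.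
Qed.

Lemma finiteS x : imx_finite x -> imx_finite (imx_star x).
Proof.
by move=> [N xN]; exists N => i j ij; rewrite /imx_star xN ?star0 // orbC.
Qed.

Lemma finiteM x y : imx_finite x -> imx_finite y -> imx_finite (imx_mul x y).
Proof.
move=> xf yf; have [N [xN yN]] := finite_pair xf yf; exists N => i j ij.
rewrite /imx_mul fsbig1 // => k _.
by case/orP: ij => h; [rewrite xN ?h // mul0r | rewrite yN ?h ?orbT // mulr0].
Qed.

Lemma finite0 : imx_finite (imx_zero A).
Proof. by exists 0%N. Qed.

Lemma finite_seq_zero k : imx_finite (@seq_zero R A k).
Proof. exact: finite0. Qed.

Lemma phi0 : phi (imx_zero A) = 0.
Proof. by rewrite (@phiE _ 0) // big_ord0. Qed.

(* A column [xi] corresponds to the element [sum_i s_i xi_i]. *)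
Definition col_elt N (xi : nat -> A) := \sum_(i < N) s i * xi i.

Lemma coef_col N xi i : star (s i) * col_elt N xi = if (i < N)%N then xi i else 0.
Proof.
rewrite mulr_sumr -(sum_delta xi); apply: eq_bigr => k _; by rewrite mulrA sP.
Qed.

Lemma col_normE N xi : (forall i, (N <= i)%N -> xi i = 0) ->
  col_norm xi = cnorm (col_elt N xi).
Proof.
move=> xiN; rewrite /col_norm (@sum_finite_support _ _ N); last first.
  by move=> k Nk; rewrite xiN // mulr0.
rewrite (_ : \sum_(i < N) _ = star (col_elt N xi) * col_elt N xi).
  by rewrite cstar_identity sqrtr_sqr ger0_norm // cnorm_ge0.
rewrite {1}/col_elt star_sum mulr_suml; apply: eq_bigr => k _.
by rewrite starM -mulrA coef_col ltn_ord.
Qed.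

Lemma phi_col x N xi : bounded x N ->
  phi x * col_elt N xi = col_elt N (fun i => \sum_(j < N) x i j * xi j).
Proof.
move=> xN; rewrite (phiE xN) mulr_suml; apply: eq_bigr => i _.
rewrite -mulrA mulr_suml; congr (_ * _); apply: eq_bigr => j _.
by rewrite -mulrA coef_col ltn_ord.
Qed.

(** Columns correspond isometrically to elements [col_elt N xi], on which the matrix acts as left
    multiplication by [phi x]. This bounds the operator norm by [cnorm (phi x)]. *)
Lemma imx_normE x : imx_finite x -> imx_norm x = cnorm (phi x).
Proof.
move=> [N xN].
have actE N' xi : bounded x N' -> (forall i, (N' <= i)%N -> xi i = 0) ->
    col_norm (fun i => \sum_(j \in [set: nat]) x i j * xi j) =
    cnorm (phi x * col_elt N' xi).
  move=> xN' xiN'; rewrite (phi_col _ xN') -col_normE; last first.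
    by move=> i N'i; rewrite big1 // => j _; rewrite xN' ?N'i // mul0r.
  congr col_norm; apply/funext => i; rewrite (@sum_finite_support _ _ N') //.
  by move=> k Nk; rewrite xN' ?Nk ?orbT // mul0r.
apply/eqP; rewrite eq_le; apply/andP; split.
  apply: ge_sup.
    exists (col_norm (fun i => \sum_(j \in [set: nat]) x i j * 0)), (fun=> 0).
    split=> //; first by exists 0%N.
    by rewrite (@col_normE 0) // /col_elt big_ord0 cnorm0.
  move=> _ [xi [[N0 xi0] xi1 ->]].
  have xN' := bounded_widen (leq_maxl N N0) xN.
  have xiN' i : (maxn N N0 <= i)%N -> xi i = 0.
    by rewrite geq_max => /andP[_]; exact: xi0.
  rewrite (actE _ _ xN' xiN') -[leRHS]mulr1 cnormM_le //.
  by rewrite -col_normE.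
(* This column corresponds to [corner_unit N], which [phi x] absorbs on the right; the supremum is
   attained there. *)
pose xi i := if (i < N)%N then star (s i) else 0.
have xiN i : (N <= i)%N -> xi i = 0 by rewrite /xi ltnNge => ->.
have colE : col_elt N xi = corner_unit N.
  by apply: eq_bigr => i _; rewrite /xi ltn_ord.
apply: ub_le_sup.
  exists (cnorm (phi x)) => _ [eta [[N0 eta0] eta1 ->]].
  have xN' := bounded_widen (leq_maxl N N0) xN.
  have etaN' i : (maxn N N0 <= i)%N -> eta i = 0.
    by rewrite geq_max => /andP[_]; exact: eta0.
  rewrite (actE _ _ xN' etaN') -[leRHS]mulr1 cnormM_le //.
  by rewrite -col_normE.
exists xi; split; first by exists N.
  by rewrite (col_normE xiN) colE; exact: is_proj_norm (unit_proj N).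
by rewrite (actE _ _ xN xiN) colE phi_unitr.
Qed.

(** Distances in the stabilization are distances of images under [phi], so equality in the
    completion becomes equality of limits in [A]. *)
Lemma stab_eqP X Y a b : (forall k, imx_finite (X k)) ->
  (forall k, imx_finite (Y k)) -> clim (phi \o X) a -> clim (phi \o Y) b ->
  stab_eq X Y <-> a = b.
Proof.
move=> Xf Yf Xa Yb; have XY : stab_eq X Y = clim (fun k => phi (X k) - phi (Y k)) 0.
  rewrite /stab_eq /clim (_ : (fun k => imx_norm _) =
    (fun k => cnorm (phi (X k) - phi (Y k) - 0))) //; apply/funext => k.
  by rewrite imx_normE ?phiB ?subr0 //; exact: finiteB.
rewrite XY; split=> [XY0|ab].
  by apply/subr0_eq; apply: (clim_uniq (climB Xa Yb)).
by rewrite -(subrr b) -{1}ab; exact: climB.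
Qed.

Lemma clim_seq_mul X Y a b : (forall k, imx_finite (X k)) ->
  (forall k, imx_finite (Y k)) -> clim (phi \o X) a -> clim (phi \o Y) b ->
  clim (phi \o seq_mul X Y) (a * b).
Proof.
by move=> Xf Yf Xa Yb; apply: clim_ext (climM Xa Yb) => k; rewrite /comp -phiM.
Qed.

Lemma clim_seq_add X Y a b : (forall k, imx_finite (X k)) ->
  (forall k, imx_finite (Y k)) -> clim (phi \o X) a -> clim (phi \o Y) b ->
  clim (phi \o seq_add X Y) (a + b).
Proof.
by move=> Xf Yf Xa Yb; apply: clim_ext (climD Xa Yb) => k; rewrite /comp -phiD.
Qed.

Lemma clim_seq_star X a : (forall k, imx_finite (X k)) ->
  clim (phi \o X) a -> clim (phi \o seq_star X) (star a).
Proof.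
by move=> Xf Xa; apply: clim_ext (clim_star Xa) => k; rewrite /comp -phi_star.
Qed.

Lemma clim_seq_zero : clim (phi \o @seq_zero R A) 0.
Proof. by apply: clim_ext (clim_cst 0) => k; rewrite /comp phi0. Qed.

Lemma stab_lim (X : stab A) : exists a, clim (phi \o X) a.
Proof.
apply: cnorm_complete => eps e0; have [N NP] := stab_cauchy X e0.
exists N => m n Nm Nn.
have [fm fn] := (stab_finite X m, stab_finite X n).
by rewrite -phiB // -imx_normE ?NP //; exact: finiteB.
Qed.

(** Brings elements of [A] back to the stabilization: [coef] of a convergent sequence of corner
    elements is a Cauchy sequence of finite matrices. *)
Lemma stab_of (u : nat -> A) a :
  (forall k, exists N, corner_unit N * u k = u k /\ u k * corner_unit N = u k) ->
  clim u a -> exists X : stab A, clim (phi \o X) a.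
Proof.
move=> uN /climP ua.
have fin k : imx_finite (coef (u k)).
  by have [N [Nu uN']] := uN k; exists N; exact: coef_bounded.
have phiu k : phi (coef (u k)) = u k.
  by have [N [Nu uN']] := uN k; exact: phi_coef Nu uN'.
have cau (eps : R) : 0 < eps -> exists N : nat, forall k l, (N <= k)%N ->
  (N <= l)%N ->
    imx_norm (imx_sub (coef (u k)) (coef (u l))) < eps.
  move=> e0; have e2 : 0 < eps / 2 by lra.
  have [N NP] := ua _ e2; exists N => k l Nk Nl.
  rewrite imx_normE ?phiB ?phiu //; last exact: finiteB.
  rewrite (le_lt_trans (cnorm_tri a _ _)) // (cnorm_distC a).
  by have := NP k Nk; have := NP l Nl; lra.
exists (Stab fin cau); apply/climP => eps e0; have [N NP] := ua _ e0.
by exists N => n Nn; rewrite /= phiu NP.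
Qed.

Lemma projection_lim (p : projection A) : exists2 a, is_proj a & clim (phi \o p) a.
Proof.
have [a pa] := stab_lim p; exists a => //; have pf := stab_finite p; split.
  apply: (proj1 (stab_eqP _ pf (clim_seq_star pf pa) pa) (proj_star p)) => k.
  exact: finiteS.
apply: (proj1 (stab_eqP _ pf (clim_seq_mul pf pf pa pa) pa) (proj_idem p)) => k.
exact: finiteM.
Qed.

Lemma mvn_equivP (p q : projection A) a b : clim (phi \o p) a ->
  clim (phi \o q) b -> mvn_equiv p q <-> mvn a b.
Proof.
move=> pa qb; have [pf qf] := (stab_finite p, stab_finite q).
have aP : is_proj a.
  by have [a' a'P pa'] := projection_lim p; rewrite (clim_uniq pa pa').
have vP (v : stab A) c : clim (phi \o v) c ->
    (stab_eq (seq_mul (seq_star v) v) p <-> star c * c = a) /\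
    (stab_eq (seq_mul v (seq_star v)) q <-> c * star c = b).
  move=> vc; have vf := stab_finite v.
  have vsf k : imx_finite (seq_star v k) by exact: finiteS.
  have vsc := clim_seq_star vf vc.
  split; apply: stab_eqP => //; try by move=> k; exact: finiteM.
    exact: clim_seq_mul.
  exact: clim_seq_mul.
split=> [[v [vp vq]]|[c [ca cb]]].
  have [c vc] := stab_lim v; have [h1 h2] := vP v c vc.
  by exists c; split; [apply/h1 | apply/h2].
have [cac bcc] := mvn_supp aP ca cb.
(* Since [c = b * c * a], it is the limit of these products, each of which lies in a corner. *)
have [||v vc] := @stab_of (fun k => phi (q k) * c * phi (p k)) c.
- move=> k; have [N [qN pN]] := finite_pair (qf k) (pf k); exists N.
  by rewrite !mulrA phi_unitl // -!mulrA phi_unitr.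
- by rewrite -{2}bcc -{2}cac mulrA; apply: climM => //; apply: climM => //;
  exact: clim_cst.
have [h1 h2] := vP v c vc.
by exists v; split; [apply/h1 | apply/h2].
Qed.

End Stabilization.
(** * The group of differences *)

Lemma cls_eqP (T : Type) (E : T -> T -> Prop) (x y : T) :
  (forall a, E a a) -> (forall a b, E a b -> E b a) ->
  (forall a b c, E a b -> E b c -> E a c) -> cls E x = cls E y <-> E x y.
Proof.
move=> Er Es Et; split=> [/(congr1 (@proj1_sig _ _)) /= ->|xy]; first exact: Er.
apply: eq_exist; apply/funext => a; apply/propext.
by split; [apply: Et; exact: Es | exact: Et].
Qed.

Lemma cls_repr (T : Type) (E : T -> T -> Prop) (C : quot E) : cls E (Defs.repr C) = C.
Proof. case: C => C CP; rewrite /cls /Defs.repr; case: cid => x xC.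
by apply: eq_exist; rewrite -xC. Qed.

Section Groth.
Variables (S : Type) (add : S -> S -> S) (zero : S) (nz : S -> Prop).
Hypothesis addA : associative add.
Hypothesis addC : commutative add.
Hypothesis add0 : left_id zero add.
Hypothesis zero_or_nz : forall a, a = zero \/ nz a.
Hypothesis nzD : forall a b, nz a -> nz (add a b).
Hypothesis nz_sub : forall a b, nz a -> nz b -> exists2 c, nz c & add a c = b.
Variable u : S.
Hypothesis nzu : nz u.

HB.instance Definition _ := Monoid.isComLaw.Build S zero add addA addC add0.

Local Infix "+++" := add (at level 50, left associativity).

(* The nonzero elements form a commutative semigroup in which every equation
   [a + x = b] is solvable, hence a group. *)
Lemma nz_cancel a b c : nz a -> nz b -> a +++ c = b +++ c -> a = b.
Proof.
move=> na nb; have [->|nc] := zero_or_nz c; first by rewrite !(addC _ zero) !add0.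
have [e ne ae] := nz_sub na na.
have be b' : nz b' -> b' +++ e = b'.
  move=> nb'; have [x _ <-] := nz_sub na nb'.
  by rewrite -addA (addC x) addA ae.
have [d _ cd] := nz_sub nc ne.
by move=> acbc; rewrite -(be a) // -(be b) // -cd !addA acbc.
Qed.

(* [d] represents the formal difference [x.1 - x.2]. *)
Definition diff (x : S * S) d := nz d /\ exists w, d +++ x.2 +++ w = x.1 +++ w.

(** Adding [u] to both components makes them nonzero, and then the equation for [d] is solvable. *)
Lemma diff_ex x : exists d, diff x d.
Proof.
have nzDu a : nz (a +++ u) by rewrite addC; exact: nzD.
have [d nd xd] := nz_sub (nzDu x.2) (nzDu x.1).
by exists d; split=> //; exists u; rewrite -xd -addA.
Qed.

Lemma diff_groth x y d : diff x d -> diff y d -> groth_eq add x y.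
Proof.
move=> [_ [w xw]] [_ [w' yw']]; exists (w +++ w').
rewrite [LHS](AC (2*2) ((1*3)*(2*4))) /= -xw.
rewrite [RHS](AC (2*2) ((1*4)*(2*3))) /= -yw'.
by rewrite [LHS](AC (3*2) ((1*4*5)*(2*3))) /=.
Qed.

Lemma groth_diff x y d : groth_eq add x y -> diff x d -> diff y d.
Proof.
move=> [z xyz] [nd [w xw]]; split=> //; exists (x.2 +++ w +++ z).
rewrite [LHS](AC (2*3) ((1*3*4)*(2*5))) /= xw.
rewrite [LHS](AC (2*2) ((1*3*4)*2)) /= xyz.
by rewrite [LHS](AC (3*1) (1*(2*4*3))) /=.
Qed.

Lemma diff_uniq x d d' : diff x d -> diff x d' -> d = d'.
Proof.
move=> [nd [w xw]] [nd' [w' xw']]; apply: (@nz_cancel _ _ (x.2 +++ w +++ w')) => //.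
rewrite [LHS](AC (1*3) ((1*2*3)*4)) /= xw.
rewrite [RHS](AC (1*3) ((1*2*4)*3)) /= xw'.
by rewrite [LHS](AC (2*1) (1*3*2)) /=.
Qed.

Lemma groth_eqP x y : groth_eq add x y <-> exists2 d, diff x d & diff y d.
Proof.
split=> [xy|[d xd yd]]; last exact: diff_groth xd yd.
by have [d xd] := diff_ex x; exists d => //; exact: groth_diff xd.
Qed.

(** Transitivity of [groth_eq] comes from uniqueness of the nonzero element representing a formal
    difference. *)
Lemma groth_cls x y :
  cls (groth_eq add) x = cls (groth_eq add) y <-> groth_eq add x y.
Proof.
apply: cls_eqP => [a|a b|a b c]; rewrite !groth_eqP.
- by have [d ad] := diff_ex a; exists d.
- by move=> [d ad bd]; exists d.
- move=> [d ad bd] [d' bd' cd']; exists d => //.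
  by rewrite (diff_uniq bd bd').
Qed.

Lemma diffD x y d d' : diff x d -> diff y d' ->
  diff (x.1 +++ y.1, x.2 +++ y.2) (d +++ d').
Proof.
move=> [nd [w xw]] [nd' [w' yw']]; split; first exact: nzD.
exists (w +++ w') => /=.
rewrite [LHS](AC (2*2*2) ((1*3*5)*(2*4*6))) /= xw yw'.
by rewrite [LHS](AC (2*2) (1*3*(2*4))) /=.
Qed.

Lemma diff_nz a : nz a -> diff (a, zero) a.
Proof. by move=> na; split=> //; exists zero; rewrite -addA add0. Qed.

Definition gcls a : groth add := cls _ (a, zero).

Lemma gcls_surj (X : groth add) : exists2 a, nz a & X = gcls a.
Proof.
have [d Xd] := diff_ex (Defs.repr X); exists d; first by case: Xd.
rewrite -[LHS]cls_repr; apply/groth_cls; apply: (diff_groth Xd).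
by apply: diff_nz; case: Xd.
Qed.

Lemma gcls_inj a b : nz a -> nz b -> gcls a = gcls b <-> a = b.
Proof.
move=> na nb; split=> [/groth_cls/groth_diff h|->//].
exact: diff_uniq (h _ (diff_nz na)) (diff_nz nb).
Qed.

Lemma gcls_diff x d : diff x d -> cls (groth_eq add) x = gcls d.
Proof.
move=> xd; apply/groth_cls; apply: (diff_groth xd).
by apply: diff_nz; case: xd.
Qed.

Lemma repr_diff a : nz a -> diff (Defs.repr (gcls a)) a.
Proof.
move=> na; apply: groth_diff (diff_nz na).
by apply/groth_cls; rewrite cls_repr.
Qed.

Lemma gcls_add a b : nz a -> nz b ->
  groth_add (gcls a) (gcls b) = gcls (a +++ b).
Proof. by move=> na nb; apply: gcls_diff; apply: diffD; exact: repr_diff. Qed.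

Lemma diff00 e : diff (zero, zero) e <-> nz e /\ e +++ e = e.
Proof.
split=> [[ne [w]]|[ne ee]].
  rewrite /= (addC e) add0 => ew; split=> //.
  apply: (@nz_cancel _ _ (w +++ u)) => //; first exact: nzD.
  rewrite [LHS](AC (2*2) (1*((2*3)*4))) /= ew.
  by rewrite add0.
split=> //; exists e.
by rewrite /= (addC e zero) add0 ee.
Qed.

(** Among nonzero elements the zero of the group shows up as the idempotent. In this form it can be
    expressed by a formula about nonzero projections, and so can opposites. *)
Lemma gcls_zero e : nz e -> cls _ (zero, zero) = gcls e <-> e +++ e = e.
Proof.
move=> ne; split=> [/groth_cls/groth_eqP[d zd ed]|ee].
  by rewrite (diff_uniq (diff_nz ne) ed); case/diff00: zd.
by apply: gcls_diff; apply/diff00.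
Qed.

Lemma idem_uniq e e' : nz e -> nz e' -> e +++ e = e -> e' +++ e' = e' -> e = e'.
Proof.
move=> ne ne' ee ee'; apply: (@nz_cancel _ _ (e +++ e')) => //.
by rewrite addA ee [RHS]addC -addA ee'.
Qed.

Lemma diff_swap x d d' : diff x d -> diff (x.2, x.1) d' ->
  d +++ d' +++ (d +++ d') = d +++ d'.
Proof.
move=> [nd [w xw]] [nd' [w' yw']]; apply: (proj2 ((diff00 _).1 _)).
split; first exact: nzD.
exists (x.1 +++ x.2 +++ w +++ w'); rewrite /= (addC _ zero) !add0.
rewrite [LHS](AC (2*4) ((1*4*5)*(2*3*6))) /= xw yw' /=.
by rewrite [LHS](AC (2*2) (1*3*2*4)) /=.
Qed.

Lemma gcls_opp a b : nz a -> nz b ->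
  groth_opp (gcls a) = gcls b <-> exists e, [/\ nz e, e +++ e = e & a +++ b = e].
Proof.
move=> na nb; have ra := repr_diff na.
have [c rc] := diff_ex ((Defs.repr (gcls a)).2, (Defs.repr (gcls a)).1).
have ac := diff_swap ra rc; have nc : nz c by case: rc.
rewrite /groth_opp (gcls_diff rc) gcls_inj //; split=> [<-|[e [ne ee abe]]].
  by exists (a +++ c); split=> //; exact: nzD.
apply: (@nz_cancel _ _ a) => //; rewrite !(addC _ a) abe.
by apply: idem_uniq => //; exact: nzD.
Qed.

End Groth.

(** * The ordered group [K_0] of a purely infinite simple algebra *)

Section Vmonoid.
Variables (R : realType) (A : cstarType R).

Definition prj := {p : A | is_proj p}.

Implicit Types (p q r : prj).

Definition Vcls p : V A :=
  cls _ (corner_proj (proj1 (proj2_sig p)) (proj2 (proj2_sig p))).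

Definition prj0 : prj := exist _ 0 (is_proj0 A).
Definition prj1 : prj := exist _ 1 (is_proj1 A).

Hypothesis Aiso : orth_isometries A.

Lemma mvn_equiv_equivalence :
  [/\ forall x, @mvn_equiv R A x x,
      forall x y, @mvn_equiv R A x y -> mvn_equiv y x
    & forall x y z, @mvn_equiv R A x y -> mvn_equiv y z -> mvn_equiv x z].
Proof.
have [s sP] := exists_isometries Aiso.
split=> [x|x y|x y z]; have [a aP xa] := projection_lim sP x.
- by rewrite (mvn_equivP sP xa xa); exact: mvn_refl.
- have [b bP yb] := projection_lim sP y.
  by rewrite (mvn_equivP sP xa yb) (mvn_equivP sP yb xa); exact: mvn_sym.
have [b bP yb] := projection_lim sP y; have [c cP zc] := projection_lim sP z.
rewrite (mvn_equivP sP xa yb) (mvn_equivP sP yb zc) (mvn_equivP sP xa zc).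
exact: mvn_trans.
Qed.

Lemma V_clsP (x y : projection A) :
  cls (@mvn_equiv R A) x = cls (@mvn_equiv R A) y <-> mvn_equiv x y.
Proof. by have [h1 h2 h3] := mvn_equiv_equivalence; exact: cls_eqP. Qed.

Lemma corner_lim (s : nat -> A) p : (forall i j, star (s i) * s j = (i == j)%:R) ->
  clim (phi s \o corner_proj (proj1 (proj2_sig p)) (proj2 (proj2_sig p)))
    (s 0%N * proj1_sig p * star (s 0%N)).
Proof.
move=> sP; apply: clim_ext (clim_cst _) => k.
by rewrite /comp (phi_corner sP).
Qed.

Lemma corner_mvn (s : nat -> A) p : (forall i j, star (s i) * s j = (i == j)%:R) ->
  mvn (proj1_sig p) (s 0%N * proj1_sig p * star (s 0%N)).
Proof.
case: p => p [pS pI] sP /=; exists (s 0%N * p); rewrite starM pS; split.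
  by rewrite mulrA -(mulrA p) sP mulr1.
by rewrite mulrA -(mulrA _ p p) pI.
Qed.

(** The image under [phi] of the corner matrix of [p] is [s 0 * p * star (s 0)], a copy of [p]; the
    comparison then takes place inside [A]. *)
Lemma cls_Vcls (s : nat -> A) (x : projection A) a p :
  (forall i j, star (s i) * s j = (i == j)%:R) -> clim (phi s \o x) a ->
  cls _ x = Vcls p <-> mvn a (proj1_sig p).
Proof.
move=> sP xa; rewrite /Vcls V_clsP (mvn_equivP sP xa (corner_lim p sP)).
have aP : is_proj a.
  by have [b bP xb] := projection_lim sP x; rewrite (clim_uniq xa xb).
have cP := corner_mvn p sP; have pP := proj2_sig p.
have cP' := mvn_proj pP cP.
by split=> h; [apply: mvn_trans h (mvn_sym cP) | apply: mvn_trans h cP].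
Qed.

Lemma Vcls_eq p q : Vcls p = Vcls q <-> mvn (proj1_sig p) (proj1_sig q).
Proof.
have [s sP] := exists_isometries Aiso.
rewrite {1}/Vcls (cls_Vcls _ sP (corner_lim p sP)).
have cP := corner_mvn p sP; have pP := proj2_sig p; have cP' := mvn_proj pP cP.
by split=> h; [apply: mvn_trans cP h | apply: mvn_trans (mvn_sym cP) h].
Qed.

Lemma Vcls_surj a : exists p, a = Vcls p.
Proof.
have [s sP] := exists_isometries Aiso.
rewrite -[a]cls_repr; move: (Defs.repr a) => x.
have [b bP xb] := projection_lim sP x.
by exists (exist _ b bP); apply/(cls_Vcls _ sP xb) => /=; exact: mvn_refl.
Qed.

(** As [V_add] picks some admissible class, two things are shown: the corners of [v v^*] and [w w^*]
    are orthogonal representatives with sum [r], and any other choice yields an equivalent sum, by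
    [padd_uniq]. *)
Lemma V_addE p q r : padd (proj1_sig p) (proj1_sig q) (proj1_sig r) ->
  V_add (Vcls p) (Vcls q) = Vcls r.
Proof.
move=> pqr; have [s sP] := exists_isometries Aiso.
have [pP qP rP] := And3 (proj2_sig p) (proj2_sig q) (proj2_sig r).
rewrite /V_add; apply: (@xget_unique {classic V A}) => [|c [x [y [z [px qy ->
  xy0 xyz]]]]].
  have [v [w [vp wq vw vwr]]] := pqr.
  have vP : is_proj (v * star v) by apply: is_proj_range; rewrite vp.
  have wP : is_proj (w * star w) by apply: is_proj_range; rewrite wq.
  pose p' : prj := exist _ _ vP; pose q' : prj := exist _ _ wP.
  pose X : projection A := corner_proj (proj1 vP) (proj2 vP).
  pose Y : projection A := corner_proj (proj1 wP) (proj2 wP).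
  pose Z : projection A := corner_proj (proj1 (proj2_sig r)) (proj2 (proj2_sig r)).
  have Xl : clim (phi s \o X) _ := corner_lim p' sP.
  have Yl : clim (phi s \o Y) _ := corner_lim q' sP.
  have Zl : clim (phi s \o Z) _ := corner_lim r sP.
  have [Xf Yf] := (stab_finite X, stab_finite Y).
  exists X, Y, Z; split.
  - by apply/(Vcls_eq p p'); exists v.
  - by apply/(Vcls_eq q q'); exists w.
  - by [].
  - have XYf k : imx_finite (seq_mul X Y k) by exact: finiteM.
    have XYl := clim_seq_mul sP Xf Yf Xl Yl.
    rewrite (stab_eqP sP XYf (@finite_seq_zero R A) XYl (clim_seq_zero s)).
    rewrite /= -!mulrA (mulrA (star (s 0%N))) sP mul1r !mulrA.
    by rewrite -(mulrA _ (star v) w) vw mulr0 !mul0r.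
  - have XYf k : imx_finite (seq_add X Y k) by exact: finiteD.
    have XYl := clim_seq_add sP Xf Yf Xl Yl.
    rewrite (stab_eqP sP XYf (stab_finite Z) XYl Zl).
    by rewrite /= -mulrDl -mulrDr vwr.
have [a aP xa] := projection_lim sP x; have [b bP yb] := projection_lim sP y.
have [d dP zd] := projection_lim sP z.
have pa : mvn (proj1_sig p) a.
  by apply: mvn_sym; apply/(cls_Vcls _ sP xa); rewrite px.
have qb : mvn (proj1_sig q) b.
  by apply: mvn_sym; apply/(cls_Vcls _ sP yb); rewrite qy.
apply/(cls_Vcls _ sP zd).
have [xf yf zf] := And3 (stab_finite x) (stab_finite y) (stab_finite z).
have ab0 : a * b = 0.
  apply: (proj1 (stab_eqP sP _ (@finite_seq_zero R A)
    (clim_seq_mul sP xf yf xa yb) (clim_seq_zero s)) xy0).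
  by move=> k; exact: finiteM.
have abd : a + b = d.
  apply: (proj1 (stab_eqP sP _ zf (clim_seq_add sP xf yf xa yb) zd) xyz) => k.
  exact: finiteD.
have [v [vp va]] := pa; have [w [wq wb]] := qb.
apply: (padd_uniq pP qP _ pqr); exists v, w; split=> //; last by rewrite va wb.
have [_ av] := mvn_supp pP vp va; have [_ bw] := mvn_supp qP wq wb.
have [aS _] := aP; rewrite -av -bw starM aS -mulrA (mulrA a) ab0.
by rewrite !(mulr0, mul0r).
Qed.

Lemma V_addP p q r :
  V_add (Vcls p) (Vcls q) = Vcls r <-> padd (proj1_sig p) (proj1_sig q) (proj1_sig r).
Proof.
have [pP qP] := (proj2_sig p, proj2_sig q).
split; last exact: V_addE.
have [r' r'P pqr'] := padd_ex Aiso pP qP.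
rewrite (@V_addE p q (exist _ r' r'P) pqr') => /Vcls_eq /=.
exact: padd_mvn.
Qed.

Lemma V_zeroE : V_zero A = Vcls prj0.
Proof. by congr (cls _ (corner_proj _ _)); exact: Prop_irrelevance. Qed.

Lemma V_unitE : V_unit A = Vcls prj1.
Proof. by congr (cls _ (corner_proj _ _)); exact: Prop_irrelevance. Qed.

Lemma V_addC : commutative (@V_add R A).
Proof.
move=> a b; have [p ->] := Vcls_surj a; have [q ->] := Vcls_surj b.
have [r rP pqr] := padd_ex Aiso (proj2_sig p) (proj2_sig q).
rewrite (@V_addE p q (exist _ r rP)) //; apply/esym/V_addE.
exact: padd_comm.
Qed.

Lemma V_addA : associative (@V_add R A).
Proof.
move=> a b c; have [p ->] := Vcls_surj a; have [q ->] := Vcls_surj b.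
have [t ->] := Vcls_surj c.
have [r rP pqr] := padd_ex Aiso (proj2_sig p) (proj2_sig q).
have [z zP rtz] := padd_ex Aiso rP (proj2_sig t).
have [y [yP qty pyz]] := padd_assoc (proj2_sig p) (proj2_sig q) (proj2_sig t) pqr rtz.
rewrite (@V_addE p q (exist _ r rP) pqr) (@V_addE q t (exist _ y yP) qty).
by rewrite (@V_addE p (exist _ y yP) (exist _ z zP) pyz)
  (@V_addE (exist _ r rP) t (exist _ z zP) rtz).
Qed.

Lemma V_add0 : left_id (V_zero A) (@V_add R A).
Proof.
move=> a; have [p ->] := Vcls_surj a; rewrite V_zeroE V_addC.
by apply: V_addE; apply: padd0; case: p.
Qed.

Definition V_nz (a : V A) := a <> V_zero A.

Lemma Vcls_nz p : V_nz (Vcls p) <-> proj1_sig p != 0.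
Proof.
rewrite /V_nz V_zeroE Vcls_eq /=; split=> [h|/eqP h /mvn_eq0 //].
by apply/eqP => p0; apply: h; rewrite p0; exact: mvn_refl (is_proj0 A).
Qed.

Lemma V_zero_or_nz a : a = V_zero A \/ V_nz a.
Proof. exact: EM. Qed.

Lemma V_nzD a b : V_nz a -> V_nz (V_add a b).
Proof.
have [p ->] := Vcls_surj a; have [q ->] := Vcls_surj b.
have [r rP pqr] := padd_ex Aiso (proj2_sig p) (proj2_sig q).
rewrite (@V_addE p q (exist _ r rP)) // !Vcls_nz /=; apply: contra => /eqP r0.
have [v [w [vp wq vw vwr]]] := pqr.
have [rv _] := padd_supp (proj2_sig p) (proj2_sig q) vp wq vw vwr.
by rewrite -vp -rv r0 mul0r mulr0.
Qed.

Lemma V_nz1 : V_nz (V_unit A).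
Proof. by rewrite V_unitE Vcls_nz /= oner_neq0. Qed.

Lemma V_nz_sub (Aabs : proj_absorbing A) a b : V_nz a -> V_nz b ->
  exists2 c, V_nz c & V_add a c = b.
Proof.
have [p ->] := Vcls_surj a; have [q ->] := Vcls_surj b.
rewrite !Vcls_nz => p0 q0.
have [r [rP r0 prq]] := padd_sub (conj Aiso Aabs) (proj2_sig p) (proj2_sig q) p0 q0.
by exists (Vcls (exist _ r rP)); [rewrite Vcls_nz | apply: V_addE].
Qed.

End Vmonoid.

Section K0.
Variables (R : realType) (A : cstarType R).
Hypothesis Ainf : infinite_alg A.

Definition nz_proj (a : A) := is_proj a /\ a != 0.

Definition K0cls (p : prj A) : K0 A := gcls (@V_add R A) (V_zero A) (Vcls p).

Let VA := V_addA Ainf.1.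
Let VC := V_addC Ainf.1.
Let V0 := V_add0 Ainf.1.
Let Vz := @V_zero_or_nz R A.
Let VD := V_nzD Ainf.1.
Let VS := V_nz_sub Ainf.1 Ainf.2.
Let V1 := V_nz1 Ainf.1.

Lemma K0cls_surj (X : K0 A) : exists2 p, proj1_sig p != 0 & X = K0cls p.
Proof.
have [a na ->] := gcls_surj VA VC V0 Vz VD VS V1 X.
have [p pE] := Vcls_surj Ainf.1 a; exists p; last by rewrite pE.
by apply/(Vcls_nz Ainf.1); rewrite -pE.
Qed.

Implicit Types (p q r : prj A).

Lemma K0cls_eq p q : proj1_sig p != 0 -> proj1_sig q != 0 ->
  K0cls p = K0cls q <-> mvn (proj1_sig p) (proj1_sig q).
Proof.
move=> p0 q0; rewrite -(Vcls_eq Ainf.1).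
by apply: (gcls_inj VA VC V0 Vz VD VS V1); apply/(Vcls_nz Ainf.1).
Qed.

Lemma K0cls_add p q r : proj1_sig p != 0 -> proj1_sig q != 0 ->
  proj1_sig r != 0 ->
  og_add (K0cls p) (K0cls q) = K0cls r <->
  padd (proj1_sig p) (proj1_sig q) (proj1_sig r).
Proof.
move=> /(Vcls_nz Ainf.1) p0 /(Vcls_nz Ainf.1) q0 /(Vcls_nz Ainf.1) r0.
rewrite -(V_addP Ainf.1) -(gcls_inj VA VC V0 Vz VD VS V1) //; last exact: VD.
by rewrite -(gcls_add VA VC V0 Vz VD VS V1).
Qed.

Lemma K0cls_zero p : proj1_sig p != 0 ->
  og_zero (K0 A) = K0cls p <-> padd (proj1_sig p) (proj1_sig p) (proj1_sig p).
Proof.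
move=> /(Vcls_nz Ainf.1) p0; rewrite -(V_addP Ainf.1).
exact: (gcls_zero VA VC V0 Vz VD VS V1).
Qed.

Lemma K0cls_unit : og_unit (K0 A) = K0cls (prj1 A).
Proof. by rewrite /= V_unitE. Qed.

Lemma K0cls_opp p q : proj1_sig p != 0 -> proj1_sig q != 0 ->
  og_opp (K0cls p) = K0cls q <-> exists r, [/\ proj1_sig r != 0,
    padd (proj1_sig r) (proj1_sig r) (proj1_sig r) &
    padd (proj1_sig p) (proj1_sig q) (proj1_sig r)].
Proof.
move=> /(Vcls_nz Ainf.1) p0 /(Vcls_nz Ainf.1) q0.
rewrite /og_opp /= (gcls_opp VA VC V0 Vz VD VS V1) //; split.
  move=> [e []]; have [r ->] := Vcls_surj Ainf.1 e.
  by rewrite (Vcls_nz Ainf.1) !(V_addP Ainf.1) => *; exists r.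
move=> [r []]; rewrite -(Vcls_nz Ainf.1) -!(V_addP Ainf.1) => *.
by exists (Vcls r).
Qed.

Lemma K0_pos (X : K0 A) : og_pos X.
Proof. by have [p _ ->] := K0cls_surj X; exists (Vcls p). Qed.

End K0.
(** * Functoriality *)

Section Functoriality.
Variables (R : realType) (A B : cstarType R) (iota : {lrmorphism A -> B}).
Hypothesis iotaS : forall x, iota (star x) = star (iota x).
Hypothesis iotaN : forall x, cnorm (iota x) = cnorm x.

Lemma iota_eq0 x : (iota x == 0) = (x == 0).
Proof.
apply/eqP/eqP => [ix|->]; last exact: rmorph0.
by apply: cnorm_eq0; rewrite -iotaN ix cnorm0.
Qed.

Lemma iota_isometries (s : nat -> A) :
  (forall i j, star (s i) * s j = (i == j)%:R) ->
  forall i j, star (iota (s i)) * iota (s j) = (i == j)%:R.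
Proof. by move=> sP i j; rewrite -iotaS -rmorphM sP rmorph_nat. Qed.

Lemma iota_orth_isometries : orth_isometries A -> orth_isometries B.
Proof.
move=> [u [v [uu vv uv]]]; exists (iota u), (iota v).
by rewrite -!iotaS -!rmorphM uu vv uv rmorph1 rmorph0.
Qed.

Lemma iota_proj p : is_proj p -> is_proj (iota p).
Proof. by move=> [pS pI]; rewrite /is_proj -iotaS -rmorphM pS pI. Qed.

Lemma iota_mvn p q : mvn p q -> mvn (iota p) (iota q).
Proof.
by move=> [v [<- <-]]; exists (iota v); rewrite -iotaS -!rmorphM.
Qed.

Lemma iota_padd p q r : padd p q r -> padd (iota p) (iota q) (iota r).
Proof.
move=> [v [w [vp wq vw vwr]]]; exists (iota v), (iota w).
by rewrite -!iotaS -!rmorphM -rmorphD vp wq vw vwr rmorph0.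
Qed.

Lemma iota_clim (u : nat -> A) l : clim u l -> clim (iota \o u) (iota l).
Proof. by move=> ul; apply: clim_squeeze ul => n; rewrite -rmorphB iotaN. Qed.

Definition prj_map (p : prj A) : prj B :=
  exist _ (iota (proj1_sig p)) (iota_proj (proj2_sig p)).

Definition imx_map (x : imx A) : imx B := fun i j => iota (x i j).

Lemma imx_map_bounded x N : bounded x N -> bounded (imx_map x) N.
Proof. by move=> xN i j ij; rewrite /imx_map xN ?rmorph0. Qed.

Lemma imx_map_finite x : imx_finite x -> imx_finite (imx_map x).
Proof. by move=> [N xN]; exists N; exact: imx_map_bounded. Qed.

Lemma phi_map (s : nat -> A) x : imx_finite x ->
  phi (iota \o s) (imx_map x) = iota (phi s x).
Proof.
move=> [N xN]; rewrite (phiE s xN) (phiE _ (imx_map_bounded xN)).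
rewrite rmorph_sum; apply: eq_bigr => i _; rewrite rmorphM rmorph_sum /=.
by congr (_ * _); apply: eq_bigr => j _; rewrite rmorphM /= iotaS.
Qed.

Hypothesis Aiso : orth_isometries A.

(** The elements [iota (s i)] are again isometries with orthogonal ranges, and [phi] built from them
    intertwines entrywise [iota] with [iota]. Hence entrywise [iota] preserves norms of finite
    matrices and sends Cauchy sequences to Cauchy sequences. *)
Lemma projection_map (p : projection A) (a : prj A) : cls _ p = Vcls a ->
  exists2 q : projection B, stab_image iota p q & cls _ q = Vcls (prj_map a).
Proof.
have [s sP] := exists_isometries Aiso; have sP' := iota_isometries sP.
have Biso := iota_orth_isometries Aiso.
have [b bP pb] := projection_lim sP p.
rewrite (cls_Vcls Aiso a sP pb) => ba.
have pf := stab_finite p; have mf k := imx_map_finite (pf k).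
have phim k : phi (iota \o s) (imx_map (p k)) = iota (phi s (p k)) by exact: phi_map.
have cau (eps : R) : 0 < eps -> exists N : nat, forall k l, (N <= k)%N ->
  (N <= l)%N ->
    imx_norm (imx_sub (imx_map (p k)) (imx_map (p l))) < eps.
  move=> e0; have [N NP] := stab_cauchy p e0; exists N => k l Nk Nl.
  rewrite (imx_normE sP') ?(phiB sP') ?phim //; last exact: finiteB.
  rewrite -rmorphB iotaN -(phiB sP) // -(imx_normE sP); last exact: finiteB.
  exact: NP.
pose P := Stab mf cau.
have Pl : clim (phi (iota \o s) \o P) (iota b).
  by apply: clim_ext (iota_clim pb) => k; rewrite /comp /= -phim.
have [bS bI] := iota_proj bP.
have PS : stab_eq (seq_star P) P.
  have PSf k : imx_finite (seq_star P k) by exact: (finiteS (mf k)).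
  by rewrite (stab_eqP sP' PSf mf (clim_seq_star sP' mf Pl) Pl).
have PI : stab_eq (seq_mul P P) P.
  have PIf k : imx_finite (seq_mul P P k) by exact: (finiteM (mf k) (mf k)).
  by rewrite (stab_eqP sP' PIf mf (clim_seq_mul sP' mf mf Pl Pl) Pl).
have [Q pQ Ql] : exists2 Q : projection B, stab_image iota p Q
    & clim (phi (iota \o s) \o Q) (iota b) by exists (Projection PS PI).
exists Q => //; rewrite (cls_Vcls Biso (prj_map a) sP' Ql).
exact: iota_mvn.
Qed.

Hypothesis Aabs : proj_absorbing A.
Hypothesis Babs : proj_absorbing B.

Let Ainf : infinite_alg A := conj Aiso Aabs.
Let Binf : infinite_alg B := conj (iota_orth_isometries Aiso) Babs.

Lemma K0_map_ex : exists f : K0 A -> K0 B,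
  forall p : prj A, proj1_sig p != 0 -> f (K0cls p) = K0cls (prj_map p).
Proof.
pose f (X : K0 A) : K0 B :=
  K0cls (prj_map (projT1 (cid2 (K0cls_surj Ainf X)))).
exists f => p p0; rewrite /f; case: cid2 => q q0 /= /(K0cls_eq Ainf p0 q0) pq.
apply/(K0cls_eq Binf); rewrite ?iota_eq0 //.
by apply: mvn_sym; exact: iota_mvn.
Qed.

(** If the nonzero [r] represents the difference of [a] and [b], then [a + t = (r + b) + t] in
    [V(A)] for some [t]. As [iota] preserves [padd], it carries over each addition in this
    equation. *)
Lemma K0_map_induced (f : K0 A -> K0 B) :
  (forall p : prj A, proj1_sig p != 0 -> f (K0cls p) = K0cls (prj_map p)) ->
  K0_induced iota f.
Proof.
move=> fP p q; have Biso := Binf.1.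
have [a pa] := Vcls_surj Aiso (cls _ p); have [b qb] := Vcls_surj Aiso (cls _ q).
have [p' pp' p'a] := projection_map pa; have [q' qq' q'b] := projection_map qb.
exists p', q'; split=> //; rewrite pa qb p'a q'b.
have [r r0 rE] := K0cls_surj Ainf (cls _ (Vcls a, Vcls b)).
rewrite rE (fP r r0); apply/esym.
move/(groth_cls (V_addA Aiso) (V_addC Aiso) (V_add0 Aiso) (@V_zero_or_nz R A)
  (V_nzD Aiso) (V_nz_sub Aiso Aabs) (V_nz1 Aiso)): rE => [z /=].
have [t ->] := Vcls_surj Aiso z.
rewrite [V_add _ (V_zero A)](V_addC Aiso) (V_add0 Aiso) => abr.
apply/(groth_cls (V_addA Biso) (V_addC Biso) (V_add0 Biso) (@V_zero_or_nz R B)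
  (V_nzD Biso) (V_nz_sub Biso Babs) (V_nz1 Biso)).
exists (Vcls (prj_map t)) => /=.
rewrite [V_add _ (V_zero B)](V_addC Biso) (V_add0 Biso).
have mapD c d e : V_add (Vcls c) (Vcls d) = Vcls e ->
    V_add (Vcls (prj_map c)) (Vcls (prj_map d)) = Vcls (prj_map e).
  by move=> /(V_addP Aiso) cde; apply/(V_addP Biso); exact: iota_padd.
have [c1 at_] := Vcls_surj Aiso (V_add (Vcls a) (Vcls t)).
have [c2 rb] := Vcls_surj Aiso (V_add (Vcls r) (Vcls b)).
rewrite at_ rb in abr.
by rewrite (mapD _ _ _ at_) (mapD _ _ _ rb) (mapD _ _ _ (esym abr)).
Qed.

End Functoriality.
(** * Uniform continuity of formulas *)

Section Box.
Variables (R : realType) (n : nat) (u : 'rV[R]_n -> R).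
Hypothesis uc : continuous u.

Let box (N : R) := [set x : 'rV[R]_n | forall j, `|x ord0 j| <= N].

Lemma box_compact N : compact (box N).
Proof.
rewrite (_ : box N = [set v | forall i, `[(- N), N]%classic (v ord0 i)]).
  apply: (@rV_compact _ _ (fun=> `[(- N), N]%classic)) => i.
  exact: segment_compact.
by apply/seteqP; split=> x /= xN j; have := xN j; rewrite in_itv /= ler_norml.
Qed.

(** Only [x] is confined to the compact box, while [y] is any nearby point; the covering form of
    compactness provides one radius for all [x]. *)
Lemma box_unif (N eps : R) : 0 < eps -> exists2 d, 0 < d &
  forall x y : 'rV[R]_n, box N x -> (forall j, `|x ord0 j - y ord0 j| < d) ->
    `|u x - u y| <= eps.
Proof.
move=> e0; have e2 : 0 < eps / 2 by lra.
have /compact_near_coveringP/(_ _ (0^'+)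
  (fun d x => forall y : 'rV[R]_n, (forall j, `|x ord0 j - y ord0 j| < d) ->
     `|u x - u y| <= eps) _) := @box_compact N.
case=> [x _|d /= d0 dP].
  have /cvgrPdist_lt/(_ _ e2)/nbhs_ballP[r /= r0 rP] := uc (x := x).
  exists (ball x (r / 2), [set d | d < r / 2]) => [|[x' d] [/= xx' dr] y xy] /=.
    split; first by apply: nbhsx_ballx; lra.
    by apply: nbhs_right_lt; lra.
  have ux' := rP x' (le_ball (_ : r / 2 <= r) xx').
  have uy : `|u x - u y| < eps / 2.
    apply: rP; split=> // i j; rewrite (_ : r = r / 2 + r / 2); last by lra.
    have [_ /(_ i j) xx'i] := xx'.
    apply: ball_triangle xx'i _; rewrite /ball /= ord1.
    exact: lt_trans (xy j) dr.
  rewrite (_ : u x' - u y = - (u x - u x') + (u x - u y)); last by ring.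
  rewrite (le_trans (ler_normD _ _)) // normrN.
  by have := ux' _; lra.
exists (d / 2); first by lra.
move=> x y xN xy; apply: (dP (d / 2)) => //=; last by lra.
rewrite sub0r normrN gtr0_norm; lra.
Qed.

Lemma box_bounded (N : R) : exists C, forall x, box N x -> `|u x| <= C.
Proof.
have /compact_near_coveringP/(_ _ (pinfty_nbhs R)
  (fun C x => `|u x| <= C) _) := @box_compact N.
case=> [x _|C [_ CP]].
  have /cvgrPdist_lt/(_ _ ltr01) := uc (x := x) => h.
  exists ([set x' | `|u x - u x'| < 1], [set C | `|u x| + 1 < C]).
    by split=> //=; apply: nbhs_pinfty_gt; exact: num_real.
  move=> [x' C] [/= xx' uxC].
  have := ler_normD (u x) (u x' - u x); rewrite addrC subrK distrC; lra.
by exists (C + 1) => x xN; apply: (CP (C + 1)) => //; lra.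
Qed.

End Box.

(** * Suprema and infima over a set *)

Section SupInf.
Variables (R : realType) (T : Type) (X : set T).
Hypothesis X0 : exists x, X x.
Implicit Types f g : T -> R.

Definition sup_on f := sup [set r | exists2 x, X x & r = f x].
Definition inf_on f := inf [set r | exists2 x, X x & r = f x].

Lemma inf_onE f : inf_on f = - sup_on (fun x => - f x).
Proof.
rewrite /inf_on /inf /sup_on; congr (- sup _); apply/seteqP; split.
  by move=> _ [_ [x Xx ->] <-]; exists x.
by move=> _ [x Xx ->]; exists (f x) => //; exists x.
Qed.

Variable N : R.

Lemma sup_on_ge f x : (forall y, X y -> f y <= N) -> X x -> f x <= sup_on f.
Proof.
move=> fN Xx; apply: ub_le_sup; last by exists x.
by exists N => _ [y Xy ->]; exact: fN.
Qed.

Lemma sup_on_le f (c : R) : (forall x, X x -> f x <= c) -> sup_on f <= c.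
Proof.
move=> fc; apply: ge_sup; last by move=> _ [x Xx ->]; exact: fc.
by have [x Xx] := X0; exists (f x), x.
Qed.

Lemma sup_on_bounded f : (forall x, X x -> `|f x| <= N) -> `|sup_on f| <= N.
Proof.
move=> fN; have fN' x : X x -> - N <= f x <= N by move=> /fN; rewrite ler_norml.
have [x Xx] := X0; rewrite ler_norml; apply/andP; split.
  apply: le_trans (sup_on_ge _ Xx); first by case/andP: (fN' x Xx).
  by move=> y /fN'/andP[].
by apply: sup_on_le => y /fN'/andP[].
Qed.

Lemma sup_on_close f g (eps : R) : (forall x, X x -> f x <= N) ->
  (forall x, X x -> g x <= N) -> (forall x, X x -> `|f x - g x| <= eps) ->
  `|sup_on f - sup_on g| <= eps.
Proof.
move=> fN gN fg.
have le f' g' : (forall x, X x -> g' x <= N) ->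
    (forall x, X x -> `|f' x - g' x| <= eps) -> sup_on f' <= sup_on g' + eps.
  move=> gN' fg'; apply: sup_on_le => x Xx.
  have := sup_on_ge gN' Xx; have := fg' x Xx; rewrite ler_norml; lra.
have h1 := le f g gN fg.
have h2 : sup_on g <= sup_on f + eps by apply: le => // x /fg; rewrite distrC.
by rewrite ler_norml; lra.
Qed.

Lemma sup_on_eq f g : (forall x, X x -> f x = g x) -> sup_on f = sup_on g.
Proof.
move=> fg; congr sup; apply/seteqP; split=> _ [x Xx ->]; exists x => //.
  exact: fg.
by rewrite fg.
Qed.

End SupInf.

Lemma sup_setT (R : realType) (T : Type) (f : T -> R) :
  sup [set r | exists x, r = f x] = sup_on setT f.
Proof.
congr sup; apply/seteqP; split=> r; first by move=> [x ->]; exists x.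
by move=> [x _ ->]; exists x.
Qed.

Lemma inf_setT (R : realType) (T : Type) (f : T -> R) :
  inf [set r | exists x, r = f x] = inf_on setT f.
Proof.
congr inf; apply/seteqP; split=> r; first by move=> [x ->]; exists x.
by move=> [x _ ->]; exists x.
Qed.

(** * Continuous connectives *)

Section Connectives.
Variables (R : realType) (K : Type) (L : mstruct R K) (G : seq (srt L)).

Lemma formula_conn1 (u : R -> R) (phi : formula G) : continuous u ->
  exists psi : formula G, forall M e, feval (M := M) psi e = u (feval phi e).
Proof.
move=> uc; have uc' : continuous (fun r : 'rV[R]_1 => u (r ord0 ord0)).
  by move=> r; apply: continuous_comp; [exact: coord_continuous | exact: uc].
by exists (FConn uc' (fun=> phi)) => M e /=; rewrite mxE.
Qed.

Lemma formula_conn2 (u : R * R -> R) (phi psi : formula G) : continuous u ->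
  exists chi : formula G, forall M e,
    feval (M := M) chi e = u (feval phi e, feval psi e).
Proof.
move=> uc.
have uc' : continuous (fun r : 'rV[R]_2 => u (r ord0 ord0, r ord0 (inord 1))).
  move=> r; apply: (continuous_comp (f := fun r : 'rV[R]_2 => (r ord0 ord0,
    r ord0 (inord 1)))).
    exact: (cvg_pair (@coord_continuous R 1 2 ord0 ord0 r)
      (@coord_continuous R 1 2 ord0 (inord 1) r)).
  exact: uc.
exists (FConn uc' (fun j => if j == ord0 then phi else psi)) => M e /=.
rewrite !mxE eqxx (_ : (inord 1 == ord0) = false) //.
by apply/eqP => /(congr1 (@nat_of_ord _)); rewrite inordK.
Qed.

Lemma formula_add (phi psi : formula G) : exists chi : formula G, forall M e,
  feval (M := M) chi e = feval phi e + feval psi e.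
Proof.
by apply: (formula_conn2 (u := fun p => p.1 + p.2)); exact: add_continuous.
Qed.

Lemma formula_scale (c : R) (phi : formula G) : exists chi : formula G,
  forall M e, feval (M := M) chi e = c * feval phi e.
Proof. by apply: (formula_conn1 (u := fun r => c * r)); exact: mulrl_continuous. Qed.

Lemma formula_const (c : R) : exists chi : formula G,
  forall M e, feval (M := M) chi e = c.
Proof.
have uc : continuous (fun _ : 'rV[R]_0 => c) by exact: cst_continuous.
by exists (FConn uc (fun i : 'I_0 => match i with Ordinal _ h =>
  False_rect _ (notF h) end)).
Qed.

Definition clamp (r : R) : R := Num.min 1 (Num.max 0 r).

Lemma clamp_continuous : continuous clamp.
Proof.
apply: (@min_fun_continuous _ R R (fun=> 1) (fun r => Num.max 0 r)).
  exact: cst_continuous.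
apply: (@max_fun_continuous _ R R (fun=> 0) id); first exact: cst_continuous.
by move=> r; exact: cvg_id.
Qed.

Lemma formula_clamp (a b : R) (phi : formula G) : exists chi : formula G,
  forall M e, feval (M := M) chi e = clamp (a * feval phi e + b).
Proof.
have [phi1 h1] := formula_scale a phi; have [phi2 h2] := formula_const b.
have [phi3 h3] := formula_add phi1 phi2.
have [chi h] := formula_conn1 phi3 clamp_continuous.
by exists chi => M e; rewrite h h3 h1 h2.
Qed.

End Connectives.

(* Moduli of continuity for terms and formulas of C*-algebras *)
Scheme term_mut := Induction for term Sort Prop
  with terms_mut := Induction for terms Sort Prop.

Section UniformContinuity.
Variables (R : realType) (K : Type) (alg : K -> cstarType R).

Let L := cstar_struct alg.

Notation cdist := (@dst R K L).

Lemma cdistE (M : K) (n : nat) (x y : cball (alg M) n) :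
  dst (m := L) (M := M) (s := n) x y = cnorm (proj1_sig x - proj1_sig y).
Proof. by []. Qed.

Lemma cdist_ge0 (M : K) s (x y : car (m := L) M s) : 0 <= dst x y.
Proof. exact: cnorm_ge0. Qed.

Lemma env_dist_xx (M : K) (G : seq (srt L)) (e : env (car (m := L) M) G) :
  env_dist (@dst R K L M) e e = 0.
Proof.
elim: G e => [|s G IH] //= e; apply/eqP.
by rewrite [env_dist _ _ _]IH subrr cnorm0 maxxx.
Qed.

Lemma lookup_dist (M : K) (G : seq (srt L)) s (v : var G s)
    (e e' : env (car (m := L) M) G) :
  dst (lookup v e) (lookup v e') <= env_dist (@dst R K L M) e e'.
Proof.
elim: v e e' => [{}s {}G|t {}s {}G v IH] e e' /=; rewrite le_max ?lexx //.
by apply/orP; right; exact: IH.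
Qed.

Lemma app_unif (f : fn L) (eps : R) : 0 < eps -> exists2 d, 0 < d &
  forall (M : K) (e e' : env (car (m := L) M) (dom f)),
    env_dist (@dst R K L M) e e' < d -> dst (app e) (app e') < eps.
Proof.
move=> e0; case: f => [m n|m n|n|c m n h|||m n h].
- exists (eps / 2); first by lra.
  move=> M [x [y []]] [x' [y' []]] /=; rewrite !gt_max => /and3P[xx' yy' _].
  rewrite opprD addrACA (le_lt_trans (cnormD _ _)) //.
  by move: xx' yy'; rewrite -!cdistE; lra.
(* The summand [1] keeps the denominator positive when both balls have radius [0]. *)
- have mn0 : 0 < (m%:R + n%:R + 1 : R) by rewrite ltr_wpDl // addr_ge0.
  exists (eps / (m%:R + n%:R + 1)); first exact: divr_gt0.
  move=> M [x [y []]] [x' [y' []]] /=; rewrite !gt_max => /and3P[xx' yy' _].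
  rewrite (_ : _ - _ = (proj1_sig x - proj1_sig x') * proj1_sig y
    + proj1_sig x' * (proj1_sig y - proj1_sig y')); last by ncring.
  have h1 : cnorm ((proj1_sig x - proj1_sig x') * proj1_sig y) <=
      eps / (m%:R + n%:R + 1) * n%:R.
    by apply: cnormM_le; [exact: ltW | case: (y)].
  have h2 : cnorm (proj1_sig x' * (proj1_sig y - proj1_sig y')) <=
      m%:R * (eps / (m%:R + n%:R + 1)).
    by apply: cnormM_le; [case: (x') | exact: ltW].
  apply: (le_lt_trans (cnormD _ _)); apply: (le_lt_trans (lerD h1 h2)).
  rewrite mulrC -mulrDl -mulrC mulrAC ltr_pdivrMr // ltr_pM2l //.
  by rewrite (addrC n%:R); lra.
- exists eps => // M [x []] [x' []] /=; rewrite gt_max => /andP[xx' _].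
  by rewrite -starB cnorm_star.
- have c0 : 0 < complex.Re `|c| + 1.
    by have := normr_ge0 c; rewrite lecE => /andP[_ /=]; lra.
  exists (eps / (complex.Re `|c| + 1)); first exact: divr_gt0.
  move=> M [x []] [x' []] /=; rewrite gt_max => /andP[xx' _].
  rewrite -scalerBr cnormZ (@le_lt_trans _ _ ((complex.Re `|c| + 1) *
    cnorm (proj1_sig x - proj1_sig x'))) //.
    by rewrite ler_wpM2r ?cnorm_ge0 //; lra.
  by rewrite mulrC -ltr_pdivlMr.
- by exists 1 => // M e e' _ /=; rewrite subrr cnorm0.
- by exists 1 => // M e e' _ /=; rewrite subrr cnorm0.
- by exists eps => // M [x []] [x' []] /=; rewrite gt_max => /andP[xx' _].
Qed.

Lemma term_unif (G : seq (srt L)) s (t : term G s) (eps : R) : 0 < eps ->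
  exists2 d, 0 < d & forall (M : K) (e e' : env (car (m := L) M) G),
    env_dist (@dst R K L M) e e' < d -> dst (teval e t) (teval e' t) < eps.
Proof.
pose P s (t : term G s) := forall eps : R, 0 < eps ->
  exists2 d, 0 < d & forall (M : K) (e e' : env (car (m := L) M) G),
    env_dist (@dst R K L M) e e' < d -> dst (teval e t) (teval e' t) < eps.
pose Q D (ts : terms G D) := forall eps : R, 0 < eps ->
  exists2 d, 0 < d & forall (M : K) (e e' : env (car (m := L) M) G),
    env_dist (@dst R K L M) e e' < d ->
    env_dist (@dst R K L M) (tseval e ts) (tseval e' ts) < eps.
move: eps; apply: (@term_mut R K L G P Q _ _ _ _ s t) =>
  {s t} [s v|f ts IH||s D t IHt ts IHts] eps e0 /=.
- exists eps => // M e e' ee'.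
  exact: le_lt_trans (lookup_dist v e e') ee'.
- have [d d0 fd] := app_unif f e0; have [d' d'0 td] := IH d d0.
  by exists d' => // M e e' /td; exact: fd.
- by exists 1.
- have [d d0 td] := IHt eps e0; have [d' d'0 td'] := IHts eps e0.
  exists (Num.min d d'); first by rewrite lt_min d0.
  by move=> M e e'; rewrite lt_min gt_max => /andP[/td -> /td' ->].
Qed.

Lemma cdist_bounded (M : K) (n : nat) (x y : car (m := L) M n) :
  dst x y <= n%:R + n%:R.
Proof.
rewrite /= (le_trans (cnormB _ _)) // lerD //; first by case: x.
by case: y.
Qed.

Lemma cball_inhabited (M : K) (n : srt L) : exists x : car (m := L) M n, setT x.
Proof. by exists (exist _ 0 (eq_ind_r (fun r => r <= n%:R) (ler0n R n)
  (cnorm0 _))). Qed.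

(** Boundedness has to be part of the induction: a connective is merely continuous, hence uniformly
    continuous only on boxes, and [sup] and [inf] have default values on unbounded sets. *)
Lemma formula_unif (G : seq (srt L)) (phi : formula G) :
  (exists N, forall (M : K) (e : env (car (m := L) M) G), `|feval phi e| <= N) /\
  forall eps : R, 0 < eps -> exists2 d, 0 < d &
    forall (M : K) (e e' : env (car (m := L) M) G),
    env_dist (@dst R K L M) e e' < d -> `|feval phi e - feval phi e'| <= eps.
Proof.
elim: phi => {G} [G s t1 t2|G n u uc phis IH|G s phi [[N phiN] IH]|G s phi [[N
  phiN] IH]].
- split; first by exists (s%:R + s%:R) => M e;
  rewrite ger0_norm ?cdist_bounded ?cdist_ge0.
  move=> eps e0; have e2 : 0 < eps / 2 by lra.
  have [d d0 h1] := term_unif t1 e2; have [d' d'0 h2] := term_unif t2 e2.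
  exists (Num.min d d'); first by rewrite lt_min d0.
  move=> M e e'; rewrite lt_min => /andP[/h1 + /h2]; rewrite /=.
  set a := proj1_sig _; set b := proj1_sig _; set c := proj1_sig _; set k :=
    proj1_sig _.
  move=> ab ck; rewrite (le_trans (cnorm_lerB _ _)) //.
  rewrite (_ : a - c - (b - k) = (a - b) - (c - k)); last by ncring.
  by rewrite (le_trans (cnormB _ _)) //; lra.
- have [N phiN] : exists N, forall j (M : K) (e : env (car (m := L) M) G),
      `|feval (phis j) e| <= N.
    pose N j := projT1 (cid (IH j).1).
    exists (\sum_j `|N j|) => j M e.
    rewrite (le_trans (projT2 (cid (IH j).1) M e)) // (le_trans (ler_norm _)) //.
    by rewrite (bigD1 j) //= lerDl sumr_ge0.
  split.
    have [C CP] := box_bounded uc N; exists C => M e /=; apply: CP => j.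
    by rewrite mxE.
  move=> eps e0; have [d d0 dP] := box_unif uc N e0.
  have d20 : 0 < d / 2 by lra.
  have [d' d'0 d'P] : exists2 d', 0 < d' & forall j (M : K) (e e' :
    env (car (m := L) M) G),
      env_dist (@dst R K L M) e e' < d' ->
      `|feval (phis j) e - feval (phis j) e'| <= d / 2.
    pose D j := projT1 (cid2 ((IH j).2 _ d20)).
    have D0 j : 0 < D j by rewrite /D; case: cid2.
    exists (\big[Num.min/1]_j D j).
      by elim/big_ind: _ => // x y x0 y0; rewrite lt_min x0.
    move=> j M e e' ee'; have : env_dist (@dst R K L M) e e' < D j.
      by rewrite (lt_le_trans ee') // bigmin_le_cond.
    by rewrite /D; case: cid2 => /= r _; apply.
  exists d' => // M e e' ee' /=; apply: dP => j; first by rewrite mxE.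
  by rewrite !mxE (le_lt_trans (d'P j M e e' ee')) //; lra.
- split.
    exists N => M e /=; rewrite sup_setT; apply: sup_on_bounded => //.
    exact: cball_inhabited.
  move=> eps e0; have [d d0 dP] := IH eps e0; exists d => // M e e' ee' /=.
  rewrite !sup_setT; apply: (@sup_on_close R _ setT (cball_inhabited M s) N) => x _.
  - exact: le_trans (ler_norm _) (phiN _ _).
  - exact: le_trans (ler_norm _) (phiN _ _).
  by apply: dP; rewrite /= subrr cnorm0 gt_max d0.
- split.
    exists N => M e /=; rewrite inf_setT inf_onE normrN; apply: sup_on_bounded.
      exact: cball_inhabited.
    by move=> x _; rewrite normrN.
  move=> eps e0; have [d d0 dP] := IH eps e0; exists d => // M e e' ee' /=.
  rewrite !inf_setT !inf_onE -opprD normrN.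
  have := @sup_on_close R _ setT (cball_inhabited M s) N (fun x =>
    - feval phi ((x, e) : env _ (s :: G)))
    (fun x => - feval phi ((x, e') : env _ (s :: G))) eps.
  apply=> x _.
  - by rewrite (le_trans (ler_norm _)) // normrN phiN.
  - by rewrite (le_trans (ler_norm _)) // normrN phiN.
  rewrite -opprD normrN.
  by apply: dP; rewrite /= subrr cnorm0 gt_max d0.
Qed.

End UniformContinuity.
(** * Formulas for equivalence and addition of projections *)

Section Discrete.
Variable R : realType.

Lemma discrete_val1 (Q : Prop) : Q -> discrete_val R Q = 0.
Proof. by move=> q; rewrite /discrete_val asboolT. Qed.

Lemma discrete_val0 (Q : Prop) : ~ Q -> discrete_val R Q = 1.
Proof. by move=> q; rewrite /discrete_val asboolF. Qed.

Lemma discrete_val_iff (Q Q' : Prop) : (Q <-> Q') ->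
  discrete_val R Q = discrete_val R Q'.
Proof. by move=> /propext ->. Qed.

Lemma discrete_val_inj (Q Q' : Prop) :
  discrete_val R Q = discrete_val R Q' -> (Q <-> Q').
Proof.
have [q|q] := EM Q; have [q'|q'] := EM Q' => //; rewrite /discrete_val.
- by rewrite asboolT // asboolF //= => /eqP; rewrite eq_sym oner_eq0.
- by rewrite asboolF // asboolT //= => /eqP; rewrite oner_eq0.
Qed.

Lemma discrete_val_eq0 (Q : Prop) : discrete_val R Q = 0 <-> Q.
Proof.
split=> [q0|]; last exact: discrete_val1.
by apply: contrapT => /discrete_val0; rewrite q0 => /eqP; rewrite eq_sym oner_eq0.
Qed.

Lemma discrete_val_ge0 (Q : Prop) : 0 <= discrete_val R Q.
Proof. exact: ler0n. Qed.

Lemma clamp0 : clamp (0 : R) = 0.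
Proof. by rewrite /clamp maxxx min_r. Qed.

Lemma clamp1 (r : R) : 1 <= r -> clamp r = 1.
Proof. by move=> r1; rewrite /clamp max_r ?min_l // (le_trans _ r1). Qed.

(** A quantity that is either [0] or at least [c] becomes zero-one valued after scaling by [c^-1]
    and truncating to [[0, 1]]. The summand [0] matches the shape of [formula_clamp]. *)
Lemma clamp_gap (Q : Prop) (c r : R) : 0 < c -> (Q -> r = 0) -> (~ Q -> c <= r) ->
  clamp (c^-1 * r + 0) = discrete_val R Q.
Proof.
move=> c0 Qr nQr; rewrite addr0; have [q|q] := EM Q.
  by rewrite Qr // mulr0 clamp0 discrete_val1.
by rewrite clamp1 ?discrete_val0 // mulrC ler_pdivlMr // mul1r nQr.
Qed.

Lemma inf_on_eq0 (T : Type) (X : set T) (f : T -> R) x :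
  (forall y, X y -> 0 <= f y) -> X x -> f x = 0 -> inf_on X f = 0.
Proof.
move=> f0 Xx fx; have X0 : exists x, X x by exists x.
rewrite inf_onE; apply/eqP; rewrite oppr_eq0 eq_le; apply/andP; split.
  by apply: sup_on_le => // y /f0; rewrite oppr_le0.
have := @sup_on_ge R T X 0 (fun x => - f x) x; rewrite fx oppr0; apply=> //.
by move=> y /f0; rewrite oppr_le0.
Qed.

Lemma inf_on_ge (T : Type) (X : set T) (f : T -> R) (c : R) : (exists x, X x) ->
  (forall y, X y -> c <= f y) -> c <= inf_on X f.
Proof.
move=> X0 cf; rewrite inf_onE lerNr; apply: sup_on_le => // y /cf.
by rewrite lerN2.
Qed.

(** With [0] for true, the infimum of a zero-one valued function on a nonempty set is an existential
    quantifier. *)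
Lemma inf_on_discrete (T : Type) (X : set T) (f : T -> R) (Q : T -> Prop) :
  (exists x, X x) -> (forall x, X x -> f x = discrete_val R (Q x)) ->
  inf_on X f = discrete_val R (exists2 x, X x & Q x).
Proof.
move=> X0 fQ; have [[x Xx Qx]|nQ] := EM (exists2 x, X x & Q x).
  rewrite discrete_val1; last by exists x.
  apply: (inf_on_eq0 (x := x)) => //; last by rewrite fQ // discrete_val1.
  by move=> y /fQ ->; exact: discrete_val_ge0.
have f1 x : X x -> f x = 1.
  by move=> Xx; rewrite fQ // discrete_val0 // => Qx; apply: nQ; exists x.
rewrite discrete_val0 //; apply/eqP; rewrite eq_le; apply/andP; split.
  have [x Xx] := X0; rewrite inf_onE lerNl -(f1 x Xx).
  apply: (@sup_on_ge _ _ _ 0 (fun x => - f x)) => // y /f1 ->.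
  by rewrite oppr_le0.
by apply: inf_on_ge => // y /f1 ->.
Qed.

End Discrete.

Lemma term_weaken (R : realType) (K : Type) (L : mstruct R K) (G : seq (srt L))
    (s' s : srt L) (t : term G s) :
  exists t' : term (s' :: G) s, forall (M : K) (a : car M s') (e : env (car M) G),
    teval ((a, e) : env (car M) (s' :: G)) t' = teval e t.
Proof.
pose P s (t : term G s) := exists t' : term (s' :: G) s,
  forall (M : K) (a : car M s') (e : env (car M) G),
    teval ((a, e) : env (car M) (s' :: G)) t' = teval e t.
pose Q D (ts : terms G D) := exists ts' : terms (s' :: G) D,
  forall (M : K) (a : car M s') (e : env (car M) G),
    tseval ((a, e) : env (car M) (s' :: G)) ts' = tseval e ts.
apply: (@term_mut R K L G P Q _ _ _ _ s t) => {s t}.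
- by move=> s v; exists (TVar (VS s' v)).
- by move=> f ts [ts' tsE]; exists (TApp (f := f) ts') => M a e /=; rewrite tsE.
- by exists (TNil _).
- move=> s D t [t' tE] ts [ts' tsE]; exists (TCons t' ts') => M a e /=.
  by rewrite tE tsE.
Qed.

(* A copy of the language of C*-algebras inside a structure, stated through
   the terms that it provides. *)
Record cterms (R : realType) (K : Type) (alg : K -> cstarType R)
    (L : mstruct R K) := CTerms {
  ct_s : nat -> srt L;
  ct_val : forall M n, car M (ct_s n) -> alg M;
  ct_norm : forall M n (x : car M (ct_s n)), cnorm (ct_val x) <= n%:R;
  ct_surj : forall M n (a : alg M), cnorm a <= n%:R ->
    exists x : car M (ct_s n), ct_val x = a;
  ct_dst : forall M n (x y : car M (ct_s n)), dst x y = cnorm (ct_val x - ct_val y);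
  ct_star : forall G n (t : term G (ct_s n)), exists t' : term G (ct_s n),
    forall M (e : env (car M) G), ct_val (teval e t') = star (ct_val (teval e t));
  ct_mul : forall G m n (t : term G (ct_s m)) (u : term G (ct_s n)),
    exists t' : term G (ct_s (m * n)), forall M (e : env (car M) G),
      ct_val (teval e t') = ct_val (teval e t) * ct_val (teval e u);
  ct_add : forall G m n (t : term G (ct_s m)) (u : term G (ct_s n)),
    exists t' : term G (ct_s (m + n)), forall M (e : env (car M) G),
      ct_val (teval e t') = ct_val (teval e t) + ct_val (teval e u);
  ct_incl : forall G m n (t : term G (ct_s m)), (m <= n)%N ->
    exists t' : term G (ct_s n), forall M (e : env (car M) G),
      ct_val (teval e t') = ct_val (teval e t);
  ct_zero : forall G, exists t' : term G (ct_s 0), forall M (e : env (car M) G),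
    ct_val (teval e t') = 0;
  ct_one : forall G, exists t' : term G (ct_s 1), forall M (e : env (car M) G),
    ct_val (teval e t') = 1
}.

(** * The language of C*-algebras inside the first stages of imaginaries *)

Section Instances.
Variables (R : realType) (K : Type) (alg : K -> cstarType R).

Let L0 := cstar_struct alg.
Let L1 := eq_step L0.
Let L2 := eq_step L1.

Lemma cball_surj (M : K) n (a : alg M) : cnorm a <= n%:R ->
  exists x : cball (alg M) n, proj1_sig x = a.
Proof. by move=> an; exists (exist _ a an). Qed.

Definition cterms0 : cterms alg L0.
Proof.
refine (@CTerms R K alg L0 id (fun M n x => proj1_sig x) _ _ _ _ _ _ _ _ _).
- by move=> M n x; case: x.
- by move=> M n a; exact: cball_surj.
- by [].
- by move=> G n t; exists (TApp (L := L0) (f := StarF R n) (TCons t (TNil G))).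
- move=> G m n t u.
  by exists (TApp (L := L0) (f := MulF R m n) (TCons t (TCons u (TNil G)))).
- move=> G m n t u.
  by exists (TApp (L := L0) (f := AddF R m n) (TCons t (TCons u (TNil G)))).
- by move=> G m n t h; exists (TApp (L := L0) (f := InclF R h) (TCons t (TNil G))).
- by move=> G; exists (TApp (L := L0) (f := ZeroF R) (TNil G)).
- by move=> G; exists (TApp (L := L0) (f := OneF R) (TNil G)).
Defined.

Definition cterms1 : cterms alg L1.
Proof.
pose s n : srt L1 := OldS (n : srt L0).
refine (@CTerms R K alg L1 s (fun M n x => proj1_sig x) _ _ _ _ _ _ _ _ _).
- by move=> M n x; case: x.
- by move=> M n a; exact: cball_surj.
- by [].
- move=> G n t.
  by exists (TApp (L := L1) (f := OldF (StarF R n : fn L0)) (TCons (t :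
    term G (OldS _)) (TNil G))).
- move=> G m n t u.
  by exists (TApp (L := L1) (f := OldF (MulF R m n : fn L0)) (TCons (t :
    term G (OldS _)) (TCons (u : term G (OldS _)) (TNil G)))).
- move=> G m n t u.
  by exists (TApp (L := L1) (f := OldF (AddF R m n : fn L0)) (TCons (t :
    term G (OldS _)) (TCons (u : term G (OldS _)) (TNil G)))).
- move=> G m n t h.
  by exists (TApp (L := L1) (f := OldF (InclF R h : fn L0)) (TCons (t :
    term G (OldS _)) (TNil G))).
- by move=> G; exists (TApp (L := L1) (f := OldF (ZeroF R : fn L0)) (TNil G)).
- by move=> G; exists (TApp (L := L1) (f := OldF (OneF R : fn L0)) (TNil G)).
Defined.

Definition cterms2 : cterms alg L2.
Proof.
pose s n : srt L2 := OldS (OldS (n : srt L0) : srt L1).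
refine (@CTerms R K alg L2 s (fun M n x => proj1_sig x) _ _ _ _ _ _ _ _ _).
- by move=> M n x; case: x.
- by move=> M n a; exact: cball_surj.
- by [].
- move=> G n t.
  by exists (TApp (L := L2) (f := OldF (OldF (StarF R n : fn L0) : fn L1))
    (TCons (t : term G (OldS _)) (TNil G))).
- move=> G m n t u.
  by exists (TApp (L := L2) (f := OldF (OldF (MulF R m n : fn L0) : fn L1))
    (TCons (t : term G (OldS _)) (TCons (u : term G (OldS _)) (TNil G)))).
- move=> G m n t u.
  by exists (TApp (L := L2) (f := OldF (OldF (AddF R m n : fn L0) : fn L1))
    (TCons (t : term G (OldS _)) (TCons (u : term G (OldS _)) (TNil G)))).
- move=> G m n t h.
  by exists (TApp (L := L2) (f := OldF (OldF (InclF R h : fn L0) : fn L1))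
    (TCons (t : term G (OldS _)) (TNil G))).
- by move=> G; exists (TApp (L := L2) (f := OldF (OldF (ZeroF R : fn L0) :
  fn L1)) (TNil G)).
- by move=> G; exists (TApp (L := L2) (f := OldF (OldF (OneF R : fn L0) :
  fn L1)) (TNil G)).
Defined.

End Instances.

(** * Gap formulas *)

Section ProjFormulas.
Variables (R : realType) (K : Type) (alg : K -> cstarType R) (L : mstruct R K).
Variable C : cterms alg L.
Implicit Types (G : seq (srt L)).

Let s1 := ct_s C 1.

Local Notation val := (ct_val (c := C)).

Lemma ct_inhabited (M : K) n : exists x : car M (ct_s C n), setT x.
Proof.
have [|x _] := @ct_surj _ _ _ _ C M n 0; first by rewrite cnorm0 ler0n.
by exists x.
Qed.

Lemma formula_dist G n (t u : term G (ct_s C n)) : exists phi : formula G,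
  forall M (e : env (car M) G),
    feval phi e = cnorm (val (teval e t) - val (teval e u)).
Proof. by exists (FDist t u) => M e /=; rewrite ct_dst. Qed.

(** The infimum over [v] in the unit ball of [|v^* v - p| + |v v^* - q|] is [0] for equivalent
    projections, since a partial isometry has norm at most [1]. By [mvn_gap] it is at least [1/100]
    otherwise. *)
Lemma mvn_formula G (t u : term G s1) : exists phi : formula G,
  forall M (e : env (car M) G) (p := val (teval e t)) (q := val (teval e u)),
    is_proj p -> is_proj q -> feval phi e = discrete_val R (mvn p q).
Proof.
have [t' tE] := term_weaken s1 t; have [u' uE] := term_weaken s1 u.
pose v : term (s1 :: G) s1 := TVar (VZ _ _).
have [vs vsE] := ct_star v.
have [vv vvE] := ct_mul vs v; have [vv' vv'E] := ct_mul v vs.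
have [d1 d1E] := formula_dist vv t'; have [d2 d2E] := formula_dist vv' u'.
have [d dE] := formula_add d1 d2.
have dV M (a : car M s1) (e : env (car M) G) :
    feval d ((a, e) : env (car M) (s1 :: G)) =
    cnorm (star (val a) * val a - val (teval e t)) +
    cnorm (val a * star (val a) - val (teval e u)).
  by rewrite dE d1E d2E vvE vv'E vsE tE uE.
have [phi phiE] := formula_clamp (100^-1)^-1 0 (FInf d).
exists phi => M e p q pP qP; rewrite phiE; apply: clamp_gap.
- by lra.
- move=> [w [wp wq]]; rewrite /= inf_setT.
  have [|x xE] := @ct_surj _ _ _ _ C M 1 w.
    by apply: cnorm_le1; rewrite wp is_proj_norm.
  apply: (inf_on_eq0 (x := x)) => // [y _|].
    by rewrite dV addr_ge0 ?cnorm_ge0.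
  by rewrite dV xE wp wq !subrr cnorm0 addr0.
- move=> npq; rewrite /= inf_setT; apply: inf_on_ge; first exact: ct_inhabited.
  move=> x _; rewrite dV leNgt; apply/negP => lt; apply: npq.
  apply: (@mvn_gap _ _ p q (val x)) => //; first exact: (ct_norm x).
    by have := cnorm_ge0 (val x * star (val x) - q); lra.
  by have := cnorm_ge0 (star (val x) * val x - p); lra.
Qed.

(* With [a], [b] isometries with orthogonal ranges, [t = v a^* + w b^*] almost
   implements an equivalence between [a p a^* + b q b^*] and [r]. *)
Lemma padd_gap (A : cstarType R) (p q r v w : A) (d : R) : orth_isometries A ->
  is_proj p -> is_proj q -> is_proj r -> d <= 1000^-1 ->
  cnorm (star v * v - p) <= d -> cnorm (star w * w - q) <= d ->
  cnorm (star v * w) <= d -> cnorm (v * star v + w * star w - r) <= d ->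
  padd p q r.
Proof.
move=> [a [b [aa bb ab]]] pP qP rP d1 vp wq vw vwr.
have [[pS pI] [qS qI]] := (pP, qP); have ba := star_eq0 ab.
have d0 : 0 <= d by rewrite (le_trans _ vw) ?cnorm_ge0.
have na : cnorm a <= 1 by apply: cnorm_le1; rewrite aa cnorm1.
have nb : cnorm b <= 1 by apply: cnorm_le1; rewrite bb cnorm1.
have nr := is_proj_norm rP.
have comp (x y z : A) : cnorm x <= 1 -> cnorm y <= 1 -> cnorm z <= d ->
    cnorm (x * z * star y) <= d.
  move=> x1 y1 zd; rewrite -[d]mulr1 cnormM_le ?cnorm_star //.
  by rewrite -[d]mul1r cnormM_le.
set c := a * p * star a + b * q * star b.
have pqc : padd p q c.
  exists (a * p), (b * q); rewrite !starM pS qS; split.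
  - by rewrite mulrA -(mulrA p) aa mulr1.
  - by rewrite mulrA -(mulrA q) bb mulr1.
  - by rewrite mulrA -(mulrA p) ab mulr0 mul0r.
  - by rewrite /c -!mulrA (mulrA p p) (mulrA q q) pI qI.
have cP := padd_proj pP qP pqc.
set t := v * star a + w * star b.
have tS : star t = a * star v + b * star w by rewrite starD !starM !starK.
have tt' : t * star t = v * star v + w * star w.
  rewrite tS /t (_ : _ * _ = v * (star a * a) * star v + v * (star a * b) * star w
    + w * (star b * a) * star v + w * (star b * b) * star w); last by ncring.
  by rewrite aa ab ba bb !mulr1 !mulr0 !mul0r !addr0.
have tt : cnorm (star t * t - c) <= 4 * d.
  rewrite tS /t /c (_ : _ - _ = a * (star v * v - p) * star a
    + b * (star w * w - q) * star b + a * (star v * w) * star b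
    + b * (star w * v) * star a); last by ncring.
  have h1 := comp a a _ na na vp; have h2 := comp b b _ nb nb wq.
  have h3 := comp a b _ na nb vw.
  have h4 : cnorm (b * (star w * v) * star a) <= d.
    by apply: comp => //; rewrite -[star w * v]starK starM starK cnorm_star.
  set x1 := a * _ * _; set x2 := b * _ * _; set x3 := a * _ * _; set x4 := b * _ * _.
  rewrite -/x1 -/x2 -/x3 -/x4 in h1 h2 h3 h4.
  have := cnormD (x1 + x2 + x3) x4; have := cnormD (x1 + x2) x3.
  have := cnormD x1 x2; lra.
have nt : cnorm t <= 1 + d.
  rewrite -(@ler_pXn2r _ 2) ?nnegrE ?cnorm_ge0 ?addr_ge0 //.
  rewrite -(cnorm_star t) -cstar_identity starK tt'.
  have := cnormD (v * star v + w * star w - r) r; rewrite subrK; nra.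
(* The norm of [t] is at most [1 + d], so [l * t] is in the unit ball, as [mvn_gap] requires.
   Scaling costs [2 d], and the total [6 d] stays below [1/100]. *)
pose l := 1 - d.
have scale (x y : A) (k : R) : cnorm (x - y) <= k -> cnorm y <= 1 ->
    cnorm ((l * l)%:C *: x - y) <= k + 2 * d.
  move=> xy y1.
  rewrite (_ : _ - y = (l * l)%:C *: (x - y) - (1 - l * l)%:C *: y); last first.
    by rewrite scalerBr rmorphB /= scalerBl scale1r; ncring.
  have [l0 l1 l2] : [/\ 0 <= l * l, l * l <= 1 & 1 - l * l <= 2 * d].
    by rewrite /l; split; nra.
  rewrite (le_trans (cnormB _ _)) // !cnormZr !ger0_norm //; last by lra.
  apply: lerD; last by rewrite (le_trans _ l2) // ler_piMr //; lra.
  by rewrite (le_trans _ xy) // ler_piMl // cnorm_ge0.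
apply: (padd_mvn pP qP pqc); apply: (@mvn_gap _ _ c r (l%:C *: t)) => //.
- rewrite cnormZr ger0_norm; last by rewrite /l; lra.
  have := cnorm_ge0 t; rewrite /l; nra.
- rewrite starZr -scalerAl -scalerAr scalerA -rmorphM /=.
  by apply: (le_trans (scale _ _ _ tt (is_proj_norm cP))); lra.
- rewrite starZr -scalerAl -scalerAr scalerA -rmorphM /= tt'.
  by apply: (le_trans (scale _ _ _ vwr nr)); lra.
Qed.

(** A double infimum over the unit ball adds up the four defects in the definition of [padd];
    [padd_gap] bounds it below by [1/1000] when the relation fails. *)
Lemma padd_formula G (t u z : term G s1) : exists phi : formula G,
  forall M (e : env (car M) G) (p := val (teval e t)) (q := val (teval e u))
    (r := val (teval e z)), orth_isometries (alg M) ->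
    is_proj p -> is_proj q -> is_proj r ->
    feval phi e = discrete_val R (padd p q r).
Proof.
have [t' tE] := term_weaken s1 t; have [t'' tE'] := term_weaken s1 t'.
have [u' uE] := term_weaken s1 u; have [u'' uE'] := term_weaken s1 u'.
have [z' zE] := term_weaken s1 z; have [z'' zE'] := term_weaken s1 z'.
pose w : term (s1 :: s1 :: G) s1 := TVar (VZ _ _).
pose v : term (s1 :: s1 :: G) s1 := TVar (VS _ (VZ _ _)).
have [vs vsE] := ct_star v; have [ws wsE] := ct_star w.
have [vv vvE] := ct_mul vs v; have [vv' vv'E] := ct_mul v vs.
have [ww wwE] := ct_mul ws w; have [ww' ww'E] := ct_mul w ws.
have [vw vwE] := ct_mul vs w; have [s sE] := ct_add vv' ww'.
have [z0 z0E] := ct_zero C (s1 :: s1 :: G); have [z1 z1E] := ct_incl z0 (leq0n 1).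
(* The sum of the two range projections is a term in the ball of radius [2], so [z] is compared with
   it there. *)
have [z2 z2E] := ct_incl z'' (leqnSn 1).
have [d1 d1E] := formula_dist vv t''; have [d2 d2E] := formula_dist ww u''.
have [d3 d3E] := formula_dist vw z1; have [d4 d4E] := formula_dist s z2.
have [d12 d12E] := formula_add d1 d2; have [d34 d34E] := formula_add d3 d4.
have [d dE] := formula_add d12 d34.
have dV M (x y : car M s1) (e : env (car M) G) :
    feval d ((y, (x, e)) : env (car M) (s1 :: s1 :: G)) =
    cnorm (star (val x) * val x - val (teval e t)) +
    cnorm (star (val y) * val y - val (teval e u)) +
    (cnorm (star (val x) * val y) +
     cnorm (val x * star (val x) + val y * star (val y) - val (teval e z))).
  rewrite dE d12E d34E d1E d2E d3E d4E sE vvE vv'E wwE ww'E vwE vsE wsE z1E z0E z2E.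
  by rewrite tE' tE uE' uE zE' zE subr0.
have [phi phiE] := formula_clamp (1000^-1)^-1 0 (FInf (FInf d)).
exists phi => M e p q r Miso pP qP rP; rewrite phiE; apply: clamp_gap.
- by lra.
- move=> [x [y [xp yq xy xyr]]].
  have [|x' x'E] := @ct_surj _ _ _ _ C M 1 x.
    by apply: cnorm_le1; rewrite xp is_proj_norm.
  have [|y' y'E] := @ct_surj _ _ _ _ C M 1 y.
    by apply: cnorm_le1; rewrite yq is_proj_norm.
  have ge0 a b : 0 <= feval d ((b, (a, e)) : env (car M) (s1 :: s1 :: G)).
    by rewrite dV; apply: addr_ge0; apply: addr_ge0; exact: cnorm_ge0.
  rewrite /= inf_setT; apply: (inf_on_eq0 (x := x')) => // [a _|].
    by rewrite inf_setT; apply: inf_on_ge => //; exact: ct_inhabited.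
  rewrite inf_setT; apply: (inf_on_eq0 (x := y')) => //.
  by rewrite dV x'E y'E xp yq xy xyr !subrr cnorm0 !addr0.
- move=> npq; rewrite /= inf_setT; apply: inf_on_ge; first exact: ct_inhabited.
  move=> x _; rewrite inf_setT; apply: inf_on_ge; first exact: ct_inhabited.
  move=> y _; rewrite dV leNgt; apply/negP => lt; apply: npq.
  move: lt; rewrite -/p -/q -/r.
  have := cnorm_ge0 (star (val x) * val x - p).
  have := cnorm_ge0 (star (val y) * val y - q).
  have := cnorm_ge0 (star (val x) * val y).
  have := cnorm_ge0 (val x * star (val x) + val y * star (val y) - r).
  move=> h1 h2 h3 h4 h5.
  by apply: (padd_gap Miso pP qP rP (lexx _) (v := val x) (w := val y)); lra.
Qed.

End ProjFormulas.
(** * The definable set of nonzero projections *)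

Section NzProj.
Variables (R : realType) (K : Type) (alg : K -> cstarType R).

Let L0 := cstar_struct alg.

Definition nzproj_set (M : K) : set (env (car (m := L0) M) [:: 1%N]) :=
  fun e => nz_proj (proj1_sig e.1).

Lemma nz_proj_norm (A : cstarType R) (p : A) : nz_proj p -> cnorm p = 1.
Proof. by move=> [pP p0]; exact: is_proj_norm_cases. Qed.

Lemma nz_proj1 (A : cstarType R) : nz_proj (1 : A).
Proof. by split; [exact: is_proj1 | exact: oner_neq0]. Qed.

(** The term [1 - cnorm a] keeps [a] away from [0], hence the nearby projection is nonzero. The
    factor [41] makes the bound [40 c] of [near_proj] strict. *)
Lemma near_nz_proj (A : cstarType R) (a : A) (c d : R) : cnorm a <= 1 ->
  0 < c -> c <= 100^-1 -> 41 * c <= d ->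
  cnorm (a * a - a) + cnorm (star a - a) + (1 - cnorm a) <= c ->
  exists2 p, nz_proj p & cnorm (p - a) < d.
Proof.
move=> a1 c0 c100 cd ac.
have := cnorm_ge0 (a * a - a); have := cnorm_ge0 (star a - a) => h1 h2.
have [||p pP pa] := near_proj a1 c100; [by lra | by lra |].
exists p; last by lra.
split=> //; apply/eqP => p0; move: pa; rewrite p0 sub0r cnormN; lra.
Qed.

Lemma nz_proj_closed (A : cstarType R) (a : A) :
  (forall eps : R, 0 < eps -> exists2 p, nz_proj p & cnorm (a - p) < eps) ->
  nz_proj a.
Proof.
move=> ap; have eq0 (x : A) : (forall eps : R, 0 < eps < 1 ->
  cnorm x <= 4 * eps) -> x = 0.
  move=> xe; apply/cnorm_eq0/eqP; rewrite eq_le cnorm_ge0 andbT leNgt.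
  apply/negP => x0; have := xe (cnorm x / 8); have := xe (1 / 2); lra.
split; first split.
- apply/subr0_eq/eq0 => eps /andP[e0 e1]; have [p [[pS pI] _] pa] := ap eps e0.
  rewrite (_ : _ - a = star (a - p) - (a - p)); last by rewrite starB pS; ncring.
  by rewrite (le_trans (cnormB _ _)) // cnorm_star; lra.
- apply/subr0_eq/eq0 => eps /andP[e0 e1]; have [p [pP p0] pa] := ap eps e0.
  have p1 := is_proj_norm pP; have [_ pI] := pP.
  have a2 : cnorm a <= 2 by have := cnormD (a - p) p; rewrite subrK; lra.
  rewrite (_ : _ - a = (a - p) * a + p * (a - p) - (a - p) + (p * p - p));
    last by ncring.
  rewrite pI subrr addr0.
  have h1 : cnorm ((a - p) * a) <= eps * 2 by rewrite cnormM_le // ltW.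
  have h2 : cnorm (p * (a - p)) <= 1 * eps by rewrite cnormM_le // ltW.
  have := cnormB ((a - p) * a + p * (a - p)) (a - p).
  have := cnormD ((a - p) * a) (p * (a - p)); lra.
- apply/eqP => a0; have [|p pP] := ap 1; first by lra.
  by rewrite a0 sub0r cnormN nz_proj_norm // ltxx.
Qed.

Lemma nzproj_set_inhabited (M : K) : exists x, nzproj_set (M := M) x.
Proof. by exists (ball_one (alg M), tt); exact: nz_proj1. Qed.

(* Quantify over the whole ball, with a penalty for not being a projection. *)
Lemma nzproj_sup (D : seq (srt L0)) (psi : formula (L := L0) ([:: 1%N] ++ D))
  (eps : R) :
  0 < eps -> exists phi : formula D, forall (M : K) (y : env (car M) D),
  `|feval phi y - sup_on (nzproj_set (M := M)) (fun x =>
    feval psi (env_cat x y))| <= eps.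
Proof.
move=> e0; have [[N' psiN'] psiU] := formula_unif psi.
pose N := Num.max 1 N'; have N0 : 0 < N by rewrite lt_max ltr01.
have psiN (M : K) e : `|feval (M := M) psi e| <= N.
  by rewrite (le_trans (psiN' M e)) // le_max lexx orbT.
have [d d0 psid] := psiU _ e0.
pose c := Num.min 100^-1 (d / 41).
have c0 : 0 < c by rewrite lt_min; apply/andP; split; lra.
have c100 : c <= 100^-1 by rewrite /c ge_min lexx.
have cd : 41 * c <= d.
  have : c <= d / 41 by rewrite /c ge_min lexx orbT.
  lra.
pose C := cterms0 alg.
pose a : term (L := L0) (1%N :: D) (ct_s C 1) := TVar (VZ (1%N : srt L0) D).
have [aa aaE] := ct_mul a a; have [sa saE] := ct_star a.
have [z0 z0E] := ct_zero C (1%N :: D); have [z1 z1E] := ct_incl z0 (leq0n 1).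
have [d1 d1E] := formula_dist (C := C) (n := 1) aa a.
have [d2 d2E] := formula_dist (C := C) sa a; have [d3 d3E] := formula_dist (C :=
  C) a z1.
have [d4 d4E] := formula_scale (-1) d3.
have [one oneE] := @formula_const R K L0 (1%N :: D) 1.
have [d5 d5E] := formula_add d1 d2; have [d6 d6E] := formula_add one d4.
(* Where the defect exceeds [c], the penalty exceeds [2 N] and pushes the value below every value of
   [psi]. Where it is at most [c], a nonzero projection lies within [d], and [psi] changes by at
   most [eps]. *)
have [d7 d7E] := formula_add d5 d6; have [d8 d8E] := formula_scale (- (2 * N / c)) d7.
have [theta thetaE] := @formula_add R K L0 (1%N :: D) psi d8.
pose def (M : K) (x : cball (alg M) 1) :=
  cnorm (proj1_sig x * proj1_sig x - proj1_sig x)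
  + cnorm (star (proj1_sig x) - proj1_sig x) + (1 - cnorm (proj1_sig x)).
have thetaV (M : K) (x : cball (alg M) 1) (y : env (car (m := L0) M) D) :
    feval theta ((x, y) : env (car (m := L0) M) (1%N :: D)) =
    feval psi (env_cat ((x, tt) : env (car (m := L0) M) [::
      1%N]) y) - 2 * N / c * def M x.
  rewrite thetaE d8E d7E d5E d6E d4E oneE d1E d2E d3E aaE saE z1E z0E /=.
  by rewrite subr0 mulN1r mulNr.
have def0 (M : K) (x : cball (alg M) 1) : 0 <= def M x.
  rewrite /def; case: x => x x1 /=; have := cnorm_ge0 (x * x - x).
  by have := cnorm_ge0 (star x - x); lra.
have Nc0 : 0 < 2 * N / c by rewrite divr_gt0 // mulr_gt0.
exists (FSup theta) => M y; rewrite /= sup_setT.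
have thetaN x : setT x -> feval theta ((x, y) : env (car (m := L0) M) (1%N ::
  D)) <= N.
  move=> _; rewrite thetaV; have := mulr_ge0 (ltW Nc0) (def0 M x).
  by have := psiN M (env_cat ((x, tt) : env (car (m := L0) M) [:: 1%N]) y);
    rewrite ler_norml; lra.
have X0 := nzproj_set_inhabited M.
have psiN1 x : nzproj_set (M := M) x -> feval psi (env_cat x y) <= N.
  by move=> _; rewrite (le_trans (ler_norm _)).
have h1 : sup_on (nzproj_set (M := M)) (fun x => feval psi (env_cat x y)) <=
    sup_on setT (fun x => feval theta ((x, y) : env (car (m := L0) M) (1%N :: D))).
  apply: sup_on_le => // -[x []] xP.
  apply: (le_trans _ (sup_on_ge thetaN (I : setT x))).
  rewrite thetaV /def; have [[-> ->] _] := xP.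
  by rewrite (nz_proj_norm xP) !subrr cnorm0 !addr0 mulr0 subr0.
have h2 : sup_on setT (fun x => feval theta ((x, y) : env (car (m := L0) M)
  (1%N :: D))) <=
    sup_on (nzproj_set (M := M)) (fun x => feval psi (env_cat x y)) + eps.
  apply: sup_on_le; first exact: cball_inhabited.
  move=> x _; rewrite thetaV.
  have [xc|cx] := lerP (def M x) c; last first.
    have [z zP] := X0; have := sup_on_ge psiN1 zP.
    have := psiN M (env_cat z y); rewrite ler_norml => /andP[h _] h'.
    have := psiN M (env_cat ((x, tt) : env (car (m := L0) M) [:: 1%N]) y).
    rewrite ler_norml => /andP[_ h''].
    have : 2 * N <= 2 * N / c * def M x.
      by rewrite -{1}(@mulfVK _ c (lt0r_neq0 c0) (2 * N)) ler_pM2l // ltW.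
    lra.
  have [p pP pa] := near_nz_proj (proj2_sig x) c0 c100 cd xc.
  have p1 : cnorm p <= 1%:R by rewrite nz_proj_norm.
  pose p' : env (car (m := L0) M) [:: 1%N] := (exist _ p p1 : cball (alg M) 1, tt).
  have := sup_on_ge psiN1 (pP : nzproj_set p').
  have := psid M (env_cat ((x, tt) : env (car (m := L0) M) [:: 1%N]) y)
    (env_cat p' y).
  have -> : env_dist (@dst R K L0 M) (env_cat ((x, tt) : env (car (m :=
    L0) M) [:: 1%N]) y) (env_cat p' y) < d.
    rewrite /= gt_max cnorm_distC pa /=.
    by rewrite [env_dist _ _ _](env_dist_xx y).
  move=> /(_ isT); rewrite ler_norml => /andP[_ h] h'.
  have := mulr_ge0 (ltW Nc0) (def0 M x); lra.
by rewrite ler_norml; lra.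
Qed.

Lemma nzproj_definable : definable_set (L := L0) (G := [:: 1%N]) nzproj_set.
Proof.
split=> [M [x []] xcl|D psi]; first apply: nz_proj_closed => eps e0.
  have [[y []] yP] := xcl eps e0; rewrite /= gt_max => /andP[xy _].
  by exists (proj1_sig y).
split=> eps e0; first exact: nzproj_sup.
have [psi' psi'E] := formula_scale (-1) psi.
have [phi phiE] := nzproj_sup psi' e0; have [phi' phi'E] := formula_scale (-1) phi.
exists phi' => M y; rewrite phi'E mulN1r.
have -> : inf [set r | exists2 x, nzproj_set (M :=
  M) x & r = feval psi (env_cat x y)] =
    - sup_on (nzproj_set (M := M)) (fun x => feval psi' (env_cat x y)).
  rewrite -[LHS]/(inf_on (nzproj_set (M := M)) (fun x => feval psi (env_cat x y))).
  rewrite inf_onE; congr (- _); apply: sup_on_eq => x _.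
  by rewrite psi'E mulN1r.
by rewrite -opprD normrN.
Qed.

End NzProj.

(** * The sort of classes of nonzero projections *)

Section ClassSort.
Variables (R : realType) (K : Type) (alg : K -> cstarType R).

Let L0 := cstar_struct alg.
Let L1 := eq_step L0.

Definition nzproj_srt : srt L1 := SetS (nzproj_definable alg).

Definition nzproj_val (M : K) (x : car (m := L1) M nzproj_srt) : alg M :=
  proj1_sig (proj1_sig x).1.

Lemma nzproj_valP (M : K) (x : car (m := L1) M nzproj_srt) : nz_proj (nzproj_val x).
Proof. by case: x. Qed.

Lemma nzproj_val_surj (M : K) (p : alg M) : nz_proj p ->
  exists x : car (m := L1) M nzproj_srt, nzproj_val x = p.
Proof.
move=> pP; have p1 : cnorm p <= 1%:R by rewrite nz_proj_norm.
by exists (exist _ (exist _ p p1 : cball (alg M) 1, tt) pP).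
Qed.

Definition mvn_pred : upred ([:: nzproj_srt] ++ [:: nzproj_srt]) :=
  fun (M : K) (e : env (car (m := L1) M) [:: nzproj_srt; nzproj_srt]) =>
    discrete_val R (mvn (nzproj_val e.1) (nzproj_val e.2.1)).

(** The zero-one predicate of an equivalence relation is a pseudometric; here this is available in
    every member of the class of models. *)
Lemma mvn_definable : definable_pseudometric mvn_pred.
Proof.
split=> [|M d].
  pose co (t : term (L := L1) [:: nzproj_srt; nzproj_srt] nzproj_srt) :
      term (L := L1) [:: nzproj_srt; nzproj_srt] (ct_s (cterms1 alg) 1) :=
    TApp (L := L1) (f := CoordF (nzproj_definable alg) (VZ (1%N : srt L0) [::]))
      (TCons t (TNil _)).
  have [phi phiE] := mvn_formula (C := cterms1 alg)
    (co (TVar (VZ _ _))) (co (TVar (VS _ (VZ _ _)))).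
  move=> eps e0; exists phi => M e.
  rewrite phiE; [|exact: (nzproj_valP e.1).1 |exact: (nzproj_valP e.2.1).1].
  by rewrite subrr normr0 ltW.
have P (z : env (car (m := L1) M) [:: nzproj_srt]) : is_proj (nzproj_val z.1).
  exact: (nzproj_valP z.1).1.
split.
- by move=> [x []]; apply: discrete_val1; apply: mvn_refl; exact: (P (x, tt)).
- move=> [x []] [y []]; apply: discrete_val_iff; split; exact: mvn_sym.
- move=> [x []] [y []] [z []]; rewrite /d /mvn_pred /=.
  have [xy|nxy] := EM (mvn (nzproj_val x) (nzproj_val y)); last first.
    rewrite (discrete_val0 R nxy); have :=
      discrete_val_ge0 R (mvn (nzproj_val y) (nzproj_val z)).
    by rewrite /discrete_val; case: asbool => /=; case: asbool => /=; lra.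
  have [yz|nyz] := EM (mvn (nzproj_val y) (nzproj_val z)).
    rewrite (discrete_val1 R (mvn_trans (P (x, tt)) (P (y, tt)) xy yz)).
    by rewrite addr_ge0 // discrete_val_ge0.
  rewrite (discrete_val0 R nyz); have := discrete_val_ge0 R (mvn (nzproj_val x)
    (nzproj_val y)).
  by rewrite /discrete_val; case: asbool => /=; case: asbool => /=; lra.
Qed.

Let L2 := eq_step L1.

(** The set of nonzero projections is a sort of the first stage, so its quotient appears in the
    second. *)
Definition class_srt : srt L2 := QuotS mvn_definable.

Definition class_of (M : K) (x : car (m := L1) M nzproj_srt) :
    car (m := L2) M class_srt :=
  cls _ ((x, tt) : env (car (m := L1) M) [:: nzproj_srt]).

Lemma class_ofP (M : K) (x y : env (car (m := L1) M) [:: nzproj_srt]) :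
  cls (fun a b : env (car (m := L1) M) [:: nzproj_srt] =>
    mvn_pred (env_cat a b) = 0) x =
  cls _ y <-> mvn (nzproj_val x.1) (nzproj_val y.1).
Proof.
have P (z : env (car (m := L1) M) [:: nzproj_srt]) : is_proj (nzproj_val z.1).
  exact: (nzproj_valP z.1).1.
have E (a b : env (car (m := L1) M) [:: nzproj_srt]) : mvn_pred (env_cat a b) = 0 <->
    mvn (nzproj_val a.1) (nzproj_val b.1).
  by case: a b => a [] [b []]; exact: discrete_val_eq0.
rewrite cls_eqP ?E // => [a|a b|a b c]; rewrite !E.
- exact: mvn_refl.
- exact: mvn_sym.
- exact: mvn_trans.
Qed.

Lemma class_of_eq (M : K) (x y : car (m := L1) M nzproj_srt) :
  class_of x = class_of y <-> mvn (nzproj_val x) (nzproj_val y).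
Proof. exact: class_ofP. Qed.

Lemma class_of_surj (M : K) (c : car (m := L2) M class_srt) : exists x,
  c = class_of x.
Proof.
rewrite -[c](cls_repr (E := fun a b : env (car (m := L1) M) [:: nzproj_srt] => _)).
by case: (Defs.repr _) => x []; exists x.
Qed.

Lemma class_dst (M : K) (c c' : car (m := L2) M class_srt) :
  dst c c' = discrete_val R (c = c').
Proof.
rewrite -[in RHS](cls_repr (E := fun a b : env (car (m := L1) M) [::
  nzproj_srt] => _) c).
rewrite -[in RHS](cls_repr (E := fun a b : env (car (m := L1) M) [::
  nzproj_srt] => _) c').
rewrite (discrete_val_iff R (class_ofP _ _)) /=.
by case: (Defs.repr c) => x []; case: (Defs.repr c') => y [].
Qed.

End ClassSort.
(** * Definable relations *)

Section Decides.
Variables (R : realType) (K : Type) (L : mstruct R K).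

(** The value is prescribed only at good models and at environments in [dom], where the gap
    estimates apply; elsewhere the formula is arbitrary. Exact values, rather than approximations,
    make the notion closed under negation and quantifiers. *)
Definition decides (good : K -> Prop) (G : seq (srt L))
    (dom : forall M, set (env (car M) G)) (Q : forall M, set (env (car M) G)) :=
  exists phi : formula G, forall M e, good M -> dom M e ->
    feval phi e = discrete_val R (Q M e).

Variables (good : K -> Prop).
Implicit Types (G : seq (srt L)).

Lemma decides_ext G (D Q Q' : forall M, set (env (car M) G)) :
  (forall M e, good M -> D M e -> Q M e <-> Q' M e) ->
  decides good D Q -> decides good D Q'.
Proof.
move=> QQ' [phi phiE]; exists phi => M e gM De; rewrite phiE //.
exact/discrete_val_iff/QQ'.
Qed.

Lemma decides_true G (D : forall M, set (env (car M) G)) :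
  decides good D (fun _ _ => True).
Proof.
have [phi phiE] := @formula_const R K L G 0; exists phi => M e _ _.
by rewrite phiE discrete_val1.
Qed.

Lemma decides_not G (D Q : forall M, set (env (car M) G)) :
  decides good D Q -> decides good D (fun M e => ~ Q M e).
Proof.
move=> [phi phiE]; have [psi psiE] := formula_clamp (-1) 1 phi.
exists psi => M e gM De; rewrite psiE phiE //.
have [q|q] := EM (Q M e).
  by rewrite discrete_val1 // mulr0 add0r clamp1 // discrete_val0.
by rewrite discrete_val0 // mulr1 addNr clamp0 discrete_val1.
Qed.

Lemma decides_and G (D Q Q' : forall M, set (env (car M) G)) :
  decides good D Q -> decides good D Q' ->
  decides good D (fun M e => Q M e /\ Q' M e).
Proof.
move=> [phi phiE] [phi' phiE']; have [psi psiE] := formula_add phi phi'.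
have [chi chiE] := formula_clamp 1^-1 0 psi.
exists chi => M e gM De; rewrite chiE psiE phiE // phiE' //.
apply: clamp_gap; first exact: ltr01.
  by move=> [q q']; rewrite !discrete_val1 // addr0.
move=> nq; have [q|q] := EM (Q M e); last first.
  by rewrite discrete_val0 // lerDl discrete_val_ge0.
by rewrite discrete_val1 // add0r discrete_val0 // => q'; apply: nq.
Qed.

Lemma decides_ex (s : srt L) G (Q : forall M, set (env (car M) (s :: G))) :
  (forall M, exists x : car M s, setT x) ->
  decides good (fun _ => setT) Q ->
  decides good (fun _ => setT)
    (fun M e => exists x : car M s, Q M ((x, e) : env (car M) (s :: G))).
Proof.
move=> s0 [phi phiE]; exists (FInf phi) => M e gM _ /=; rewrite inf_setT.
rewrite (inf_on_discrete (Q := fun x => Q M ((x, e) : env (car M) (s :: G)))) //.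
  apply: discrete_val_iff; split; first by move=> [x _ Qx]; exists x.
  by move=> [x Qx]; exists x.
by move=> x _; rewrite phiE.
Qed.

End Decides.

(** * The operations of the group as relations between classes *)

Section ClassRelations.
Variables (R : realType) (K : Type) (alg : K -> cstarType R).

Let L1 := eq_step (cstar_struct alg).
Let L2 := eq_step L1.
Let N : srt L1 := nzproj_srt alg.
Let N2 : srt L2 := OldS N.
Let S : srt L2 := class_srt alg.
Let good (M : K) := infinite_alg (alg M).
Implicit Types (G : seq (srt L2)).

Let all G : forall M, set (env (car (m := L2) M) G) := fun _ => setT.

Lemma nzproj_inhabited (M : K) : exists x : car (m := L2) M N2, setT x.
Proof. by have [x _] := nzproj_val_surj (nz_proj1 (alg M)); exists x. Qed.

Lemma decides_class G (x : term G S) (p : term G N2) :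
  decides good (@all G) (fun M e => teval e x = class_of (M := M) (teval e p)).
Proof.
pose q : term G S := TApp (L := L2) (f := QuotF (mvn_definable alg)) (TCons (p :
  term G (OldS _)) (TNil _)).
by exists (FDist x q) => M e _ _; rewrite -class_dst.
Qed.

Let coord G (p : term G N2) : term G (ct_s (cterms2 alg) 1) :=
  TApp (L := L2) (f := OldF (CoordF (nzproj_definable alg)
    (VZ (1%N : srt (cstar_struct alg)) [::]) : fn L1)) (TCons (p :
      term G (OldS _)) (TNil _)).

Lemma decides_padd G (p q r : term G N2) : decides good (@all G)
  (fun M e => padd (nzproj_val (M := M) (teval e p)) (nzproj_val (M := M) (teval e q))
    (nzproj_val (M := M) (teval e r))).
Proof.
have [phi phiE] := padd_formula (C := cterms2 alg) (coord p) (coord q) (coord r).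
exists phi => M e [Miso _] _; rewrite phiE //.
- exact: (nzproj_valP (M := M) (teval e p)).1.
- exact: (nzproj_valP (M := M) (teval e q)).1.
- exact: (nzproj_valP (M := M) (teval e r)).1.
Qed.

Lemma decides_unit G (p : term G N2) : decides good (@all G)
  (fun M e => mvn (nzproj_val (M := M) (teval e p)) 1).
Proof.
have [one oneE] := ct_one (cterms2 alg) G.
have [phi phiE] := mvn_formula (C := cterms2 alg) (coord p) one.
exists phi => M e _ _; rewrite phiE ?oneE //.
- exact: (nzproj_valP (M := M) (teval e p)).1.
- exact: is_proj1.
Qed.

Lemma decides_class_zero : decides good (@all [:: S])
  (fun M e => exists x : car (m := L1) M N, e.1 = class_of x /\
    padd (nzproj_val x) (nzproj_val x) (nzproj_val x)).
Proof.
pose x : term [:: N2; S] N2 := TVar (VZ _ _).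
pose a : term [:: N2; S] S := TVar (VS _ (VZ _ _)).
exact: (decides_ex nzproj_inhabited
  (decides_and (decides_class a x) (decides_padd x x x))).
Qed.

Lemma decides_class_unit : decides good (@all [:: S])
  (fun M e => exists x : car (m := L1) M N, e.1 = class_of x /\
    mvn (nzproj_val x) 1).
Proof.
pose x : term [:: N2; S] N2 := TVar (VZ _ _).
pose a : term [:: N2; S] S := TVar (VS _ (VZ _ _)).
exact: (decides_ex nzproj_inhabited
  (decides_and (decides_class a x) (decides_unit x))).
Qed.

Lemma decides_class_add : decides good (@all [:: S; S; S])
  (fun M e => exists x y z : car (m := L1) M N, (e.1 = class_of x /\
    e.2.1 = class_of y) /\ (e.2.2.1 = class_of z /\
    padd (nzproj_val x) (nzproj_val y) (nzproj_val z))).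
Proof.
pose G := [:: N2; N2; N2; S; S; S].
(* A context is a stack, so the variable quantified first lies deepest among the three. *)
pose x : term G N2 := TVar (VS _ (VS _ (VZ _ _))).
pose y : term G N2 := TVar (VS _ (VZ _ _)).
pose z : term G N2 := TVar (VZ _ _).
pose a : term G S := TVar (VS _ (VS _ (VS _ (VZ _ _)))).
pose b : term G S := TVar (VS _ (VS _ (VS _ (VS _ (VZ _ _))))).
pose c : term G S := TVar (VS _ (VS _ (VS _ (VS _ (VS _ (VZ _ _)))))).
exact: (decides_ex nzproj_inhabited (decides_ex nzproj_inhabited
  (decides_ex nzproj_inhabited
    (decides_and (decides_and (decides_class a x) (decides_class b y))
      (decides_and (decides_class c z) (decides_padd x y z)))))).
Qed.

Lemma decides_class_opp : decides good (@all [:: S; S])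
  (fun M e => exists x y z : car (m := L1) M N, (e.1 = class_of x /\
    e.2.1 = class_of y) /\ (padd (nzproj_val z) (nzproj_val z) (nzproj_val z) /\
    padd (nzproj_val x) (nzproj_val y) (nzproj_val z))).
Proof.
pose G := [:: N2; N2; N2; S; S].
pose x : term G N2 := TVar (VS _ (VS _ (VZ _ _))).
pose y : term G N2 := TVar (VS _ (VZ _ _)).
pose z : term G N2 := TVar (VZ _ _).
pose a : term G S := TVar (VS _ (VS _ (VS _ (VZ _ _)))).
pose b : term G S := TVar (VS _ (VS _ (VS _ (VS _ (VZ _ _))))).
exact: (decides_ex nzproj_inhabited (decides_ex nzproj_inhabited
  (decides_ex nzproj_inhabited
    (decides_and (decides_and (decides_class a x) (decides_class b y))
      (decides_and (decides_padd z z z) (decides_padd x y z)))))).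
Qed.

End ClassRelations.

(** * The group as a sort of the second stage *)

Section InAeq.
Variables (R : realType) (A : cstarType R).
Hypothesis Ainf : infinite_alg A.

Let alg := @proj1_sig _ (elem_equiv A).
Let self := Th_self A.
Let L2 := eq_stage A 2.
Let S : srt L2 := class_srt alg.
Let nz := car (m := eq_stage A 1) self (nzproj_srt alg).

Let val (x : nz) : A := nzproj_val x.

Let nz_prj (x : nz) : prj A := exist _ (val x) (nzproj_valP x).1.

Let g (x : nz) : K0 A := K0cls (nz_prj x).

Let val_nz (x : nz) : proj1_sig (nz_prj x) != 0 := (nzproj_valP x).2.

Let g_surj (X : K0 A) : exists x, g x = X.
Proof.
have [p p0 ->] := K0cls_surj Ainf X.
have [x xE] := nzproj_val_surj (alg := alg) (M := self) (conj (proj2_sig p) p0).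
exists x; apply/(K0cls_eq Ainf (val_nz x) p0); rewrite /= /val xE.
by apply: mvn_refl; case: (p).
Qed.

Let lift (X : K0 A) : nz := projT1 (cid (g_surj X)).

Let gK X : g (lift X) = X.
Proof. exact: projT2 (cid (g_surj X)). Qed.

Let g_eq x y : g x = g y <-> class_of x = class_of y.
Proof. by rewrite /g (K0cls_eq Ainf) // (class_of_eq (alg := alg)). Qed.

Let f (X : K0 A) : car (m := L2) self S := class_of (lift X).

Let fP x X : class_of x = f X <-> g x = X.
Proof. by rewrite -{2}(gK X) g_eq. Qed.

Let f_class (X : K0 A) : exists2 x, f X = class_of x & g x = X.
Proof. by exists (lift X). Qed.

(** The deciding formula itself serves as the definable predicate over all models; its meaning is
    checked at [A], which is a good model. *)
Lemma definable_rel_decides (G : seq (srt L2))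
    (Q : forall M, set (env (car (m := L2) M) G))
    (Q' : set (env (car (m := L2) self) G)) :
  decides (fun M => infinite_alg (alg M)) (fun _ => setT) Q ->
  (forall e, Q self e <-> Q' e) -> definable_rel Q'.
Proof.
move=> [phi phiE] QQ'; exists (fun M e => feval phi e).
  by move=> eps e0; exists phi => M e; rewrite subrr normr0 ltW.
by move=> e; rewrite phiE //; exact: discrete_val_iff.
Qed.

Lemma K0_in_Aeq : in_Aeq A (K0 A).
Proof.
exists 2%N, S, f; split.
- exists (fun c => g (projT1 (cid (class_of_surj c)))) => [X|c].
    by apply/fP; rewrite -(projT2 (cid (class_of_surj (f X)))).
  apply/esym; rewrite {1}(projT2 (cid (class_of_surj c))).
  exact/fP.
- move=> X Y; rewrite (class_dst (alg := alg)); apply: discrete_val_iff.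
  by split=> [/fP|->//]; rewrite gK.
split.
- apply: (definable_rel_decides (decides_class_zero alg)) => -[c []] /=.
  split=> [[x [-> xxx]]|->].
    by apply/fP/esym/(K0cls_zero Ainf).
  have [x -> gx] := f_class (og_zero (K0 A)); exists x; split; first by [].
  exact: (proj1 (K0cls_zero Ainf (val_nz x)) (esym gx)).
- apply: (definable_rel_decides (decides_class_unit alg)) => -[c []] /=.
  have unitE x : g x = og_unit (K0 A) <-> mvn (val x) 1.
    by rewrite K0cls_unit; exact: (K0cls_eq Ainf (val_nz x) (oner_neq0 A :
      proj1_sig (prj1 A) != 0)).
  split=> [[x [-> x1]]|->]; first by apply/fP/unitE.
  by have [x -> /unitE gx] := f_class (og_unit (K0 A)); exists x.
- apply: (definable_rel_decides (decides_class_add alg)) => -[c [c' [c'' []]]] /=.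
  split=> [[x [y [z [[-> ->] [-> xyz]]]]]|[X [Y [-> -> ->]]]].
    exists (g x), (g y); split; try exact/fP.
    by apply/fP/esym/(K0cls_add Ainf).
  have [x -> <-] := f_class X; have [y -> <-] := f_class Y.
  have [z -> gz] := f_class (og_add (g x) (g y)).
  exists x, y, z; split; first by []; split; first by [].
  exact: (proj1 (K0cls_add Ainf (val_nz x) (val_nz y) (val_nz z)) (esym gz)).
- apply: (definable_rel_decides (decides_class_opp alg)) => -[c [c' []]] /=.
  split=> [[x [y [z [[-> ->] [zzz xyz]]]]]|[X [-> ->]]].
    exists (g x); split; first exact/fP.
    apply/fP/esym/(K0cls_opp Ainf) => //.
    by exists (nz_prj z).
  have [x -> <-] := f_class X; have [y -> gy] := f_class (og_opp (g x)).
  have /(K0cls_opp Ainf (val_nz x) (val_nz y))[r [r0 rrr xyr]] := esym gy.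
  have [z zE] := nzproj_val_surj (alg := alg) (M := self) (conj (proj2_sig r) r0).
  by exists x, y, z; split; [by [] | rewrite zE; split].
- apply: (definable_rel_decides (decides_true _ _)) => -[c []] /=.
  split=> // _; have [x ->] := class_of_surj c; exists (g x); split.
    exact/fP.
  exact: (K0_pos Ainf).
Qed.

End InAeq.
(** * Translation of first-order formulas about [K_0] *)

Section Translation.
Variable R : realType.

Let L := cstar_lang R.
Implicit Types (G : seq (srt L)).

Let good (M : cstarType R) := infinite_alg M.

Fixpoint all_nz (M : cstarType R) G : set (env (car (m := L) M) G) :=
  match G return set (env (car (m := L) M) G) with
  | [::] => fun _ => True
  | s :: G' => fun e => nz_proj (proj1_sig e.1) /\ all_nz e.2
  end.

Let all G : forall M, set (env (car (m := L) M) G) := fun M e => all_nz e.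

Lemma all_nz_lookup (M : cstarType R) G s (v : var G s) (e : env (car (m := L) M) G) :
  all_nz e -> nz_proj (proj1_sig (lookup v e)).
Proof.
elim: v e => [{}s {}G|t {}s {}G v IH] e /= [h1 h2]; first exact: h1.
exact: IH.
Qed.

(* The class of [a] in [K_0], with a junk value when [a] is not a projection. *)
Definition K0elt (M : cstarType R) (a : M) : K0 M :=
  if pselect (is_proj a) is left aP then K0cls (exist _ a aP) else og_zero (K0 M).

Lemma K0eltE (M : cstarType R) (p : prj M) : K0elt (proj1_sig p) = K0cls p.
Proof.
rewrite /K0elt; case: pselect => [aP|nP]; last by case: nP; case: p.
by congr K0cls; case: p aP => a aP aP' /=; congr exist; exact: Prop_irrelevance.
Qed.

Section Elt.
Variables (M : cstarType R) (Minf : infinite_alg M).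
Implicit Types a b c : M.

Lemma K0elt_surj (X : K0 M) : exists2 x : cball M 1, nz_proj (proj1_sig x) &
  K0elt (proj1_sig x) = X.
Proof.
have [p p0 ->] := K0cls_surj Minf X; have pP : nz_proj (proj1_sig p).
  by split=> //; case: (p).
have p1 : cnorm (proj1_sig p) <= 1%:R by rewrite nz_proj_norm.
by exists (exist _ (proj1_sig p) p1) => //; exact: K0eltE.
Qed.

Lemma K0elt_eq a b : nz_proj a -> nz_proj b -> K0elt a = K0elt b <-> mvn a b.
Proof.
move=> [aP a0] [bP b0].
rewrite (K0eltE (exist _ a aP)) (K0eltE (exist _ b bP)).
exact: (K0cls_eq Minf (p := exist _ a aP) (q := exist _ b bP)).
Qed.

Lemma K0elt_add a b c : nz_proj a -> nz_proj b -> nz_proj c ->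
  og_add (K0elt a) (K0elt b) = K0elt c <-> padd a b c.
Proof.
move=> [aP a0] [bP b0] [cP c0].
rewrite (K0eltE (exist _ a aP)) (K0eltE (exist _ b bP)) (K0eltE (exist _ c cP)).
exact: (K0cls_add Minf (p := exist _ a aP) (q := exist _ b bP) (r := exist _ c cP)).
Qed.

Lemma K0elt_zero a : nz_proj a -> og_zero (K0 M) = K0elt a <-> padd a a a.
Proof.
move=> [aP a0]; rewrite (K0eltE (exist _ a aP)).
exact: (K0cls_zero Minf (p := exist _ a aP)).
Qed.

Lemma K0elt_unit a : nz_proj a -> og_unit (K0 M) = K0elt a <-> mvn a 1.
Proof.
move=> aP; rewrite K0cls_unit -(K0eltE (prj1 M)) (K0elt_eq (nz_proj1 M) aP).
by split; exact: mvn_sym.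
Qed.

Lemma K0elt_opp a b : nz_proj a -> nz_proj b ->
  og_opp (K0elt a) = K0elt b <-> exists x : cball M 1,
    [/\ nz_proj (proj1_sig x), padd (proj1_sig x) (proj1_sig x) (proj1_sig x)
      & padd a b (proj1_sig x)].
Proof.
move=> [aP a0] [bP b0].
rewrite (K0eltE (exist _ a aP)) (K0eltE (exist _ b bP)).
rewrite (K0cls_opp Minf (p := exist _ a aP) (q := exist _ b bP)) //; split.
  move=> [r [r0 rrr abr]]; have rP : nz_proj (proj1_sig r) by split=> //; case: (r).
  have r1 : cnorm (proj1_sig r) <= 1%:R by rewrite nz_proj_norm.
  by exists (exist _ (proj1_sig r) r1).
by move=> [x [[xP x0] xxx abx]]; exists (exist _ (proj1_sig x) xP).
Qed.

End Elt.

Lemma decides_mvn_var G (x y : var G 1%N) : decides good (@all G)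
  (fun M e => mvn (proj1_sig (lookup x e)) (proj1_sig (lookup y e))).
Proof.
have [phi phiE] := mvn_formula (C := cterms0 (fun M : cstarType R => M))
  (TVar x) (TVar y).
exists phi => M e _ De; rewrite phiE //.
  by case: (all_nz_lookup x De).
by case: (all_nz_lookup y De).
Qed.

Lemma decides_unit_var G (x : var G 1%N) : decides good (@all G)
  (fun M e => mvn (proj1_sig (lookup x e)) 1).
Proof.
have [one oneE] := ct_one (cterms0 (fun M : cstarType R => M)) G.
have [phi phiE] := mvn_formula (C := cterms0 (fun M : cstarType R => M)) (TVar x) one.
exists phi => M e _ De; rewrite phiE ?oneE //; last exact: is_proj1.
by case: (all_nz_lookup x De).
Qed.

Lemma decides_padd_var G (x y z : var G 1%N) : decides good (@all G)
  (fun M e => padd (proj1_sig (lookup x e)) (proj1_sig (lookup y e))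
    (proj1_sig (lookup z e))).
Proof.
have [phi phiE] := padd_formula (C := cterms0 (fun M : cstarType R => M))
  (TVar x) (TVar y) (TVar z).
exists phi => M e [Miso _] De; rewrite phiE //.
- by case: (all_nz_lookup x De).
- by case: (all_nz_lookup y De).
- by case: (all_nz_lookup z De).
Qed.

(** Definability of the set of nonzero projections gives a formula within [1/4] of the infimum over
    them, which is [0] or [1]. Truncating [2 r - 1/2] sends everything within [1/4] of [0] to [0]
    and of [1] to [1]. *)
Lemma decides_ex_nz G (Q : forall M, set (env (car (m := L) M) (1%N :: G))) :
  decides good (@all (1%N :: G)) Q ->
  decides good (@all G) (fun M e => exists x : cball M 1, nz_proj (proj1_sig x) /\
    Q M ((x, e) : env (car (m := L) M) (1%N :: G))).
Proof.
move=> [phi phiE].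
have [_ /(_ G (phi : formula (L := L) ([:: 1%N] ++ G)))[_ infP]] :=
  nzproj_definable (fun M : cstarType R => M).
have [|psi psiE] := infP (4^-1 : R); first by lra.
have [chi chiE] := formula_clamp 2 (- 2^-1) psi.
exists chi => M e gM De; rewrite chiE; move: (psiE M e).
rewrite (_ : inf _ = discrete_val R (exists2 x : env (car (m := L) M) [:: 1%N],
    nzproj_set (alg := fun M : cstarType R => M) x &
    Q M (env_cat x e : env (car (m := L) M) (1%N :: G)))); last first.
  apply: (@inf_on_discrete R _ (nzproj_set (alg := fun M : cstarType R => M) (M := M))
    (fun x => feval phi (env_cat x e : env (car (m := L) M) (1%N :: G)))
    (fun x => Q M (env_cat x e : env (car (m := L) M) (1%N :: G)))).
    exact: (nzproj_set_inhabited (fun M : cstarType R => M)).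
  by move=> [x []] xP; rewrite phiE.
rewrite (@discrete_val_iff R _ (exists x : cball M 1, nz_proj (proj1_sig x) /\
    Q M ((x, e) : env (car (m := L) M) (1%N :: G)))); last first.
  split; first by move=> [[x []] xP Qx]; exists x.
  by move=> [x [xP Qx]]; exists (x, tt).
set P := (X in discrete_val _ X).
have [q|q] := EM P.
  rewrite (discrete_val1 R q) subr0 ler_norml => /andP[h1 h2].
  by rewrite /clamp max_l ?min_r //; lra.
rewrite (discrete_val0 R q) ler_norml => /andP[h1 h2].
by rewrite clamp1 //; lra.
Qed.

(** Addition is only a relation between projections, so what is translated is the graph of a term;
    the values of subterms are quantified over nonzero projections. *)
Lemma og_term_decides (t : og_term) G (rho : nat -> var G 1%N) (r : var G 1%N) :
  decides good (@all G) (fun M e =>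
    og_teval (G := K0 M) (fun j => K0elt (proj1_sig (lookup (rho j) e))) t =
    K0elt (proj1_sig (lookup r e))).
Proof.
elim: t G rho r => [k|||t1 IH1 t2 IH2|t IH] G rho r.
- apply: decides_ext (decides_mvn_var (rho k) r) => M e gM De /=.
  by rewrite (K0elt_eq gM) //; exact: all_nz_lookup.
- apply: decides_ext (decides_padd_var r r r) => M e gM De /=.
  by symmetry; apply: (K0elt_zero gM); exact: all_nz_lookup.
- apply: decides_ext (decides_unit_var r) => M e gM De /=.
  by symmetry; apply: (K0elt_unit gM); exact: all_nz_lookup.
- pose x : var [:: 1%N, 1%N & G] 1%N := VS _ (VZ _ _).
  pose y : var [:: 1%N, 1%N & G] 1%N := VZ _ _.
  pose up s (v : var G s) : var [:: 1%N, 1%N & G] s := VS _ (VS _ v).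
  apply: decides_ext (decides_ex_nz (decides_ex_nz (decides_and
    (decides_and (IH1 _ (up _ \o rho) x) (IH2 _ (up _ \o rho) y))
    (decides_padd_var x y (up _ r))))) => M e gM De /=.
  have rP := all_nz_lookup r De.
  split=> [[a [aP [b [bP [[-> ->] abr]]]]]|add_r].
    exact/(K0elt_add gM).
  have [a aP aE] := K0elt_surj gM (og_teval (G := K0 M)
    (fun j => K0elt (proj1_sig (lookup (rho j) e))) t1).
  have [b bP bE] := K0elt_surj gM (og_teval (G := K0 M)
    (fun j => K0elt (proj1_sig (lookup (rho j) e))) t2).
  exists a; split=> //; exists b; split=> //; split; first by rewrite aE bE.
  by apply/(K0elt_add gM aP bP rP); rewrite aE bE.
- pose x : var [:: 1%N, 1%N & G] 1%N := VS _ (VZ _ _).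
  pose z : var [:: 1%N, 1%N & G] 1%N := VZ _ _.
  pose up s (v : var G s) : var [:: 1%N, 1%N & G] s := VS _ (VS _ v).
  apply: decides_ext (decides_ex_nz (decides_ex_nz (decides_and
    (IH _ (up _ \o rho) x)
    (decides_and (decides_padd_var z z z) (decides_padd_var x (up _ r) z)))))
    => M e gM De /=.
  have rP := all_nz_lookup r De.
  split=> [[a [aP [b [bP [-> [bbb arb]]]]]]|opp_r].
    by apply/(K0elt_opp gM aP rP); exists b.
  have [a aP aE] := K0elt_surj gM (og_teval (G := K0 M)
    (fun j => K0elt (proj1_sig (lookup (rho j) e))) t).
  have /(K0elt_opp gM aP rP)[b [bP bbb arb]] :
      og_opp (K0elt (proj1_sig a)) = K0elt (proj1_sig (lookup r e)).
    by rewrite aE.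
  by exists a; split=> //; exists b.
Qed.

(** An equation says that both terms share a value at some nonzero projection, and positivity always
    holds. A quantifier extends the context and redirects its variable to the new entry. *)
Lemma og_formula_decides (phi : og_formula) G (rho : nat -> var G 1%N) :
  decides good (@all G) (fun M e =>
    og_sat (G := K0 M) (fun j => K0elt (proj1_sig (lookup (rho j) e))) phi).
Proof.
elim: phi G rho => [t1 t2|t|phi IH|phi IH1 psi IH2|k phi IH] G rho.
- pose up s (v : var G s) : var (1%N :: G) s := VS _ v.
  apply: decides_ext (decides_ex_nz (decides_and
    (og_term_decides t1 (up _ \o rho) (VZ _ _))
    (og_term_decides t2 (up _ \o rho) (VZ _ _)))) => M e gM De /=.
  split=> [[a [aP [-> ->]]] //|t12].
  have [a aP aE] := K0elt_surj gM (og_teval (G := K0 M)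
    (fun j => K0elt (proj1_sig (lookup (rho j) e))) t1).
  by exists a; split=> //; rewrite aE -t12.
- apply: decides_ext (decides_true good (@all G)) => M e gM De.
  by split=> // _; exact: (K0_pos gM).
- exact: decides_not.
- exact: decides_and.
- pose rho' j : var (1%N :: G) 1%N := if j == k then VZ _ _ else VS _ (rho j).
  apply: decides_ext (decides_ex_nz (IH _ rho')) => M e gM De /=.
  have rhoE (a : cball M 1) : (fun j => K0elt (proj1_sig (lookup (rho' j)
      ((a, e) : env (car (m := L) M) (1%N :: G))))) =
      (fun j => if j == k then K0elt (proj1_sig a)
                else K0elt (proj1_sig (lookup (rho j) e))).
    by apply/funext => j; rewrite /rho'; case: eqP.
  split=> [[a [aP]]|[X phiX]]; first by rewrite rhoE; exists (K0elt (proj1_sig a)).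
  have [a aP aE] := K0elt_surj gM X; exists a; split=> //.
  by rewrite rhoE aE.
Qed.

End Translation.

(** * From infinite valuations to finite environments *)

Fixpoint og_term_bound (t : og_term) : nat :=
  match t with
  | OVar k => k.+1
  | OZero | OUnit => 0
  | OAdd t1 t2 => maxn (og_term_bound t1) (og_term_bound t2)
  | OOpp t => og_term_bound t
  end.

Fixpoint og_bound (phi : og_formula) : nat :=
  match phi with
  | OEq t1 t2 => maxn (og_term_bound t1) (og_term_bound t2)
  | OPos t => og_term_bound t
  | ONot phi => og_bound phi
  | OAnd phi psi => maxn (og_bound phi) (og_bound psi)
  | OEx _ phi => og_bound phi
  end.

Lemma og_teval_bound (G : ogroup) (v w : nat -> G) t :
  (forall j, (j < og_term_bound t)%N -> v j = w j) -> og_teval v t = og_teval w t.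
Proof.
elim: t => //= [k vw|t1 IH1 t2 IH2 vw|t IH vw]; first exact: vw.
  by rewrite IH1 ?IH2 // => j jt; apply: vw; rewrite leq_max jt ?orbT.
by rewrite IH.
Qed.

Lemma og_sat_bound (G : ogroup) phi (v w : nat -> G) :
  (forall j, (j < og_bound phi)%N -> v j = w j) -> og_sat v phi <-> og_sat w phi.
Proof.
elim: phi v w => /= [t1 t2|t|phi IH|phi IH1 psi IH2|k phi IH] v w vw.
- by rewrite (@og_teval_bound _ v w t1) ?(@og_teval_bound _ v w t2) // => j jt;
    apply: vw; rewrite leq_max jt ?orbT.
- by rewrite (@og_teval_bound _ v w t).
- by rewrite (IH v w).
- by rewrite (IH1 v w) ?(IH2 v w) // => j jt; apply: vw; rewrite leq_max jt ?orbT.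
- by split=> -[a aP]; exists a; move: aP; apply: (proj1 (IH _ _ _)) => j jt;
    case: eqP => // _; rewrite vw.
Qed.

Section Environments.
Variables (S : Type) (C : S -> Type) (s : S).

Fixpoint env_of (n : nat) (w : nat -> C s) : env C (nseq n s) :=
  if n is n'.+1 then (w 0%N, env_of n' (fun j => w j.+1)) else tt.

(** The context has length [n.+1], so it is nonempty and a variable exists for every [j]; indices
    beyond [n] fall on the last entry. *)
Fixpoint var_of (n j : nat) : var (nseq n.+1 s) s :=
  match n return var (nseq n.+1 s) s with
  | 0 => VZ s [::]
  | n'.+1 => if j is j'.+1 then VS s (var_of n' j') else VZ s (nseq n'.+1 s)
  end.

Lemma lookup_env_of n j (w : nat -> C s) : (j <= n)%N ->
  lookup (var_of n j) (env_of n.+1 w) = w j.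
Proof. by elim: n j w => [|n IH] [|j] w //= jn; exact: (IH j (fun j => w j.+1)). Qed.

End Environments.

Lemma lookup_env_map (S : Type) (C C' : S -> Type) (h : forall s, C s -> C' s)
    (G : seq S) s (v : var G s) (e : env C G) :
  lookup v (env_map h e) = h s (lookup v e).
Proof. by elim: v e => [{}s {}G|t {}s {}G v IH] e //=; rewrite IH. Qed.

(** * Elementary extensions *)

Section ElementaryExtension.
Variables (R : realType) (A B : cstarType R) (iota : {lrmorphism A -> B}).
Hypothesis iotaS : forall x, iota (star x) = star (iota x).
Hypothesis iotaN : forall x, cnorm (iota x) = cnorm x.
Hypothesis elem : forall (G : seq (srt (cstar_lang R))) (phi : formula G)
  (e : env (car (m := cstar_lang R) A) G),
  feval (M := A) phi e =
  feval (M := B) phi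
    (env_map (C' := car (m := cstar_lang R) B) (ball_map iotaN) e).
Hypothesis Ainf : infinite_alg A.

Let L := cstar_lang R.
Let X (M : cstarType R) := nzproj_set (alg := fun M : cstarType R => M) (M := M).

(* In [A], [inf_x |x^* p x - q|] vanishes for all nonzero projections [p], [q];
   this is expressed by formulas, so it remains small in [B]. *)
Lemma elementary_absorbing : proj_absorbing B.
Proof.
pose C := cterms0 (fun M : cstarType R => M).
pose G : seq (srt L) := [:: 1%N; 1%N; 1%N].
pose x : term (L := L) G (ct_s C 1) := TVar (VZ _ _).
pose p : term (L := L) G (ct_s C 1) := TVar (VS _ (VZ _ _)).
pose q : term (L := L) G (ct_s C 1) := TVar (VS _ (VS _ (VZ _ _))).
have [xs xsE] := ct_star x; have [xp xpE] := ct_mul xs p.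
have [xpx xpxE] := ct_mul xp x.
have [d dE] := formula_dist (C := C) (n := 1) xpx q.
(* Two suprema over nonzero projections are replaced by formulas, once in [A] and once in [B]. The
   accumulated bound [5/16] stays below the threshold [1/2] of [polar_compress]. *)
have e0 : 0 < 16^-1 :> R by lra.
have [psi psiE] := nzproj_sup (alg := fun M : cstarType R => M)
  (FInf d : formula (L := L) ([:: 1%N] ++ [:: 1%N])) e0.
have [chi chiE] := nzproj_sup (alg := fun M : cstarType R => M)
  (psi : formula (L := L) ([:: 1%N] ++ [::])) e0.
pose K (M : cstarType R) (p q : cball M 1) := inf_on setT
  (fun x : cball M 1 =>
    cnorm (star (proj1_sig x) * proj1_sig p * proj1_sig x - proj1_sig q)).
have KE (M : cstarType R) (a b : cball M 1) :
    feval (FInf d) ((a, (b, tt)) : env (car (m := L) M) [:: 1%N; 1%N]) = K M a b.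
  rewrite /= inf_setT; congr inf; apply/seteqP.
  by split=> _ [y _ ->]; exists y => //; rewrite dE xpxE xpE xsE.
have KA (a b : cball A 1) : nz_proj (proj1_sig a) -> nz_proj (proj1_sig b) ->
  K A a b = 0.
  move=> [pP p0] [qP q0]; have [w [ww pw]] := Ainf.2 _ _ pP qP p0 q0.
  have w1 : cnorm w <= 1%:R by apply: cnorm_le1; rewrite ww is_proj_norm.
  apply: (inf_on_eq0 (x := exist _ w w1)) => // [y _|]; first exact: cnorm_ge0.
  by rewrite /= -mulrA pw ww subrr cnorm0.
have chiA : feval (M := A) chi tt <= 3 * 16^-1.
  have sup1 (b : env (car (m := L) A) [:: 1%N]) : X b ->
      feval psi b <= 2 * 16^-1.
    case: b => b [] bP; have := psiE A (b, tt).
    set s := sup_on _ _; have : s <= 0.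
      apply: sup_on_le; first exact: (nzproj_set_inhabited (fun M :
        cstarType R => M)).
      by move=> [a []] aP; rewrite [feval _ _](KE A a b) KA.
    by rewrite ler_norml => h /andP[h1 h2]; lra.
  have := chiE A tt; set s := sup_on _ _; have : s <= 2 * 16^-1.
    apply: sup_on_le; first exact: (nzproj_set_inhabited (fun M : cstarType R => M)).
    by move=> [b []] bP; apply: sup1.
  by rewrite ler_norml => h /andP[h1 h2]; lra.
have chiB : feval (M := B) chi tt <= 3 * 16^-1.
  by have := elem chi tt; rewrite /= => <-.
have [[N1 psiN] _] := formula_unif (alg := fun M : cstarType R => M) psi.
have [[N2 KN] _] := formula_unif (alg := fun M : cstarType R => M) (FInf d).
move=> p' q' pP qP p0 q0.
have p1 : cnorm p' <= 1%:R by exact: is_proj_norm.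
have q1 : cnorm q' <= 1%:R by exact: is_proj_norm.
pose pb : cball B 1 := exist _ p' p1; pose qb : cball B 1 := exist _ q' q1.
have psiB : feval psi ((qb, tt) : env (car (m := L) B) [:: 1%N]) <= 4 * 16^-1.
  have := chiE B tt; set s := sup_on _ _; rewrite ler_norml => /andP[h1 h2].
  have : feval psi ((qb, tt) : env (car (m := L) B) [:: 1%N]) <= s.
    rewrite /s; set F := (X in sup_on _ X).
    apply: (@sup_on_ge R _ _ N1 F (qb, tt)) => [y _|]; last by split.
    exact: le_trans (ler_norm _) (psiN _ _).
  lra.
have KB : K B pb qb <= 5 * 16^-1.
  have := psiE B (qb, tt); set s := sup_on _ _; rewrite ler_norml => /andP[h1 h2].
  have : K B pb qb <= s.
    rewrite /s -KE; set F := (X in sup_on _ X).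
    apply: (@sup_on_ge R _ _ N2 F (pb, tt)) => [y _|]; last by split.
    exact: le_trans (ler_norm _) (KN _ _).
  lra.
have [y yP] : exists y : cball B 1,
    cnorm (star (proj1_sig y) * p' * proj1_sig y - q') <= 2^-1.
  apply: contrapT => ny; suff : 2^-1 <= K B pb qb by lra.
  apply: inf_on_ge; first by exists pb.
  move=> y _; rewrite leNgt; apply/negP => yP; apply: ny; exists y; exact: ltW.
exact: polar_compress yP.
Qed.

Lemma elementary_infinite : infinite_alg B.
Proof.
split; last exact: elementary_absorbing.
exact: (iota_orth_isometries iotaS Ainf.1).
Qed.

(** One formula computes the satisfaction of [phi] in both groups. The environment in [B] is the
    image under [iota] of the one in [A], so the elementary inclusion equates the two values. *)
Lemma K0_map_elementary (f : K0 A -> K0 B) :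
  (forall p : prj A, proj1_sig p != 0 -> f (K0cls p) = K0cls (prj_map iotaS p)) ->
  og_elementary f.
Proof.
move=> fP phi v; have Binf := elementary_infinite.
have fE (a : A) : nz_proj a -> f (K0elt a) = K0elt (iota a).
  move=> [aP a0]; rewrite (K0eltE (exist _ a aP)) fP //.
  by rewrite -K0eltE.
pose w j : cball A 1 := projT1 (cid2 (K0elt_surj Ainf (v j))).
have wP j : nz_proj (proj1_sig (w j)) by rewrite /w; case: cid2.
have wE j : K0elt (proj1_sig (w j)) = v j by rewrite /w; case: cid2.
pose n := og_bound phi; pose G : seq (srt L) := nseq n.+1 1%N.
pose rho j : var G 1%N := var_of 1%N n j.
have [psi psiE] := og_formula_decides phi rho.
pose e : env (car (m := L) A) G := env_of (C := car (m := L) A) (s := 1%N) n.+1 w.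
pose e' : env (car (m := L) B) G := env_map (C' := car (m := L) B) (ball_map iotaN) e.
have nz_env m (w0 : nat -> cball A 1) : (forall j, nz_proj (proj1_sig (w0 j))) ->
    all_nz (env_of (C := car (m := L) A) (s := 1%N) m w0) /\
    all_nz (env_map (C' := car (m := L) B) (ball_map iotaN)
      (env_of (C := car (m := L) A) (s := 1%N) m w0)).
  elim: m w0 => [|m IH] w0 w0P //=; have [h1 h2] := IH _ (fun j => w0P j.+1).
  split; split=> //; have [wP0 wn0] := w0P 0%N.
  by split; [exact: iota_proj | rewrite iota_eq0].
have [eP e'P] := nz_env n.+1 w wP.
have satA : og_sat v phi <-> og_sat (G := K0 A)
    (fun j => K0elt (proj1_sig (lookup (rho j) e))) phi.
  apply: og_sat_bound => j jn.
  by rewrite (lookup_env_of (C := car (m := L) A)) ?wE // ltnW.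
have satB : og_sat (f \o v) phi <-> og_sat (G := K0 B)
    (fun j => K0elt (proj1_sig (lookup (rho j) e'))) phi.
  apply: og_sat_bound => j jn.
  rewrite lookup_env_map (lookup_env_of (C := car (m := L) A)); last exact: ltnW.
  by rewrite /= -wE fE.
rewrite satA satB; apply: (@discrete_val_inj R).
by rewrite -psiE // -psiE // elem.
Qed.

End ElementaryExtension.

Theorem proposition3p11p2 (R : realType) (A : cstarType R)
    (hA : purely_infinite_simple A) :
  in_Aeq A (K0 A) /\
  forall (B : cstarType R) (iota : {lrmorphism A -> B}),
    elementary_inclusion iota ->
    exists f : K0 A -> K0 B, K0_induced iota f /\ og_elementary f.
Proof.
have Ainf := pis_infinite hA; split; first exact: K0_in_Aeq.
move=> B iota [iotaS [iotaN elem]].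
have Binf := elementary_infinite iotaS elem Ainf.
have [f fP] := K0_map_ex iotaS iotaN Ainf.1 Ainf.2 Binf.2.
exists f; split.
  exact: (K0_map_induced iotaN Ainf.1 Ainf.2 Binf.2 fP).
exact: (K0_map_elementary elem Ainf fP).
Qed.
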